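(* Let $1\le p<+\infty$, $p\ne 2$, and let $Y$ be a unital subspace of $L_p=L_p[0,1]$. Then $$\mathrm{Env}(Y)=\mathrm{Lat}(Y)=\mathrm{Env}_{\mathrm c}(Y)=\mathrm{Env}_{\min}(Y).$$
   Context: $L_p[0,1]$ is taken with Lebesgue measure. A subspace is unital if it contains the constant function $\mathbf 1_{[0,1]}$. $\mathrm{Env}(Y)$ (isometric envelope) is the set of $x\in L_p$ such that whenever a net $(T_i)_i$ of surjective linear isometries of $L_p$ satisfies $T_iy\to y$ for every $y\in Y$, then $T_ix\to x$ in norm. $\mathrm{Lat}(Y)$ is the closed sublattice of $L_p$ generated by $Y$. $\mathrm{Env}_{\mathrm c}(Y)$ (conditional envelope) is $L_p([0,1],\Sigma_Y)$, the subspace of $\Sigma_Y$-measurable functions in $L_p[0,1]$, where $\Sigma_Y$ is the smallest $\sigma$-algebra (of measurable subsets of $[0,1]$, modulo null sets) making all functions of $Y$ measurable. $\mathrm{Env}_{\min}(Y)$ is the smallest $1$-complemented subspace of $L_p$ containing $Y$ (its existence here is part of the statement), where $1$-complemented means being the range of a contractive linear projection on $L_p$. *)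

(* Defs.v *)
From HB Require Import structures.
From mathcomp Require Import all_boot all_order all_algebra.
From mathcomp Require Import all_classical all_reals all_analysis.
From mathcomp Require Import ess_sup_inf measurable_realfun.

Set Implicit Arguments.
Unset Strict Implicit.
Unset Printing Implicit Defensive.
Import Order.TTheory GRing.Theory Num.Theory.
Import numFieldNormedType.Exports.
Local Open Scope classical_set_scope.
Local Open Scope ring_scope.
Local Open Scope quotient_scope.

(* The library provides [LspaceType mu p1], the type of classes of p-integrable
   functions modulo equality mu-almost everywhere, as a bare type.  This section
   equips it with its normed module structure, computed on representatives. *)
Section Lspace_normed_module.
Context d (T : measurableType d) (R : realType).
Variables (mu : {measure set T -> \bar R}) (p : \bar R) (p1 : (1 <= p)%E).
Local Notation V := (LspaceType mu p1).
Local Notation F := (LfunType mu p1).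
Local Notation Q := {mfun_ mu, T >-> measurableTypeR R}.

Lemma Lnorm_ae_eq (f g : T -> R) :
  measurable_fun [set: T] f -> measurable_fun [set: T] g ->
  f = g %[ae mu] -> ('N[mu]_p[EFin \o f] = 'N[mu]_p[EFin \o g])%E.
Proof.
move=> mf mg fg; rewrite unlock /Lnorm; case: p p1 => [r r1| _|//].
- have mr (h : T -> R) : measurable_fun [set: T] h ->
    measurable_fun [set: T] (fun x => (`|(EFin \o h) x| `^ r)%E).
    move=> mh; apply: (measurableT_comp (measurable_poweR _)) => //.
    by apply: measurableT_comp => //; exact: measurableT_comp.
  congr (_ `^ _)%E; apply: ge0_ae_eq_integral => //.
  + exact: mr.
  + exact: mr.
  + by move=> x _; rewrite poweR_ge0.
  + by move=> x _; rewrite poweR_ge0.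
  + by apply: filterS fg => x /= /(_ I) ->.
- case: ifPn => // _; apply: eq_ess_sup.
  by apply: filterS fg => x /= /(_ I) ->.
Qed.

(* [R] and [measurableTypeR R] have the same measurable sets but different
   displays, hence this repackaging. *)
Definition mfun_of_Lfun (f : F) : {mfun T >-> measurableTypeR R} :=
  HB.pack (f : T -> measurableTypeR R)
    (isMeasurableFun.Build _ _ T (measurableTypeR R) f (measurable_funPT f)).

Lemma repr_pi_ae_eq (f : F) :
  (repr (\pi_Q (mfun_of_Lfun f)) : T -> R) = f %[ae mu].
Proof.
have /eqmodP/asboolP// :
  repr (\pi_Q (mfun_of_Lfun f)) = mfun_of_Lfun f %[mod Q].
by rewrite reprK.
Qed.

Lemma Lspace_pi_subproof (f : F) :
  finite_norm mu p (\pi_Q (mfun_of_Lfun f) : Q).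
Proof.
rewrite /finite_norm (Lnorm_ae_eq _ _ (repr_pi_ae_eq f)).
- exact: Lfunction_finite.
- exact: measurable_funPT (repr (\pi_Q (mfun_of_Lfun f))).
- exact: measurable_funPT f.
Qed.

Definition Lspace_pi (f : F) : V :=
  HB.pack (\pi_Q (mfun_of_Lfun f))
    (isFinLebesgue.Build d T R mu p p1 _ (Lspace_pi_subproof f)).

Lemma Lspace_repr_subproof (x : V) :
  (repr (x : Q) : T -> R) \in Lfun mu p.
Proof.
rewrite inE; apply/andP; split; rewrite inE.
  exact: measurable_funPT (repr (x : Q)).
exact: (@Lebesgue_finite _ _ _ _ _ _ x).
Qed.

Definition Lspace_repr (x : V) : F := Lfun_Sub p1 (Lspace_repr_subproof x).

Lemma Lspace_val_inj (x y : V) : x = y :> Q -> x = y.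
Proof.
case: x y => x [[xf]] [y [[yf]]] /= xy; rewrite xy in xf *.
by rewrite (Prop_irrelevance xf yf).
Qed.

Lemma Lspace_piP (f g : F) : Lspace_pi f = Lspace_pi g <-> f = g %[ae mu].
Proof.
split=> [fg|fg].
  have : \pi_Q (mfun_of_Lfun f) = \pi_Q (mfun_of_Lfun g).
    by rewrite -[LHS]/(LebesgueSpace.sort (Lspace_pi f)) fg.
  by move/eqmodP/asboolP.
by apply: Lspace_val_inj; apply/eqmodP/asboolP.
Qed.

Lemma Lspace_reprK : cancel Lspace_repr Lspace_pi.
Proof.
move=> x; apply: Lspace_val_inj; rewrite -[RHS]reprK.
by apply/eqmodP/asboolP; exact: filterE.
Qed.

Lemma Lspace_piK (f : F) : Lspace_repr (Lspace_pi f) = f %[ae mu].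
Proof. by apply/Lspace_piP; rewrite Lspace_reprK. Qed.

HB.instance Definition _ := gen_eqMixin V.
HB.instance Definition _ := gen_choiceMixin V.

Definition Lspace_zero : V := Lspace_pi 0.
Definition Lspace_opp (x : V) : V := Lspace_pi (- Lspace_repr x).
Definition Lspace_add (x y : V) : V :=
  Lspace_pi (Lspace_repr x + Lspace_repr y).
Definition Lspace_scale (a : R) (x : V) : V := Lspace_pi (a *: Lspace_repr x).
Definition Lspace_norm (x : V) : R :=
  fine ('N[mu]_p[EFin \o Lspace_repr x])%E.

Lemma Lspace_piD (f g : F) :
  Lspace_pi (f + g) = Lspace_add (Lspace_pi f) (Lspace_pi g).
Proof.
apply/Lspace_piP.
apply: filterS2 (Lspace_piK f) (Lspace_piK g) => t /(_ I) ft /(_ I) gt _.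
by rewrite -[RHS]/(Lspace_repr (Lspace_pi f) t + Lspace_repr (Lspace_pi g) t)
  ft gt.
Qed.

Lemma Lspace_piN (f : F) : Lspace_pi (- f) = Lspace_opp (Lspace_pi f).
Proof.
apply/Lspace_piP; apply: filterS (Lspace_piK f) => t /(_ I) ft _.
by rewrite -[RHS]/(- Lspace_repr (Lspace_pi f) t) ft.
Qed.

Lemma Lspace_piZ a (f : F) : Lspace_pi (a *: f) = Lspace_scale a (Lspace_pi f).
Proof.
apply/Lspace_piP; apply: filterS (Lspace_piK f) => t /(_ I) ft _.
by rewrite -[RHS]/(a *: Lspace_repr (Lspace_pi f) t) ft.
Qed.

Fact Lspace_addA : associative Lspace_add.
Proof.
move=> x y z; rewrite -[x]Lspace_reprK -[y]Lspace_reprK -[z]Lspace_reprK.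
by rewrite -!Lspace_piD addrA.
Qed.

Fact Lspace_addC : commutative Lspace_add.
Proof. by move=> x y; rewrite /Lspace_add addrC. Qed.

Fact Lspace_add0 : left_id Lspace_zero Lspace_add.
Proof.
by move=> x; rewrite -[x]Lspace_reprK -Lspace_piD add0r.
Qed.

Fact Lspace_addN : left_inverse Lspace_zero Lspace_opp Lspace_add.
Proof.
by move=> x; rewrite -[x]Lspace_reprK -Lspace_piN -Lspace_piD addNr.
Qed.

HB.instance Definition _ := GRing.isZmodule.Build V
  Lspace_addA Lspace_addC Lspace_add0 Lspace_addN.

Fact Lspace_scaleA a b (x : V) :
  Lspace_scale a (Lspace_scale b x) = Lspace_scale (a * b) x.
Proof. by rewrite -[x]Lspace_reprK -!Lspace_piZ scalerA. Qed.

Fact Lspace_scale1 : left_id 1 Lspace_scale.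
Proof. by move=> x; rewrite -[x]Lspace_reprK -Lspace_piZ scale1r. Qed.

Fact Lspace_scaleDr : right_distributive Lspace_scale Lspace_add.
Proof.
move=> a x y; rewrite -[x]Lspace_reprK -[y]Lspace_reprK.
by rewrite -Lspace_piD -!Lspace_piZ -Lspace_piD scalerDr.
Qed.

Fact Lspace_scaleDl (x : V) : {morph Lspace_scale^~ x : a b / a + b >-> Lspace_add a b}.
Proof.
move=> a b /=; rewrite -[x]Lspace_reprK -!Lspace_piZ scalerDl.
by rewrite Lspace_piD.
Qed.

HB.instance Definition _ :=
  GRing.Zmodule_isLmodule.Build R V
    Lspace_scaleA Lspace_scale1 Lspace_scaleDr Lspace_scaleDl.

Lemma Lspace_normE (f : F) :
  Lspace_norm (Lspace_pi f) = fine ('N[mu]_p[EFin \o f])%E.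
Proof.
congr fine; apply: Lnorm_ae_eq (Lspace_piK f).
- exact: measurable_funPT (Lspace_repr (Lspace_pi f)).
- exact: measurable_funPT f.
Qed.

Fact Lspace_normD (x y : V) : Lspace_norm (x + y) <= Lspace_norm x + Lspace_norm y.
Proof. by rewrite Lspace_normE ler_LnormD. Qed.

Fact Lspace_normZ a (x : V) : Lspace_norm (a *: x) = `|a| * Lspace_norm x.
Proof.
rewrite Lspace_normE; apply/EFin_inj; rewrite EFinM.
by rewrite !finite_norm_fine LnormZ.
Qed.

Fact Lspace_norm0_eq0 (x : V) : Lspace_norm x = 0 -> x = 0.
Proof.
move=> /fine_Lnormr_eq0 x0; rewrite -[x]Lspace_reprK.
exact/Lspace_piP.
Qed.

HB.instance Definition _ :=
  Lmodule_isNormed.Build R V Lspace_normD Lspace_normZ Lspace_norm0_eq0.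

End Lspace_normed_module.

Section sublattices_and_sigma_algebras.
Context d (T : measurableType d) (R : realType).
Variables (mu : {measure set T -> \bar R}) (p : \bar R) (p1 : (1 <= p)%E).
Local Notation V := (LspaceType mu p1).
Local Notation F := (LfunType mu p1).

Lemma Lfun_abs_subproof (f : F) : (Num.norm \o f : T -> R) \in Lfun mu p.
Proof.
rewrite inE; apply/andP; split; rewrite inE/=.
  by apply: measurableT_comp => //; exact: measurable_funPT f.
rewrite /finite_norm (_ : _ \o _ = abse \o (EFin \o f))// Lnorm_abse.
exact: Lfunction_finite.
Qed.

Lemma Lfun_max_subproof (f g : F) : (f \max g : T -> R) \in Lfun mu p.
Proof.
pose h : F := 2^-1 *: (f + g + Lfun_Sub p1 (Lfun_abs_subproof (f - g))).
rewrite (_ : f \max g = h); first exact: LfunP.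
by apply/funext => t; rewrite /= maxr_absE mulrC.
Qed.

Lemma Lfun_min_subproof (f g : F) : (f \min g : T -> R) \in Lfun mu p.
Proof.
pose h : F := 2^-1 *: (f + g - Lfun_Sub p1 (Lfun_abs_subproof (f - g))).
rewrite (_ : f \min g = h); first exact: LfunP.
by apply/funext => t; rewrite /= minr_absE mulrC.
Qed.

Definition Lspace_join (x y : V) : V :=
  Lspace_pi (Lfun_Sub p1 (Lfun_max_subproof (Lspace_repr x) (Lspace_repr y))).

Definition Lspace_meet (x y : V) : V :=
  Lspace_pi (Lfun_Sub p1 (Lfun_min_subproof (Lspace_repr x) (Lspace_repr y))).

Definition closed_sublattice (L : set V) :=
  [/\ submod_closed (mem L),
      forall x y, L x -> L y -> L (Lspace_join x y),
      forall x y, L x -> L y -> L (Lspace_meet x y)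
    & closed L].

Definition Lat (Y : set V) : set V := smallest closed_sublattice Y.

(* Working modulo null sets is rendered by putting all the measurable null sets
   in the sigma-algebra; accordingly, which representatives are used does not
   matter. *)
Definition Sigma_generators (Y : set V) : set (set T) :=
  [set N | measurable N /\ mu N = 0] `|`
  \bigcup_(f in [set f : F | Y (Lspace_pi f)])
    preimage_set_system [set: T] f measurable.

Definition Env_c (Y : set V) : set V :=
  [set x | exists2 f : F,
    measurable_fun [set: g_sigma_algebraType (Sigma_generators Y)] f &
    x = Lspace_pi f].

End sublattices_and_sigma_algebras.

Section Lspace_one.
Context d (T : measurableType d) (R : realType).
Variables (mu : {finite_measure set T -> \bar R}) (p : R) (p1 : (1 <= p%:E)%E).

Definition Lspace_one : LspaceType mu p1 :=
  Lspace_pi (Lfun_Sub p1 (Lfun_cst mu 1 p)).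

End Lspace_one.

Section nets.
Context (I : Type) (le : I -> I -> Prop).

Definition directed :=
  [/\ inhabited I, forall i, le i i,
      forall i j k, le i j -> le j k -> le i k
    & forall i j, exists k, le i k /\ le j k].

Definition tails : set_system I :=
  filter_from [set: I] (fun i => [set j | le i j]).

End nets.

Section envelopes.
Context (R : realType) (X : normedModType R).

Definition surjective_isometry (T : {linear X -> X}) :=
  (forall x, `|T x| = `|x|) /\ (forall y, exists x, T x = y).

Definition Env (Y : set X) : set X :=
  [set x | forall (I : Type) (le : I -> I -> Prop) (T : I -> {linear X -> X}),
    directed le -> (forall i, surjective_isometry (T i)) ->
    (forall y, Y y -> T i y @[i --> tails le] --> y) ->
    T i x @[i --> tails le] --> x].

Definition one_complemented (Z : set X) :=
  exists P : {linear X -> X},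
    [/\ forall x, P (P x) = P x, forall x, `|P x| <= `|x| & Z = range P].

Definition is_Env_min (Y Z : set X) :=
  [/\ one_complemented Z, Y `<=` Z
    & forall W, one_complemented W -> Y `<=` W -> Z `<=` W].

End envelopes.

Section lebesgue01.
Context (R : realType).

Lemma lebesgue_measure01_fin :
  ((@lebesgue_measure R) `[0%R, 1%R] < +oo)%E.
Proof. by rewrite lebesgue_measure_itv/= lte_fin ltr01 oppr0 adde0 ltry. Qed.

(* Lebesgue measure on [0,1], carried by the real line: everything outside
   [0,1] is null. *)
Definition lebesgue01 : {finite_measure set (measurableTypeR R) -> \bar R} :=
  @mfrestr _ (measurableTypeR R) R _ lebesgue_measure
    (measurable_itv `[0%R, 1%R]) lebesgue_measure01_fin.

End lebesgue01.

(* Main.v *)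
From HB Require Import structures.
Require Import Defs.
From mathcomp Require Import all_boot all_order all_algebra.
From mathcomp Require Import fingroup perm finmap.
From mathcomp Require Import all_classical all_reals all_analysis.
From mathcomp Require Import measurable_realfun.
From mathcomp Require Import ring lra.

(** Everything is compared with the conditional envelope [Env_c Y], the space of
the functions measurable for the sigma-algebra generated by [Y].

_Lattice envelope._  Conditional expectation is a contraction of L_p, so that
[Env_c Y] is one-complemented, hence closed, and it is plainly a lattice
containing [Y].  Conversely, let [L] be a closed sublattice containing 1.  For
[f] in [L], the indicator of [f > c] is the limit of [min (n (f - c)^+) 1], so it
belongs to [L]; therefore the sets whose indicator is in [L] form a sigma-algebra
for which the members of [L] are measurable, and all the p-integrable functions
measurable for it are in [L].  Thus [Env_c Y] is included in every closed
sublattice containing [Y] ([Env_c_sub], [Lat_Env_c]).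

_Minimal envelope._  By [Env_c_sub] it is enough that the range [W] of a
contractive projection [P] fixing 1 be a lattice ([one_complemented_sublattice]).
For p = 1, comparing the norms of [f], [n - f] and of their images shows that [P]
is positive, and then [P |w|] is above [|w|] without having a larger norm.  For
p > 1, let [J_p f = sg f |f|^(p-1)] be the duality map, and let [M] be the space
of those functionals [phi] in L_q such that [phi P = phi].  Differentiating the
norm gives [J_p W] inside [M], and strict convexity gives [J_q M] inside [W].
Both spaces are linear while [J_p] is not when p is not 2, and this is what makes
room for nonlinear operations: if p > 2, if [f] and [|f|^g] are in [W], then
the derivative of [J_p] at [f] along [|f|^g], which is [(p-1) |f|^(p-2+g)], is in
[M], and its image by [J_q] is proportional to [|f|^(1 - (1-g)/(p-1))].  Starting
from [g = 0] and iterating, the exponent tends to 1, and [|f|] is in [W].  If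
p < 2, the same argument runs in [M], with exponent q > 2.

_Conditional envelope inside the isometric one._  For p not 2, the integrand in
the Clarkson inequality has a constant sign and vanishes only where [x y = 0], so
that linear isometries preserve disjointness ([disj_isometry]).  As 1 is the
disjoint sum of the indicators of a set and of its complement, the image of a
nonnegative function has everywhere the sign of [U 1], whence
[U |x| = sg (U 1) |U x|] ([isometry_vabs]).  If [U_i 1] tends to 1 and [U_i x] to
[x], it follows that [U_i |x|] tends to [|x|]: the points of convergence of a net
form a closed sublattice containing 1, and [Env_c_sub] applies.

_Isometric envelope inside the conditional one._  If [x] is in [Env Y] then, for
each [e > 0], there are a finite part [s] of [Y] and [eta > 0] such that every
isometry moving [s] by less than [eta] moves [x] by less than [e]; otherwise the
counterexamples, indexed by [s] and [eta], would form a net converging on [Y] but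
not at [x] ([Env_finite]).  Up to small errors, the
elements of [s] are functions of finitely many sets [A] measurable for the
sigma-algebra of [Y], while [x] is a step function on a partition of the unit
interval in cells of equal length, so fine that each [A] is nearly a union of
cells.  Call colour of a cell the list of the [A] that contain it.  Permuting
cells of the same colour gives an isometry which almost fixes [s], hence [x];
averaging [x] over all these permutations, [x] is close to a step function
depending only on the colour, that is, to a function of the sets [A]
([Env_c_approx]).  So [x] is in the closed space [Env_c Y]. *)

Set Implicit Arguments.
Unset Strict Implicit.
Unset Printing Implicit Defensive.
Import Order.TTheory GRing.Theory Num.Theory.
Import numFieldNormedType.Exports.
Local Open Scope classical_set_scope.
Local Open Scope ring_scope.

(** * Classes of p-integrable functions *)

Section classes.
Context d (T : measurableType d) (R : realType).
Variables (mu : {finite_measure set T -> \bar R}) (p : R).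
Hypothesis p1 : (1 <= p%:E)%E.
Local Notation V := (LspaceType mu p1).
Local Notation F := (LfunType mu p1).
Local Notation Lp := (Lfun mu p%:E).
Implicit Types f g h : T -> R.

Lemma aeI (P Q : T -> Prop) : {ae mu, forall t, P t} -> {ae mu, forall t, Q t} ->
  {ae mu, forall t, P t /\ Q t}.
Proof. by move=> HP HQ; apply: filterS2 HP HQ. Qed.

Lemma ae_imply (P Q : T -> Prop) : (forall t, P t -> Q t) ->
  {ae mu, forall t, P t} -> {ae mu, forall t, Q t}.
Proof. by move=> PQ; apply: filterS. Qed.

Lemma Rintegral_ge0_eq0 f : mu.-integrable [set: T] (EFin \o f) ->
  (forall t, 0 <= f t) -> \int[mu]_t f t <= 0 -> f = (fun=> 0) %[ae mu].
Proof.
move=> iF f0 int0; have mf : measurable_fun [set: T] (EFin \o f).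
  exact: measurable_int iF.
have : (\int[mu]_t `|(f t)%:E| = 0)%E.
  transitivity (\int[mu]_t (f t)%:E)%E.
    by apply: eq_integral => t _; rewrite gee0_abs// lee_fin.
  rewrite -[LHS]fineK ?(integrable_fin_num _ iF)//.
  by congr EFin; apply/eqP; rewrite eq_le int0 Rintegral_ge0.
move/(ae_eq_integral_abs mu measurableT mf); apply: filterS => t /(_ I)[] -> //.
Qed.

Lemma p_ge1 : 1 <= p. Proof. by rewrite -lee_fin. Qed.
Lemma p_gt0 : 0 < p. Proof. exact: lt_le_trans p_ge1. Qed.
Lemma p_neq0 : p != 0. Proof. by rewrite gt_eqF// p_gt0. Qed.

(** A total function on all real functions, with junk value 0 outside L_p, so that
membership in L_p becomes a side condition instead of an argument. *)
Definition cls f : V :=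
  if pselect (f \in Lp) is left h then Lspace_pi (Lfun_Sub p1 h) else 0.

Lemma clsE (f : F) : cls f = Lspace_pi f.
Proof.
rewrite /cls; case: pselect => [h|/(_ (LfunP f))//].
by congr Lspace_pi; apply: val_inj.
Qed.

Lemma Lp_repr (x : V) : (Lspace_repr x : T -> R) \in Lp.
Proof. exact: LfunP. Qed.

Lemma cls_repr (x : V) : cls (Lspace_repr x) = x.
Proof. by rewrite clsE Lspace_reprK. Qed.

Lemma clsP f g : f \in Lp -> g \in Lp -> cls f = cls g <-> f = g %[ae mu].
Proof.
move=> hf hg; rewrite -[f](Lfun_valP p1 hf) -[g](Lfun_valP p1 hg) !clsE.
exact: Lspace_piP.
Qed.

Lemma repr_cls f : f \in Lp -> Lspace_repr (cls f) = f %[ae mu].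
Proof. by move=> hf; apply/clsP => //; [exact: Lp_repr|rewrite cls_repr]. Qed.

Lemma Lp_measurable f : f \in Lp -> measurable_fun [set: T] f.
Proof. by rewrite inE => /andP[]; rewrite inE. Qed.

Lemma LpD f g : f \in Lp -> g \in Lp -> (fun x => f x + g x) \in Lp.
Proof.
move=> hf hg; exact: (LfunP (Lfun_Sub p1 hf + Lfun_Sub p1 hg)).
Qed.

Lemma LpB f g : f \in Lp -> g \in Lp -> (fun x => f x - g x) \in Lp.
Proof.
move=> hf hg; exact: (LfunP (Lfun_Sub p1 hf - Lfun_Sub p1 hg)).
Qed.

Lemma LpZ a f : f \in Lp -> (fun x => a * f x) \in Lp.
Proof. by move=> hf; exact: (LfunP (a *: Lfun_Sub p1 hf)). Qed.

Lemma Lp_abs f : f \in Lp -> (fun x => `|f x|) \in Lp.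
Proof. by move=> hf; exact: (Lfun_abs_subproof (Lfun_Sub p1 hf)). Qed.

Lemma Lp_cst a : (fun=> a) \in Lp.
Proof. exact: Lfun_cst. Qed.

Lemma clsD f g : f \in Lp -> g \in Lp ->
  cls (fun x => f x + g x) = cls f + cls g.
Proof.
move=> hf hg; rewrite -[f](Lfun_valP p1 hf) -[g](Lfun_valP p1 hg) !clsE.
by rewrite -[RHS]Lspace_piD -clsE.
Qed.

Lemma clsZ a f : f \in Lp -> cls (fun x => a * f x) = a *: cls f.
Proof.
move=> hf; rewrite -[f](Lfun_valP p1 hf) !clsE.
by rewrite -[RHS]Lspace_piZ -clsE.
Qed.

Lemma clsB f g : f \in Lp -> g \in Lp ->
  cls (fun x => f x - g x) = cls f - cls g.
Proof.
move=> hf hg; rewrite -scaleN1r -clsZ// -clsD ?LpZ//.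
by congr cls; apply/funext => t; rewrite mulN1r.
Qed.

Lemma cls0 : cls (fun=> 0) = 0.
Proof.
have /(_ 0) := @clsZ^~ (fun=> 0); rewrite scale0r => <-; last exact: Lp_cst.
by congr cls; apply/funext => t; rewrite mul0r.
Qed.

Lemma cls1 : cls (fun=> 1) = Lspace_one mu p1.
Proof. by rewrite /Lspace_one -clsE. Qed.

Lemma measurable_powR_abs f : measurable_fun [set: T] f ->
  measurable_fun [set: T] (fun x => (`|f x| `^ p)).
Proof.
move=> mf; apply: (measurableT_comp (measurable_powR p)).
exact: measurableT_comp.
Qed.

Lemma Lp_int f : measurable_fun [set: T] f ->
  f \in Lp <-> mu.-integrable [set: T] (EFin \o (fun x => `|f x| `^ p)).
Proof.
move=> mf; split => [/(Lfun_integrable p_ge1)//|/integrableP[_ fi]].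
rewrite inE; apply/andP; split; rewrite inE// /= /finite_norm unlock.
apply: poweR_lty; apply: le_lt_trans fi.
by under [leRHS]eq_integral do rewrite /= ger0_norm ?powR_ge0//.
Qed.

Lemma integrable_Lp f : f \in Lp ->
  mu.-integrable [set: T] (EFin \o (fun x => `|f x| `^ p)).
Proof. by move=> hf; apply/Lp_int => //; exact: Lp_measurable. Qed.

Lemma norm_cls f : f \in Lp -> `|cls f| `^ p = \int[mu]_x (`|f x| `^ p).
Proof.
move=> hf; rewrite -[f in cls f](Lfun_valP p1 hf) clsE.
rewrite -[X in X `^ _]/(Lspace_norm _) Lspace_normE.
rewrite /Rintegral unlock /= -fine_poweR -poweRrM mulVf ?p_neq0// poweRe1//.
by apply: integral_ge0 => x _; rewrite lee_fin powR_ge0.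
Qed.

Lemma le_norm_powR (a b : R) : 0 <= a -> 0 <= b ->
  (a `^ p <= b `^ p) = (a <= b).
Proof.
move=> a0 b0; apply/idP/idP => [|ab]; last first.
  by apply: (ge0_ler_powR (ltW p_gt0)).
by apply: contraTT; rewrite -!ltNge => ba; apply: (gt0_ltr_powR p_gt0).
Qed.

Lemma le_Lp f g : measurable_fun [set: T] f -> g \in Lp ->
  (forall x, `|f x| <= `|g x|) -> f \in Lp.
Proof.
move=> mf hg fg; apply/Lp_int => //.
apply: le_integrable (integrable_Lp hg) => //=.
  by apply/measurable_EFinP; exact: measurable_powR_abs.
move=> x _; rewrite lee_fin !(ger0_norm (powR_ge0 _ _)).
by rewrite le_norm_powR.
Qed.

Lemma le_norm_cls f g : f \in Lp -> g \in Lp ->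
  {ae mu, forall x, `|f x| <= `|g x|} -> `|cls f| <= `|cls g|.
Proof.
move=> hf hg fg; rewrite -le_norm_powR// !norm_cls//.
rewrite /Rintegral; apply: fine_le;
  try by apply: integrable_fin_num => //; exact: integrable_Lp.
apply: ae_ge0_le_integral => //.
- by apply/measurable_EFinP/measurable_powR_abs/Lp_measurable.
- by apply/measurable_EFinP/measurable_powR_abs/Lp_measurable.
by apply: filterS fg => x fg _; rewrite lee_fin le_norm_powR.
Qed.

Lemma eq_norm_cls f g : f \in Lp -> g \in Lp ->
  {ae mu, forall x, `|f x| = `|g x|} -> `|cls f| = `|cls g|.
Proof.
move=> hf hg fg; apply/eqP; rewrite eq_le !le_norm_cls//.
  by apply: filterS fg => x ->.
by apply: filterS fg => x ->.
Qed.

(** Convergence to 0 in norm can be tested on p-th powers, which are integrals. *)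
Lemma powR_cvg0n (u : nat -> R) : (forall n, 0 <= u n) -> 
  (u n `^ p) @[n --> \oo] --> 0 <-> u @ \oo --> 0.
Proof.
have key (v : nat -> R) q : 0 < q -> (forall n, 0 <= v n) ->
  v @ \oo --> 0 -> (v n `^ q) @[n --> \oo] --> 0.
  move=> q0 v0 /cvgrPdist_lt cv; apply/cvgrPdist_lt => e e0.
  have e1 : 0 < e `^ q^-1 by rewrite powR_gt0.
  near=> n; have : `|0 - v n| < e `^ q^-1 by near: n; exact: cv.
  rewrite !sub0r !normrN (ger0_norm (v0 n)) (ger0_norm (powR_ge0 _ _)) => ve.
  rewrite -[e]powRr1 ?ltW// -(mulVf (lt0r_neq0 q0)) powRrM.
  by apply: gt0_ltr_powR => //; rewrite nnegrE// powR_ge0.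
move=> u0; split; last exact: key (p_gt0) u0.
move/(key _ p^-1); rewrite invr_gt0 => /(_ p_gt0) h.
have -> : u = fun n => (u n `^ p) `^ p^-1.
  by apply/funext => n; rewrite -powRrM mulfV ?p_neq0// powRr1.
by apply: h => n; rewrite powR_ge0.
Unshelve. all: by end_near. Qed.

Lemma powR_dist_le (a b c : R) : `|a| <= c -> `|b| <= c ->
  `|a - b| `^ p <= 2 `^ p * c `^ p.
Proof.
move=> ac bc; have c0 : 0 <= c by exact: le_trans ac.
rewrite -powRM// le_norm_powR ?mulr_ge0//.
by rewrite (le_trans (ler_normB _ _))// mulr_natl mulr2n lerD.
Qed.

(** Everywhere domination and convergence suffice below: the functions that are
approximated are honest functions, not classes. *)
Lemma Rdominated_convergence (f_ : nat -> T -> R) f g :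
  (forall n, measurable_fun [set: T] (f_ n)) ->
  mu.-integrable [set: T] (EFin \o g) ->
  (forall n x, `|f_ n x| <= g x) ->
  (forall x, f_ n x @[n --> \oo] --> f x) ->
  mu.-integrable [set: T] (EFin \o f) /\
  \int[mu]_x f_ n x @[n --> \oo] --> \int[mu]_x f x.
Proof.
move=> mf_ ig fg ff.
have mf : measurable_fun [set: T] f.
  by apply: (measurable_fun_cvg mf_) => x _; exact: ff.
have ffE x : EFin (f_ n x) @[n --> \oo] --> EFin (f x) by exact: cvg_EFin (nearW _ _) (ff x).
have [intf _ cf] := @dominated_convergence _ _ _ mu _ measurableT
  (fun n => EFin \o f_ n) (EFin \o f) (EFin \o g)
  (fun n => (measurable_EFinP _ _).2 (mf_ n)) ((measurable_EFinP _ _).2 mf)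
  (aeW _ (fun x _ => ffE x)) ig
  (aeW _ (fun x n _ => fg n x)).
split=> //; apply: fine_cvg; rewrite fineK//.
exact: integrable_fin_num intf.
Qed.

(** Dominated convergence in L_p, to which all the truncation arguments below reduce. *)
Lemma cvg_cls (f_ : nat -> T -> R) f g :
  (forall n, measurable_fun [set: T] (f_ n)) -> g \in Lp ->
  (forall n x, `|f_ n x| <= g x) ->
  (forall x, f_ n x @[n --> \oo] --> f x) ->
  [/\ forall n, f_ n \in Lp, f \in Lp & cls (f_ n) @[n --> \oo] --> cls f].
Proof.
move=> mf_ hg fg ff.
have mf : measurable_fun [set: T] f.
  by apply: (measurable_fun_cvg mf_) => x _; exact: ff.
have fg' x : `|f x| <= g x.
  have /cvg_lim <- // : (`|f_ n x| @[n --> \oo] --> `|f x|) by exact: cvg_norm.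
  apply: limr_le; last exact: nearW.
  by apply/cvg_ex; exists (`|f x|); exact: cvg_norm.
have leg a x : `|a| <= g x -> `|a| <= `|g x|.
  by move=> ag; rewrite (le_trans ag)// ler_norm.
have f_L n : f_ n \in Lp by apply: le_Lp (mf_ n) hg _ => x; exact: leg.
have fL : f \in Lp by apply: le_Lp mf hg _ => x; exact: leg.
split=> //; apply/subr_cvg0/norm_cvg0P/powR_cvg0n => //.
under eq_fun => n do rewrite -clsB// norm_cls ?LpB//.
set h := fun n x => `|f_ n x - f x| `^ p.
have mh n : measurable_fun [set: T] (h n).
  by apply: measurable_powR_abs; exact: measurable_funB.
have ig : mu.-integrable [set: T] (EFin \o (fun x => 2 `^ p * `|g x| `^ p)).
  apply: (eq_integrable measurableT (fun x => (2 `^ p)%:E * (`|g x| `^ p)%:E))%E => //.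
  by apply: integrableZl => //; exact: integrable_Lp.
have [||_] := @Rdominated_convergence h (cst 0) _ mh ig.
- move=> n x; rewrite /h ger0_norm ?powR_ge0// powR_dist_le ?leg//.
- move=> x; apply/(powR_cvg0n (fun n => normr_ge0 _))/norm_cvg0P.
  exact/subr_cvg0.
by rewrite Rintegral_cst// mul0r.
Qed.

End classes.

(** * Closed unital sublattices *)

Section measurable_induction.
Import HBNNSimple.
Context d (T : measurableType d) (R : realType).
Implicit Types (f g : T -> R) (Phi : (T -> R) -> Prop).

(** Nonnegative simple functions approximate [f0] from below. Only nonnegative
coefficients are used, so this applies to properties that are stable under cones
but not under differences, such as having an image of prescribed sign. The limit is
required only for approximations dominated by [f0], to allow dominated convergence. *)
Lemma measurable_fun_ind_ge0 Phi (f0 : T -> R) :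
  measurable_fun [set: T] f0 -> (forall x, 0 <= f0 x) ->
  (forall A, measurable A -> Phi \1_A) ->
  (forall a f g, 0 <= a -> Phi f -> Phi g -> Phi (fun x => a * f x + g x)) ->
  (forall (f_ : nat -> T -> R), (forall n, Phi (f_ n)) ->
    (forall n, measurable_fun [set: T] (f_ n)) ->
    (forall n x, `|f_ n x| <= f0 x) ->
    (forall x, f_ n x @[n --> \oo] --> f0 x) -> Phi f0) ->
  Phi f0.
Proof.
move=> mf f0_ge0 Phi1 PhiD Philim.
have mf0 : measurable_fun [set: T] (EFin \o f0) by exact/measurable_EFinP.
pose g_ := nnsfun_approx measurableT mf0.
have ge0 x : [set: T] x -> (0 <= (EFin \o f0) x)%E by rewrite lee_fin.
have Phi0 : Phi (fun=> 0).
  by have := Phi1 _ measurable0; rewrite indic0.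
apply: (Philim (fun n => g_ n)).
- move=> n.
  have -> : (g_ n : T -> R) =
      (fun x => \sum_(y <- fset_set (range (g_ n))) (y * \1_(g_ n @^-1` [set y]) x)).
    by apply/funext => x; rewrite fimfunE fsbig_finite.
  have y0 y : y \in enum_fset (fset_set (range (g_ n))) -> 0 <= y.
    rewrite -[_ \in _]/(y \in fset_set _).
    by rewrite in_fset_set// => /set_mem[x _ <-].
  elim: (enum_fset _) y0 => [|y s ih] y0.
    by under eq_fun do rewrite big_nil.
  under eq_fun do rewrite big_cons.
  apply: PhiD; first by apply: y0; rewrite mem_head.
    by apply: Phi1; exact: measurable_funPTI.
  by apply: ih => z zs; apply: y0; rewrite in_cons zs orbT.
- by move=> n; exact: measurable_funPT.
- move=> n x; rewrite ger0_norm ?fun_ge0// -lee_fin.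
  by rewrite /g_ nnsfun_approxE; exact: le_approx.
- by move=> x; exact: fine_cvg (cvg_nnsfun_approx measurableT mf0 ge0 (I : [set: T] x)).
Qed.

(** The linear version of the previous induction, through positive and negative parts. *)
Lemma measurable_fun_ind Phi (f0 : T -> R) :
  measurable_fun [set: T] f0 ->
  (forall A, measurable A -> Phi \1_A) ->
  (forall a f g, Phi f -> Phi g -> Phi (fun x => a * f x + g x)) ->
  (forall (f_ : nat -> T -> R) f, (forall n, Phi (f_ n)) ->
    (forall n, measurable_fun [set: T] (f_ n)) ->
    (forall n x, `|f_ n x| <= `|f0 x|) ->
    (forall x, f_ n x @[n --> \oo] --> f x) -> Phi f) ->
  Phi f0.
Proof.
move=> mf Phi1 PhiD Philim.
have PhiDp a f g : 0 <= a -> Phi f -> Phi g -> Phi (fun x => a * f x + g x).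
  by move=> _; exact: PhiD.
have -> : f0 = fun x => (-1) * f0^\- x + f0^\+ x.
  by rewrite -[LHS]funrposBneg; apply/funext => x; rewrite mulN1r addrC.
apply: PhiD.
- apply: measurable_fun_ind_ge0 => //; first exact: measurable_funrneg.
  move=> f_ Pf_ mf_ ff cf; apply: (Philim f_) => // n x.
  rewrite (le_trans (ff n x))//; rewrite /funrneg ge_max normr_ge0 andbT.
  by rewrite -normrN ler_norm.
- apply: measurable_fun_ind_ge0 => //; first exact: measurable_funrpos.
  move=> f_ Pf_ mf_ ff cf; apply: (Philim f_) => // n x.
  rewrite (le_trans (ff n x))//; rewrite /funrpos ge_max normr_ge0 andbT.
  by rewrite ler_norm.
Qed.

End measurable_induction.

Section submod.
Context (R : realType) (X : normedModType R).
Implicit Types x y : X.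
Variable L : set X.
Hypothesis sL : submod_closed (mem L).

Lemma submodP0 : L 0. Proof. by case: sL => /set_mem. Qed.
Lemma submodPZD a x y : L x -> L y -> L (a *: x + y).
Proof. by move=> /mem_set Lx /mem_set Ly; case: sL => _ /(_ a x y Lx Ly)/set_mem. Qed.
Lemma submodPZ a x : L x -> L (a *: x).
Proof. by move=> Lx; rewrite -[_ *: _]addr0; apply: submodPZD => //; exact: submodP0. Qed.
Lemma submodPD x y : L x -> L y -> L (x + y).
Proof. by move=> Lx Ly; rewrite -[x]scale1r; exact: submodPZD. Qed.
Lemma submodPB x y : L x -> L y -> L (x - y).
Proof. by move=> Lx Ly; rewrite addrC -scaleN1r; exact: submodPZD. Qed.
End submod.

Lemma submod_closedP (R : realType) (X : normedModType R) (L : set X) : L 0 ->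
  (forall a x y, L x -> L y -> L (a *: x + y)) -> submod_closed (mem L).
Proof.
move=> L0 LZD; split; first exact/mem_set.
by move=> a x y /set_mem Lx /set_mem Ly; apply/mem_set/LZD.
Qed.

Section sublattices.
Context d (T : measurableType d) (R : realType).
Variables (mu : {finite_measure set T -> \bar R}) (p : R).
Hypothesis p1 : (1 <= p%:E)%E.
Local Notation V := (LspaceType mu p1).
Local Notation Lp := (Lfun mu p%:E).
Local Notation cls := (@cls d T R mu p p1).
Implicit Types f g h : T -> R.

Lemma reprD (x y : V) : Lspace_repr (x + y) =
  (fun t => Lspace_repr x t + Lspace_repr y t) %[ae mu].
Proof.
by apply/(clsP p1); rewrite ?(LpD p1) ?Lp_repr// clsD ?Lp_repr// !cls_repr.
Qed.

Lemma reprB (x y : V) : Lspace_repr (x - y) =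
  (fun t => Lspace_repr x t - Lspace_repr y t) %[ae mu].
Proof.
by apply/(clsP p1); rewrite ?(LpB p1) ?Lp_repr// clsB ?Lp_repr// !cls_repr.
Qed.

Lemma reprZ a (x : V) : Lspace_repr (a *: x) =
  (fun t => a * Lspace_repr x t) %[ae mu].
Proof.
by apply/(clsP p1); rewrite ?(LpZ p1) ?Lp_repr// clsZ ?Lp_repr// !cls_repr.
Qed.

Definition vabs (x : V) : V := cls (fun t => `|Lspace_repr x t|).

Lemma vabs_cls f : f \in Lp -> vabs (cls f) = cls (fun t => `|f t|).
Proof.
move=> fL; apply/clsP; [by rewrite Lp_abs ?Lp_repr..|].
by apply: filterS (repr_cls p1 fL) => t /(_ I) -> _.
Qed.

Lemma repr_vabs (x : V) : Lspace_repr (vabs x) = (fun t => `|Lspace_repr x t|) %[ae mu].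
Proof. by apply: repr_cls; rewrite Lp_abs// Lp_repr. Qed.

Lemma norm_vabs (x : V) : `|vabs x| = `|x|.
Proof.
rewrite -[in RHS](cls_repr x); apply: eq_norm_cls; rewrite ?(Lp_abs p1) ?Lp_repr//.
by apply: aeW => t; rewrite normr_id.
Qed.

Lemma dist_vabs (x y : V) : `|vabs x - vabs y| <= `|x - y|.
Proof.
rewrite -[x in leRHS]cls_repr -[y in leRHS]cls_repr -!clsB ?Lp_abs ?Lp_repr//.
apply: le_norm_cls; rewrite ?(LpB p1) ?(Lp_abs p1) ?Lp_repr//.
by apply: aeW => t; exact: ler_dist_dist.
Qed.

Lemma joinE (x y : V) : Lspace_join x y = 2^-1 *: (x + y + vabs (x - y)).
Proof.
rewrite -[RHS]cls_repr /Lspace_join -clsE; apply/clsP; rewrite ?Lp_repr//.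
  exact: LfunP.
apply: filterS3 (reprZ 2^-1 (x + y + vabs (x - y))) (reprD (x + y) (vabs (x - y)))
  (filterI (reprD x y) (filterI (repr_vabs (x - y)) (reprB x y))).
move=> t /(_ I) -> /(_ I) -> [/(_ I) -> [/(_ I) -> /(_ I) ->]] _ /=.
by rewrite maxr_absE mulrC.
Qed.

Lemma meetE (x y : V) : Lspace_meet x y = 2^-1 *: (x + y - vabs (x - y)).
Proof.
rewrite -[RHS]cls_repr /Lspace_meet -clsE; apply/clsP; rewrite ?Lp_repr//.
  exact: LfunP.
apply: filterS3 (reprZ 2^-1 (x + y - vabs (x - y))) (reprB (x + y) (vabs (x - y)))
  (filterI (reprD x y) (filterI (repr_vabs (x - y)) (reprB x y))).
move=> t /(_ I) -> /(_ I) -> [/(_ I) -> [/(_ I) -> /(_ I) ->]] _ /=.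
by rewrite minr_absE mulrC.
Qed.

(** Stability under absolute values is all that has to be checked, because
[max a b = (a + b + |a - b|) / 2]. *)
Lemma closed_sublattice_vabs (L : set V) : submod_closed (mem L) ->
  (forall x, L x -> L (vabs x)) -> closed L -> closed_sublattice L.
Proof.
move=> sL La cL; split=> // x y Lx Ly; rewrite ?joinE ?meetE.
  apply: submodPZ => //; apply: submodPD => //; first exact: submodPD.
  by apply: La; exact: submodPB.
apply: submodPZ => //; apply: submodPB => //; first exact: submodPD.
by apply: La; exact: submodPB.
Qed.

Section closed_unital_sublattice.
Variable L : set V.
Hypotheses (sL : closed_sublattice L) (L1 : L (Lspace_one mu p1)).

Let subL : submod_closed (mem L). Proof. by case: sL. Qed.
Let clL : closed L. Proof. by case: sL. Qed.

Lemma indic_Lp (A : set T) : measurable A -> (\1_A : T -> R) \in Lp.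
Proof.
move=> mA; apply: (le_Lp p1 _ (Lp_cst mu p 1)); first exact: measurable_indic.
by move=> x; rewrite normr1 ger0_norm// indicE lern1 leq_b1.
Qed.

(** [|x|] is the join of [x] and [- x]. *)
Lemma sublattice_vabs x : L x -> L (vabs x).
Proof.
move=> Lx; have [_ + _ _] := sL => /(_ x (- x) Lx).
have /[swap]/[apply] : L (- x) by rewrite -scaleN1r; exact: submodPZ.
rewrite joinE subrr add0r opprK -mulr2n -(scaler_nat 2 x).
suff -> : vabs (2%:R *: x) = 2%:R *: vabs x by rewrite scalerA mulVf// scale1r.
rewrite -clsZ ?Lp_abs ?Lp_repr//; apply/clsP.
- by rewrite (Lp_abs p1)// Lp_repr.
- by rewrite (LpZ p1)// (Lp_abs p1)// Lp_repr.
by apply: filterS (reprZ 2%:R x) => t /(_ I) -> _; rewrite normrM ger0_norm.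
Qed.

Lemma closed_cvg_seq (u : nat -> V) l :
  (forall n, L (u n)) -> u @ \oo --> l -> L l.
Proof. by move=> Lu; exact: (@closed_cvg _ _ _ _ u L clL (nearW _ Lu)). Qed.

Lemma sublattice_abs f : f \in Lp -> L (cls f) -> L (cls (fun t => `|f t|)).
Proof. by move=> fL /sublattice_vabs; rewrite vabs_cls. Qed.

Definition L_sets := [set A : set T | measurable A /\ L (cls \1_A)].

Lemma L_setsC A : L_sets A -> L_sets (~` A).
Proof.
move=> [mA LA]; split; first exact: measurableC.
have -> : \1_(~` A) = (fun t => (cst 1 t : R) - \1_A t).
  by apply/funext => t; rewrite !indicE in_setC /=; case: (t \in A); rewrite /= ?subrr ?subr0.
rewrite clsB ?Lp_cst ?indic_Lp//; apply: submodPB => //.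
by rewrite cls1.
Qed.

Lemma L_setsU A B : L_sets A -> L_sets B -> L_sets (A `|` B).
Proof.
move=> [mA LA] [mB LB]; split; first exact: measurableU.
have -> : \1_(A `|` B) = (fun t => 2^-1 * ((\1_A t + \1_B t) + `|\1_A t - \1_B t|) : R).
  apply/funext => t; rewrite !indicE in_setU /=.
  case: (t \in A); case: (t \in B) => /=;
    by rewrite ?subrr ?subr0 ?sub0r ?normrN ?normr0 ?normr1; lra.
rewrite clsZ ?clsD ?(LpD p1) ?(Lp_abs p1) ?(LpB p1) ?indic_Lp//.
apply: submodPZ => //; apply: submodPD => //; first exact: submodPD.
by apply: sublattice_abs; rewrite ?(LpB p1) ?indic_Lp// clsB ?indic_Lp//; exact: submodPB.
Qed.

(** The indicator of [A `|` B] is half of [1_A + 1_B + |1_A - 1_B|], and indicators of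
increasing unions are dominated limits. *)
Lemma sigma_algebra_L_sets : sigma_algebra [set: T] L_sets.
Proof.
split.
- split; first exact: measurable0.
  rewrite indic0 -[cls _]/(cls (fun=> 0)) cls0; exact: submodP0.
- by move=> A LA; rewrite setTD; exact: L_setsC.
- move=> A LA; split; first by apply: bigcup_measurable => n _; case: (LA n).
  pose B n := \big[setU/set0]_(i < n) A i.
  have LB n : L_sets (B n).
    rewrite /B; elim: n => [|n ih]; last by rewrite big_ord_recr; exact: L_setsU.
    rewrite big_ord0; split; first exact: measurable0.
    rewrite indic0 -[cls _]/(cls (fun=> 0)) cls0; exact: submodP0.
  have [||||_ _] := @cvg_cls _ _ _ mu _ p1 (fun n => \1_(B n)) \1_(\bigcup_k A k) (cst 1).
  + by move=> n; apply: measurable_indic; case: (LB n).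
  + exact: Lp_cst.
  + by move=> n x; rewrite ger0_norm// indicE lern1 leq_b1.
  + move=> x; have BU n : B n x -> (\bigcup_k A k) x.
      by rewrite /B -bigcup_mkord => -[i _ Aix]; exists i.
    have [[i _ Aix]|nx] := pselect ((\bigcup_k A k) x); last first.
      apply: cvg_near_cst; apply: nearW => n.
      by rewrite !indicE !memNset// => /BU.
    apply: cvg_near_cst; near=> n; rewrite !indicE !mem_set//; first by exists i.
    rewrite /B -bigcup_mkord; exists i => //=.
    by near: n; exists i.+1.
  by apply: closed_cvg_seq => n; case: (LB n).
Unshelve. all: by end_near. Qed.

(** The indicator of [f > c] is the increasing limit of [min (n (f - c)^+) 1], which is
obtained from [f] and 1 by lattice operations. *)
Lemma L_sets_gt f c : f \in Lp -> L (cls f) -> L_sets (f @^-1` `]c, +oo[).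
Proof.
move=> fL Lf; have mf := Lp_measurable fL.
split; first by rewrite -[_ @^-1` _]setTI; exact: mf.
(* [h n] is [n] times the positive part of [f - c] *)
pose h n t : R := n%:R * (2^-1 * ((f t - c) + `|f t - c|)).
have hE n t : h n t = n%:R * Num.max (f t - c) 0.
  by rewrite /h maxr_absE subr0 addr0 mulrC [in RHS]mulrC [2^-1 * _]mulrC.
have Lh n : h n \in Lp /\ L (cls (h n)).
  have LB : (fun t => f t - c) \in Lp by rewrite (LpB p1)// Lp_cst.
  have LBc : L (cls (fun t => f t - c)).
    rewrite (clsB p1) ?Lp_cst//; apply: (submodPB subL) => //.
    have -> : (fun=> c) = (fun=> c * 1) :> (T -> R) by apply/funext => t; rewrite mulr1.
    by rewrite clsZ ?Lp_cst// cls1; exact: submodPZ.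
  have SL : (fun t => (f t - c) + `|f t - c|) \in Lp.
    by apply: (LpD p1) => //; exact: (Lp_abs p1).
  split; first by rewrite !(LpZ p1).
  rewrite clsZ ?(LpZ p1)// clsZ// clsD ?(Lp_abs p1)//.
  apply: (submodPZ subL); apply: (submodPZ subL); apply: (submodPD subL) => //.
  exact: sublattice_abs.
(* [k n] is the minimum of [h n] and 1 *)
pose k n t : R := 2^-1 * ((h n t + 1) - `|h n t - 1|).
have kE n t : k n t = Num.min (h n t) 1 by rewrite /k minr_absE mulrC.
have Lk n : L (cls (k n)).
  have [hL Lh'] := Lh n; have L1' : L (cls (fun=> 1)) by rewrite cls1.
  have h1L : (fun t => h n t - 1) \in Lp by rewrite (LpB p1)// Lp_cst.
  have h2L : (fun t => h n t + 1) \in Lp by rewrite (LpD p1)// Lp_cst.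
  rewrite clsZ ?(LpB p1) ?(Lp_abs p1)// clsB ?(Lp_abs p1)// clsD ?Lp_cst//.
  apply: (submodPZ subL); apply: (submodPB subL); first exact: submodPD.
  by apply: sublattice_abs => //; rewrite clsB ?Lp_cst//; exact: submodPB.
have [||||_ _] := @cvg_cls _ _ _ mu _ p1 k \1_(f @^-1` `]c, +oo[) (cst 1).
- move=> n; have [hL _] := Lh n; apply: (@Lp_measurable _ _ _ mu p).
  apply: (LpZ p1); apply: (LpB p1); first by apply: (LpD p1) => //; exact: Lp_cst.
  by apply: (Lp_abs p1); apply: (LpB p1) => //; exact: Lp_cst.
- exact: Lp_cst.
- move=> n x; rewrite kE hE ger0_norm; first by rewrite ge_min lexx orbT.
  by rewrite le_min ler01 mulr_ge0// le_max lexx orbT.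
- move=> x; have [fc|fc] := ltP c (f x); last first.
    apply: cvg_near_cst; apply: nearW => n; rewrite kE hE.
    rewrite indicE memNset/=; last first.
      by rewrite in_itv/= andbT => /(le_lt_trans fc); rewrite ltxx.
    by rewrite max_r ?subr_le0// mulr0 min_l.
  apply: cvg_near_cst; near=> n; rewrite kE hE indicE mem_set/=; last by rewrite in_itv/= fc.
  rewrite max_l ?subr_ge0 ?ltW// min_r// -ler_pdivrMr ?subr_gt0// div1r.
  by near: n; exact: nbhs_infty_ger.
exact: closed_cvg_seq.
Unshelve. all: by end_near. Qed.

(** The half-lines generate the Borel sets. *)
Lemma L_sets_preimage f (B : set R) : f \in Lp -> L (cls f) -> measurable B ->
  L_sets (f @^-1` B).
Proof.
move=> fL Lf; rewrite -[measurable B]/((@ocitv R).-sigma.-measurable B) RGenOInfty.measurableE.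
move=> mB; suff : image_set_system [set: T] f L_sets B.
  by rewrite /image_set_system/= setTI.
apply: (smallest_sub (sigma_algebra_image f sigma_algebra_L_sets)) mB.
by move=> _ [c ->]; rewrite /image_set_system/= setTI; exact: L_sets_gt.
Qed.

Lemma sublattice_measurable (G : set (set T)) f :
  <<s G >> `<=` L_sets -> measurable_fun [set: g_sigma_algebraType G] f ->
  f \in Lp -> L (cls f).
Proof.
move=> GL mf fL.
pose Phi (h : T -> R) := h \in Lp /\ L (cls h).
suff [] : Phi f by [].
apply: (@measurable_fun_ind _ (g_sigma_algebraType G)) => //.
- move=> A /GL[mA LA]; split=> //; exact: indic_Lp.
- move=> a g h [gL Lg] [hL Lh]; split; first by rewrite (LpD p1) ?(LpZ p1).
  by rewrite clsD ?(LpZ p1)// clsZ//; exact: submodPZD.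
- move=> f_ h Pf_ _ ff cf.
  have [||||_ hL ch] := @cvg_cls _ _ _ mu _ p1 f_ h (fun t => `|f t|) => //.
  + by move=> n; apply: (@Lp_measurable _ _ _ mu p); case: (Pf_ n).
  + by rewrite (Lp_abs p1).
  split=> //; apply: (closed_cvg_seq _ ch) => n; by case: (Pf_ n).
Qed.

End closed_unital_sublattice.

(** The conditional envelope is the smallest closed unital sublattice: the sets whose
indicator is in [L] form a sigma-algebra containing the null sets and making [Y]
measurable. *)
Lemma Env_c_sub (L Y : set V) : closed_sublattice L -> L (Lspace_one mu p1) ->
  Y `<=` L -> Env_c Y `<=` L.
Proof.
move=> sL L1 YL _ [f mf ->].
have subL : submod_closed (mem L) by case: sL.
have GL : <<s Sigma_generators Y >> `<=` L_sets L.
  apply: smallest_sub; first exact: sigma_algebra_L_sets.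
  move=> A [[mA A0]|[g Yg [B mB <-]]].
    split=> //; suff -> : cls \1_A = 0 by exact: submodP0.
    rewrite -cls0; apply/clsP; rewrite ?Lp_cst ?indic_Lp//.
    exists A; split=> // t /=; apply: contra_notP => nAt _.
    by rewrite indicE memNset.
  rewrite setTI; apply: L_sets_preimage => //; first exact: LfunP.
  by rewrite clsE; exact: YL.
rewrite -clsE; apply: sublattice_measurable mf _ => //; exact: LfunP.
Qed.

End sublattices.

(** * The duality map of the real line *)

Section duality_map.
Context (R : realType).
Implicit Types a b r x y z : R.

(** The normalized derivative of [|a|^r]: composed with a function of norm 1 in L_r, it
gives its norming functional in the dual space. *)
Definition dmap r a := Num.sg a * `|a| `^ (r - 1).

Lemma dmap_mul r a : 0 < r -> dmap r a * a = `|a| `^ r.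
Proof. by move=> r0; rewrite /dmap mulrAC -normrEsg mulr_powRB1. Qed.

Lemma dmapE_ge0 r a : 1 < r -> 0 <= a -> dmap r a = a `^ (r - 1).
Proof.
move=> r1; rewrite le_eqVlt => /predU1P[<-|a0]; last first.
  by rewrite /dmap gtr0_sg// mul1r gtr0_norm.
by rewrite /dmap sgr0 mul0r powR0// gt_eqF// subr_gt0.
Qed.

Lemma norm_dmap r a : 1 < r -> `|dmap r a| = `|a| `^ (r - 1).
Proof.
move=> r1; rewrite /dmap normrM [X in _ * X]ger0_norm ?powR_ge0// normr_sg.
have [->|a0] := eqVneq a 0; last by rewrite mul1r.
by rewrite mul0r normr0 powR0// gt_eqF// subr_gt0.
Qed.

Lemma le_norm_dmap r a : `|dmap r a| <= `|a| `^ (r - 1).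
Proof.
rewrite /dmap normrM [X in _ * X]ger0_norm ?powR_ge0// normr_sg.
by apply: ler_piMl; rewrite ?powR_ge0// lern1 leq_b1.
Qed.

(** This is Young's inequality, which avoids differentiating at 0. *)
Lemma powR_tangent r a b : 1 <= r ->
  `|a| `^ r + r * dmap r a * (b - a) <= `|b| `^ r.
Proof.
move=> r1; have r0 : 0 < r by exact: lt_le_trans r1.
suff : r * (dmap r a * b) <= `|b| `^ r + (r - 1) * `|a| `^ r.
  by rewrite mulrBr -!(mulrA r) (dmap_mul a r0); lra.
have : dmap r a * b <= `|a| `^ (r - 1) * `|b|.
  by rewrite (le_trans (ler_norm _))// normrM ler_wpM2r// le_norm_dmap.
move: r1; rewrite le_eqVlt => /predU1P[<-|r1 h].
  by rewrite subrr powRr0 powRr1// mul0r !mul1r addr0.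
have r10 : 0 < r - 1 by rewrite subr_gt0.
have q0 : 0 < r / (r - 1) by rewrite divr_gt0.
have := @conjugate_powR _ (`|a| `^ (r - 1)) `|b| (r / (r - 1)) r.
rewrite powR_ge0 normr_ge0 q0 r0 => /(_ isT isT isT isT).
have -> : (r / (r - 1))^-1 + r^-1 = 1 by field; rewrite !gt_eqF.
move=> /(_ erefl); rewrite -powRrM.
have -> : (r - 1) * (r / (r - 1)) = r by field; rewrite gt_eqF.
move=> /(le_trans h) {}h.
have -> : `|b| `^ r + (r - 1) * `|a| `^ r =
    r * (`|a| `^ r / (r / (r - 1)) + `|b| `^ r / r).
  by field; rewrite !gt_eqF.
by rewrite ler_pM2l.
Qed.

Lemma measurable_sg : measurable_fun [set: R] (@Num.sg R).
Proof.
have -> : @Num.sg R =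
    (fun x => \1_(`]0, +oo[%classic : set R) x - \1_(`]-oo, 0[%classic : set R) x).
  apply/funext => x; rewrite !indicE !mem_setE !in_itv/= andbT.
  by case: sgrP; rewrite /= ?subrr ?subr0 ?sub0r.
by apply: measurable_funB; exact: measurable_indic.
Qed.

Lemma measurable_dmap r : measurable_fun [set: R] (dmap r).
Proof.
apply: measurable_funM; first exact: measurable_sg.
apply: (measurableT_comp (measurable_powR (r - 1))); exact: normr_measurable.
Qed.

Lemma dmapN r a : dmap r (- a) = - dmap r a.
Proof. by rewrite /dmap sgrN normrN mulNr. Qed.

Lemma dmap1 r : dmap r 1 = 1.
Proof. by rewrite /dmap sgr1 normr1 powR1 mulr1. Qed.

(** The duality maps of conjugate exponents are inverse to each other; the hypothesis on
[r] and [s] is equivalent to [1/r + 1/s = 1]. *)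
Lemma dmapK r s a : 1 < r -> 1 < s -> (r - 1) * (s - 1) = 1 ->
  dmap r (dmap s a) = a.
Proof.
move=> r1 s1 rs; rewrite {1}/dmap norm_dmap// -powRrM mulrC [_ * (r - 1)]mulrC rs powRr1//.
rewrite /dmap sgrM [X in _ * (_ * X)](_ : _ = 1 *+ (a != 0)).
  by have [->|a0] := eqVneq a 0; rewrite ?sgr0 ?normr0 ?mul0r// mulr1 sgr_id mulrC -numEsg.
have [->|a0] := eqVneq a 0; last by rewrite gtr0_sg// powR_gt0// normr_gt0.
by rewrite normr0 powR0 ?sgr0// gt_eqF// subr_gt0.
Qed.

Lemma ltr_dmap r a b : 1 < r -> a < b -> dmap r a < dmap r b.
Proof.
move=> r1; have r10 : 0 < r - 1 by rewrite subr_gt0.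
have pos x y : 0 <= x -> x < y -> dmap r x < dmap r y.
  move=> x0 xy; rewrite !dmapE_ge0// ?(ltW (le_lt_trans x0 xy))//.
  by apply: gt0_ltr_powR => //; rewrite nnegrE// ltW// (le_lt_trans x0).
move=> ab; have [a0|a0] := leP 0 a; first exact: pos.
(* when the signs differ, both values are compared with 0 *)
have [b0|b0] := leP b 0.
  rewrite -[a]opprK -[b]opprK (dmapN r (- a)) (dmapN r (- b)) ltrN2.
  by apply: pos; rewrite ?oppr_ge0 ?ltrN2.
have d0 : dmap r 0 = 0 by rewrite /dmap sgr0 mul0r.
apply: (@lt_trans _ _ 0).
  by rewrite -[a]opprK (dmapN r (- a)) oppr_lt0 -d0; apply: pos; rewrite ?oppr_gt0.
by rewrite -d0; exact: pos.
Qed.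

(** Strict convexity: the tangent at [a] meets the graph at [a] only. Otherwise the
tangents at [a] and at the midpoint [c] would contradict the strict monotonicity of
the slope. *)
Lemma powR_tangent_eq r a b : 1 < r ->
  `|b| `^ r <= `|a| `^ r + r * dmap r a * (b - a) -> b = a.
Proof.
(* the slopes at [a] and at [c] bound the increments from [a] to [c] and from [c] to
[b], while the hypothesis bounds their sum by the slope at [a] *)
move=> r1 E; have r1' := ltW r1; set c := (a + b) / 2.
have ca := powR_tangent a c r1'; have cb := powR_tangent c b r1'.
have cE : c - a = (b - a) / 2 by rewrite /c; field.
have bcE : b - c = (b - a) / 2 by rewrite /c; field.
rewrite cE in ca; rewrite bcE in cb.
set h := (b - a) / 2 in ca cb cE.
have E' : `|b| `^ r <= `|a| `^ r + r * dmap r a * h * 2.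
  by rewrite -mulrA /h mulfVK.
have : r * ((dmap r c - dmap r a) * h) <= 0 by lra.
have r0 : 0 < r by exact: lt_trans r1.
rewrite pmulr_rle0// => m.
have [ba|ab|//] := ltgtP b a.
- have h0 : h < 0 by rewrite /h pmulr_llt0// subr_lt0.
  have /(ltr_dmap r1) : c < a by rewrite -subr_lt0 cE.
  by rewrite -subr_lt0 => k; have := nmulr_rgt0 h k; nra.
- have h0 : 0 < h by rewrite /h divr_gt0// subr_gt0.
  have /(ltr_dmap r1) : a < c by rewrite -subr_gt0 cE.
  by rewrite -subr_gt0 => k; nra.
Qed.

Lemma powR_cts q (u : nat -> R) x : 0 < q -> u n @[n --> \oo] --> x ->
  (`|u n| `^ q) @[n --> \oo] --> `|x| `^ q.
Proof.
move=> q0 ux; have nux : `|u n| @[n --> \oo] --> `|x| by exact: cvg_norm.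
have [x0|x0] := eqVneq x 0.
  rewrite x0 normr0 powR0 ?gt_eqF//; rewrite x0 normr0 in nux.
  apply/cvgrPdist_lt => e e0.
  have e1 : 0 < e `^ q^-1 by rewrite powR_gt0.
  move/cvgrPdist_lt : nux => /(_ _ e1); apply: filterS => n.
  rewrite !sub0r !normrN (ger0_norm (powR_ge0 _ _)) normr_id => ve.
  have -> : e = (e `^ q^-1) `^ q by rewrite -powRrM mulVf ?gt_eqF// powRr1 ?ltW.
  by apply: gt0_ltr_powR => //; rewrite nnegrE// powR_ge0.
rewrite [X in _ --> X]/powR normr_eq0 (negbTE x0).
have : expR (q * ln `|u n|) @[n --> \oo] --> expR (q * ln `|x|).
  apply: continuous_cvg; first exact: continuous_expR.
  apply: cvgMr; apply: continuous_cvg nux; apply: continuous_ln.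
  by rewrite normr_gt0.
apply: cvg_trans; apply: near_eq_cvg.
have x0' : 0 < `|x| by rewrite normr_gt0.
have /cvgrPdist_lt /(_ _ x0') := ux; apply: filterS => n xu.
rewrite /powR ifF// normr_eq0; apply/negP => /eqP u0.
by move: xu; rewrite u0 subr0 ltxx.
Qed.

Lemma dmap_cts r (u : nat -> R) x : 1 < r -> u n @[n --> \oo] --> x ->
  dmap r (u n) @[n --> \oo] --> dmap r x.
Proof.
move=> r1 ux; have r10 : 0 < r - 1 by rewrite subr_gt0.
have cp := powR_cts r10 ux.
have [x0|x0] := eqVneq x 0.
  have -> : dmap r x = 0 by rewrite x0 /dmap sgr0 mul0r.
  apply/norm_cvg0P; under eq_fun do rewrite norm_dmap//.
  by move: cp; rewrite x0 normr0 powR0 ?gt_eqF.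
have x0' : 0 < `|x| by rewrite normr_gt0.
rewrite /dmap; apply: cvgM => //; apply: cvg_near_cst.
have /cvgrPdist_lt /(_ _ x0') := ux; apply: filterS => n.
have [u0|u0|->] := ltgtP (u n) 0; last by rewrite subr0 ltxx.
  have [x1|x1|xx] := ltgtP x 0; last by rewrite xx eqxx in x0.
    by move=> _; rewrite !ltr0_sg.
  have xu : 0 < x - u n by rewrite subr_gt0 (lt_trans u0).
  by rewrite !gtr0_norm// => h; exfalso; lra.
have [x1|x1|xx] := ltgtP x 0; last by rewrite xx eqxx in x0.
  have xu : x - u n < 0 by rewrite subr_lt0 (lt_trans x1).
  by rewrite !ltr0_norm// => h; exfalso; lra.
by move=> _; rewrite !gtr0_sg.
Qed.

Lemma dmap_diff_ge r x z : 2 < r -> 0 <= x -> 0 <= z ->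
  (r - 1) * x `^ (r - 2) * (z - x) <= dmap r z - dmap r x.
Proof.
move=> r2 x0 z0; have r1 : 1 < r by lra.
rewrite !dmapE_ge0//; have r11 : 1 < r - 1 by lra.
have := powR_tangent x z (ltW r11); rewrite !ger0_norm// dmapE_ge0//.
have -> : r - 1 - 1 = r - 2 by ring.
lra.
Qed.

Lemma dmap_diff_le r x z : 2 < r -> 0 <= x -> 0 <= z ->
  dmap r z - dmap r x <= (r - 1) * z `^ (r - 2) * (z - x).
Proof. by move=> r2 x0 z0; have := dmap_diff_ge r2 z0 x0; lra. Qed.

(** Domination of the difference quotients of [dmap r], needed to differentiate under a
limit in L_s. It requires [2 < r]: below 2 the derivative is unbounded at 0. *)
Lemma dmap_lipschitz r x z m : 2 < r -> `|x| <= m -> `|z| <= m ->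
  `|dmap r z - dmap r x| <= (r - 1) * m `^ (r - 2) * `|z - x|.
Proof.
move=> r2; have r1 : 1 < r by lra.
have r20 : 0 < r - 2 by lra.
have powm y : `|y| <= m -> `|y| `^ (r - 2) <= m `^ (r - 2).
  move=> ym; apply: (ge0_ler_powR (ltW r20)) => //; rewrite nnegrE//.
  exact: le_trans ym.
have posx x' z' : 0 <= x' -> x' <= z' -> `|z'| <= m ->
    `|dmap r z' - dmap r x'| <= (r - 1) * m `^ (r - 2) * `|z' - x'|.
  move=> x0 xz zm; have z0 := le_trans x0 xz.
  rewrite !ger0_norm ?subr_ge0//; last first.
    move: xz; rewrite le_eqVlt => /predU1P[->//|xz]; exact/ltW/ltr_dmap.
  rewrite (le_trans (dmap_diff_le r2 x0 z0))// ler_wpM2r ?subr_ge0//.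
  have pz := powm _ zm; rewrite (ger0_norm z0) in pz.
  by apply: ler_wpM2l => //; lra.
have pos x' z' : 0 <= x' -> 0 <= z' -> `|x'| <= m -> `|z'| <= m ->
    `|dmap r z' - dmap r x'| <= (r - 1) * m `^ (r - 2) * `|z' - x'|.
  move=> x0 z0 xm zm; have [xz|/ltW xz] := leP x' z'; first exact: posx.
  by rewrite distrC (distrC z'); exact: posx.
move: x z; have mix x' z' : 0 <= x' -> z' <= 0 -> `|x'| <= m -> `|z'| <= m ->
    `|dmap r z' - dmap r x'| <= (r - 1) * m `^ (r - 2) * `|z' - x'|.
  move=> x0 z0 xm zm.
  rewrite (le_trans (ler_normB _ _))// !norm_dmap//.
  have -> : `|z' - x'| = `|z'| + `|x'|.
    by rewrite ler0_norm ?subr_le0 ?(le_trans z0)// ler0_norm// ger0_norm//; ring.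
  have split_ y : `|y| <= m -> `|y| `^ (r - 1) <= m `^ (r - 2) * `|y|.
    move=> ym; have -> : r - 1 = (r - 2) + 1 by ring.
    rewrite powRD; last by apply/implyP => /eqP h; exfalso; lra.
    by rewrite powRr1// ler_wpM2r// powm.
  have := lerD (split_ _ zm) (split_ _ xm) => h; apply: le_trans h _.
  rewrite -mulrDr -mulrA ler_peMl ?mulr_ge0 ?powR_ge0 ?addr_ge0//; lra.
move=> x z xm zm.
have [x0|/ltW x0] := leP 0 x; have [z0|/ltW z0] := leP 0 z.
- exact: pos.
- exact: mix.
- by rewrite distrC (distrC z); exact: mix.
- rewrite -[x]opprK -[z]opprK (dmapN r (- x)) (dmapN r (- z)).
  by rewrite -opprD normrN -opprD [in leRHS]normrN; apply: pos; rewrite ?oppr_ge0 ?normrN.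
Qed.

(** The quotient is squeezed between the slopes at [x] and at [x + y / n]; at [x = 0] the
Lipschitz estimate gives the limit 0. *)
Lemma dmap_derive r x y : 2 < r ->
  n.+1%:R * (dmap r (x + y / n.+1%:R) - dmap r x) @[n --> \oo] -->
  (r - 1) * `|x| `^ (r - 2) * y.
Proof.
move=> r2; have r1 : 1 < r by lra.
have r20 : 0 < r - 2 by lra.
have cz (x' y' : R) : x' + y' / n.+1%:R @[n --> \oo] --> x'.
  rewrite -[X in _ --> X]addr0 -(mulr0 y'); apply: cvgD; first exact: cvg_cst.
  apply: cvgMr; exact: cvg_harmonic.
have main x' y' : 0 < x' ->
  n.+1%:R * (dmap r (x' + y' / n.+1%:R) - dmap r x') @[n --> \oo] -->
  (r - 1) * `|x'| `^ (r - 2) * y'.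
  move=> x0.
  have nz : \forall n \near \oo, 0 <= x' + y' / n.+1%:R.
    have /cvgrPdist_lt /(_ _ x0) := cz x' y'; apply: filterS => n.
    move=> /= h; have := le_lt_trans (ler_norm _) h.
    by set w := y' / _; lra.
  have ny n : n.+1%:R * (x' + y' / n.+1%:R - x') = y'.
    by rewrite [x' + _]addrC addrK mulrC mulfVK.
  apply: (@squeeze_cvgr _ _ _ _ (fun=> (r - 1) * `|x'| `^ (r - 2) * y')
    (fun n => (r - 1) * `|x' + y' / n.+1%:R| `^ (r - 2) * y')).
  - apply: filterS nz => n nz; rewrite !ger0_norm ?(ltW x0)//.
    have h1 := dmap_diff_ge r2 (ltW x0) nz; have h2 := dmap_diff_le r2 (ltW x0) nz.
    have n0 : 0 <= n.+1%:R :> R by [].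
    apply/andP; split.
      by apply: le_trans (ler_wpM2l n0 h1); rewrite mulrCA ny.
    by apply: le_trans (ler_wpM2l n0 h2) _; rewrite mulrCA ny.
  - exact: cvg_cst.
  - by apply: cvgMl; apply: cvgMr; apply: powR_cts.
have [x0|x0|->] := ltgtP x 0; last first.
- rewrite normr0 powR0 ?gt_eqF// mulr0 mul0r; apply/norm_cvg0P.
  apply: (@squeeze_cvgr _ _ _ _ (fun=> 0)
    (fun n => (r - 1) * `|0 + y / n.+1%:R| `^ (r - 2) * `|y|)).
  + apply: nearW => n; rewrite normr_ge0 normrM (@ger0_norm _ n.+1%:R)//=.
    have := @dmap_lipschitz r 0 (0 + y / n.+1%:R) `|0 + y / n.+1%:R| r2.
    rewrite normr0 normr_ge0 lexx => /(_ isT isT) h.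
    apply: le_trans (ler_wpM2l (ler0n _ _) h) _.
    have e : n.+1%:R * `|0 + y / n.+1%:R - 0| = `|y|.
      by rewrite subr0 add0r normrM normfV (@ger0_norm _ n.+1%:R)// mulrC mulfVK.
    by rewrite mulrCA e.
  + exact: cvg_cst.
  + have h := powR_cts r20 (cz 0 y); rewrite normr0 powR0 ?gt_eqF// in h.
    have e0 : (r - 1) * 0 * `|y| = 0 by rewrite mulr0 mul0r.
    rewrite -[X in _ --> X]e0.
    by apply: cvgMl; apply: cvgMr.
- exact: main.
- have x0' : 0 < - x by rewrite oppr_gt0.
  have := cvgN (main (- x) (- y) x0'); rewrite normrN mulrN opprK => h.
  pose u n := - (n.+1%:R * (dmap r (- x + (- y) / n.+1%:R) - dmap r (- x))).
  have E n : n.+1%:R * (dmap r (x + y / n.+1%:R) - dmap r x) = u n.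
    rewrite /u; have -> : - x + - y / n.+1%:R = - (x + y / n.+1%:R).
      by rewrite mulNr opprD.
    by rewrite !dmapN; ring.
  by under eq_fun do rewrite E; exact: h.
Qed.

End duality_map.

(** * Conditional expectations *)

Section trace_measure.
Context d (T : measurableType d) (R : realType).
Variables (mu : {finite_measure set T -> \bar R}) (G : set (set T)).
Hypothesis GT : <<s G >> `<=` measurable.
Local Notation T' := (g_sigma_algebraType G).

Lemma measurable_id_trace : measurable_fun [set: T] (id : T -> T').
Proof. by move=> _ A mA; rewrite setTI; exact: GT. Qed.

Lemma measurable_fun_trace (g : T -> R) :
  measurable_fun [set: T'] g -> measurable_fun [set: T] g.
Proof. by move=> mg _ A mA; apply: GT; exact: mg. Qed.

(** The restriction of [mu] to the sigma-algebra generated by [G], as a measure on a type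
whose measurable sets are those of that sigma-algebra. The inclusion of
sigma-algebras is an argument so that the measure structure can be attached to the
constant. *)
Definition trace_measure & (<<s G >> `<=` measurable) : set T' -> \bar R :=
  fun A => mu A.

Local Notation tm := (trace_measure GT).

Let tm0 : tm set0 = 0%E. Proof. exact: (measure0 mu). Qed.
Let tm_ge0 A : (0 <= tm A)%E. Proof. exact: (measure_ge0 mu A). Qed.
Let tm_sigma : semi_sigma_additive tm.
Proof.
move=> F mF tF mUF.
exact: (@measure_semi_sigma_additive _ _ _ mu F (fun n => GT (mF n)) tF (GT mUF)).
Qed.

HB.instance Definition _ := isMeasure.Build _ _ _ tm tm0 tm_ge0 tm_sigma.

Let tm_fin : fin_num_fun tm.
Proof. by move=> A mA; exact: (fin_num_measure mu A (GT mA)). Qed.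

HB.instance Definition _ := Measure_isFinite.Build _ _ _ tm tm_fin.

(** The restricted measure is the image of [mu] by the identity, so that integrals of
functions measurable for the smaller sigma-algebra agree. *)
Lemma trace_pushforward (f : T -> \bar R) (A : set T') : measurable A ->
  measurable_fun [set: T'] f -> mu.-integrable [set: T] f ->
  tm.-integrable A f /\ (\int[tm]_(x in A) f x = \int[mu]_(x in A) f x)%E.
Proof.
move=> mA mf intf; have mfA : measurable_fun A f by exact: measurable_funTS.
have intA : mu.-integrable A f by apply: integrableS intf => //; exact: GT.
split; last first.
  rewrite -[RHS](integral_pushforward measurable_id_trace mf intA mA).
  apply: eq_measure_integral => //; exact: measurable_id_trace.
apply/integrableP; split=> //; have /integrableP[_] := intA; apply: le_lt_trans.
have mabs : measurable_fun A (fun x : T' => `|f x|%E) by exact: measurableT_comp.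
by rewrite -[leRHS](ge0_integral_pushforward measurable_id_trace mu mA mabs).
Qed.

(** Conditional expectation is the density of [A |-> \int_A f] on the smaller
sigma-algebra, by the Radon-Nikodym theorem. *)
Lemma condexp_ex (f : T -> R) : mu.-integrable [set: T] (EFin \o f) ->
  exists g : T -> R, [/\ measurable_fun [set: T'] g,
    mu.-integrable [set: T] (EFin \o g) &
    forall A, <<s G >> A -> (\int[mu]_(x in A) (g x)%:E = \int[mu]_(x in A) (f x)%:E)%E].
Proof.
move=> intf.
pose nu0 (A : set T') := (\int[mu]_(x in A) (f x)%:E)%E.
have nu00 : nu0 set0 = 0%E by rewrite /nu0 integral_set0.
have nufin A : measurable A -> nu0 A \is a fin_num.
  by move=> mA; exact: (fin_num_measure (induced_charge intf) A (GT mA)).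
have nusig : semi_sigma_additive nu0.
  move=> F mF tF mUF.
  exact: (@charge_semi_sigma_additive _ _ _ (induced_charge intf) F
    (fun n => GT (mF n)) tF (GT mUF)).
pose nu : {charge set T' -> \bar R} := HB.pack nu0 (isCharge.Build _ _ _ nu0 nu00 nufin nusig).
(* null sets of the restricted measure are null for [mu] *)
have dom : nu `<< tm.
  apply/null_content_dominatesP => A mA A0.
  rewrite -[LHS]/(nu0 A) /nu0.
  apply: null_set_integral => //; first exact: GT.
  by apply: measurable_funTS; exact: measurable_int intf.
have rnint := Radon_Nikodym_integrable dom.
have rnE A := @Radon_Nikodym_integral _ _ _ _ tm A dom.
set D := Radon_Nikodym nu tm in rnint rnE.
have mD : measurable_fun [set: T'] D by exact: measurable_int rnint.
have Dfin x : D x = (fine (D x))%:E by rewrite fineK// Radon_Nikodym_fin_num.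
have mg : measurable_fun [set: T'] (fun x : T' => fine (D x)).
  by apply/measurable_EFinP; apply: eq_measurable_fun mD => x _ /=; rewrite -Dfin.
have mDT : measurable_fun [set: T] D by move=> _ B mB; apply: GT; exact: mD.
have intD : mu.-integrable [set: T] D.
  apply/integrableP; split=> //; have /integrableP[_] := rnint; apply: le_lt_trans.
  have mabs : measurable_fun [set: T'] (fun x : T' => `|D x|%E).
    exact: measurableT_comp.
  rewrite -[leLHS](ge0_integral_pushforward measurable_id_trace mu measurableT mabs)//.
exists (fun x => fine (D x)); split=> //.
  by apply: eq_integrable intD => // x _; rewrite /= -Dfin.
move=> A mA; rewrite -[RHS]/(nu A) rnE// (trace_pushforward mA mD intD).2.
by apply: eq_integral => x _; rewrite -Dfin.
Qed.

Lemma condexp_unique (g1 g2 : T -> R) :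
  measurable_fun [set: T'] g1 -> measurable_fun [set: T'] g2 ->
  mu.-integrable [set: T] (EFin \o g1) -> mu.-integrable [set: T] (EFin \o g2) ->
  (forall A, <<s G >> A ->
    (\int[mu]_(x in A) (g1 x)%:E = \int[mu]_(x in A) (g2 x)%:E)%E) ->
  g1 = g2 %[ae mu].
Proof.
move=> mg1 mg2 i1 i2 E.
have mg1' : measurable_fun [set: T'] (EFin \o g1) by exact/measurable_EFinP.
have mg2' : measurable_fun [set: T'] (EFin \o g2) by exact/measurable_EFinP.
have : ae_eq tm [set: T'] (EFin \o g1) (EFin \o g2).
  apply: integral_ae_eq => //.
    by have [] := trace_pushforward measurableT mg1' i1.
  move=> A _ mA.
  by rewrite (trace_pushforward mA mg1' i1).2 (trace_pushforward mA mg2' i2).2 E.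
case=> N [mN N0 sN]; exists N; split=> //; first exact: GT.
move=> x xN; apply: sN => /= h; apply: xN => /h; exact: EFin_inj.
Qed.

End trace_measure.

Section condexp.
Context d (T : measurableType d) (R : realType).
Variables (mu : {finite_measure set T -> \bar R}) (G : set (set T)).
Hypothesis GT : <<s G >> `<=` measurable.
Local Notation T' := (g_sigma_algebraType G).
Implicit Types f g h k : T -> R.

Lemma integrable_bddM h k (K : R) : measurable_fun [set: T] h ->
  (forall x, `|h x| <= K) -> mu.-integrable [set: T] (EFin \o k) ->
  mu.-integrable [set: T] (EFin \o (fun x => h x * k x)).
Proof.
move=> mh hK ik; have mk : measurable_fun [set: T] k.
  by apply/measurable_EFinP; exact: measurable_int ik.
have iKk := integrableZl measurableT K ik.
apply: le_integrable iKk => //.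
  by apply/measurable_EFinP; exact: measurable_funM.
move=> x _; rewrite /= lee_fin !normrM ler_wpM2r//.
exact: le_trans (hK x) (ler_norm _).
Qed.

Lemma integral_indicM k (A : set T) : measurable A ->
  \int[mu]_x (\1_A x * k x) = \int[mu]_(x in A) k x.
Proof.
move=> mA; rewrite [RHS]Rintegral_mkcond; apply: eq_Rintegral => x _.
by rewrite patch_indic mulrC.
Qed.

(** By induction on [h] from the indicators of the sets of the sigma-algebra; the bound on
[h] dominates its approximations. *)
Lemma condexp_pullout h k (K : R) :
  measurable_fun [set: T'] h -> (forall x, `|h x| <= K) ->
  mu.-integrable [set: T] (EFin \o k) ->
  (forall A, <<s G >> A -> \int[mu]_(x in A) k x = 0) ->
  \int[mu]_x (h x * k x) = 0.
Proof.
move=> mh hK ik k0.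
pose Phi (u : T -> R) := [/\ measurable_fun [set: T] u, exists M : R, forall x, `|u x| <= M &
  \int[mu]_x (u x * k x) = 0].
suff [] : Phi h by [].
apply: (@measurable_fun_ind _ T') => //.
- move=> A mA; split; first exact/measurable_indic/GT.
    by exists 1 => x; rewrite ger0_norm// indicE lern1 leq_b1.
  by rewrite integral_indicM ?k0//; exact: GT.
- move=> a u v [mu_ [M uM] u0] [mv [N vN] v0]; split.
  + by apply: measurable_funD => //; exact: measurable_funM.
  + exists (`|a| * M + N) => x; rewrite (le_trans (ler_normD _ _))// lerD//.
    by rewrite normrM ler_wpM2l.
  + have iu := integrable_bddM mu_ uM ik; have iv := integrable_bddM mv vN ik.
    under eq_Rintegral do rewrite mulrDl -mulrA.
    rewrite RintegralD//; last by have := integrableZl measurableT a iu.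
    by rewrite RintegralZl// u0 v0 mulr0 addr0.
- move=> u_ u Pu _ uh cu.
  have mu_ n : measurable_fun [set: T] (u_ n) by case: (Pu n).
  have mk : measurable_fun [set: T] k.
    by apply/measurable_EFinP; exact: measurable_int ik.
  have mu' : measurable_fun [set: T] u.
    by apply: (measurable_fun_cvg mu_) => x _; exact: cu.
  have u_K n x : `|u_ n x| <= K by exact: le_trans (uh n x) (hK x).
  have uK x : `|u x| <= K.
    have /cvg_lim <- // : `|u_ n x| @[n --> \oo] --> `|u x| by exact: cvg_norm.
    apply: limr_le; last exact: nearW.
    by apply/cvg_ex; exists (`|u x|); exact: cvg_norm.
  split=> //; first by exists K.
  have K0 : 0 <= K by exact: le_trans (uK point).
  have iKk : mu.-integrable [set: T] (EFin \o (fun x => K * `|k x|)).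
    have := integrableZl measurableT K (integrable_abse ik).
    by apply: eq_integrable => // x _.
  have [|||_] := @Rdominated_convergence _ _ _ mu (fun n x => u_ n x * k x)
    (fun x => u x * k x) (fun x => K * `|k x|) _ iKk.
  + by move=> n; exact: measurable_funM.
  + by move=> n x; rewrite normrM ler_wpM2r.
  + by move=> x; apply: cvgMl; exact: cu.
  under eq_fun => n do have [_ _ ->] := Pu n.
  by move/(cvg_unique _ (cvg_cst _)) => <-.
Qed.

Variable p : R.
Hypothesis p1 : (1 <= p%:E)%E.
Local Notation Lp := (Lfun mu p%:E).
Local Notation cls := (@cls d T R mu p p1).

Lemma Lp_L1 f : f \in Lp -> mu.-integrable [set: T] (EFin \o f).
Proof.
move=> fL; apply/Lfun1_integrable; apply: Lfun_subset fL => //.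
exact: fin_num_measure.
Qed.

(** Conditional Jensen inequality for [|a|^p]. The tangent inequality at [g],
[|f|^p >= |g|^p + p (dmap p g) (f - g)], is integrated on the sets where [|g| <= n]: there
the slope is bounded and measurable for the sigma-algebra, hence orthogonal to
[f - g]. Monotone convergence in [n] concludes. *)
Lemma condexp_contract f g : f \in Lp -> measurable_fun [set: T'] g ->
  mu.-integrable [set: T] (EFin \o g) ->
  (forall A, <<s G >> A ->
    (\int[mu]_(x in A) (g x)%:E = \int[mu]_(x in A) (f x)%:E)%E) ->
  g \in Lp /\ `|cls g| <= `|cls f|.
Proof.
move=> fL mg ig gfE.
have mgT : measurable_fun [set: T] g by exact: measurable_fun_trace GT _ mg.
have mf := Lp_measurable fL; have if1 := Lp_L1 fL.
pose B n := [set x | `|g x| <= n%:R].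
have mB n : (<<s G >>) (B n).
  have mabs : measurable_fun [set: T'] (fun x : T' => `|g x|).
    by apply: (measurableT_comp (@normr_measurable _ _)); exact: mg.
  have mcst : measurable_fun [set: T'] (fun _ : T' => n%:R : R) by [].
  have m1 : measurable [set true] by [].
  by have := measurable_fun_ler mabs mcst measurableT m1; rewrite setTI.
have key n : (\int[mu]_x (\1_(B n) x * `|g x| `^ p)%:E <= \int[mu]_x (`|f x| `^ p)%:E)%E.
  (* the slope of the tangent at [g], cut off to the set where [|g|] is at most [n] *)
  pose h x := \1_(B n) x * (p * dmap p (g x)).
  have p0 := p_gt0 p1; have p1' := p_ge1 p1.
  have mh : measurable_fun [set: T'] h.
    apply: measurable_funM; first by apply: measurable_indic; exact: mB.
    by apply: measurable_funM => //; apply: (measurableT_comp (measurable_dmap p)).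
  have hK x : `|h x| <= p * n%:R `^ (p - 1).
    rewrite /h indicE; case: (boolP (x \in B n)) => /= [/set_mem Bx|_]; last first.
      by rewrite mul0r normr0 mulr_ge0 ?powR_ge0// ltW.
    rewrite mul1r normrM gtr0_norm// ler_pM2l// (le_trans (le_norm_dmap _ _))//.
    by apply: ge0_ler_powR; rewrite ?nnegrE ?subr_ge0.
  have ik : mu.-integrable [set: T] (EFin \o (fun x => f x - g x)).
    by have := integrableB measurableT if1 ig.
  have int0 : \int[mu]_x (h x * (f x - g x)) = 0.
    apply: (condexp_pullout mh hK ik) => A GA.
    have mA := GT GA.
    rewrite RintegralB//; try exact: integrableS measurableT mA _ _.
    by rewrite /Rintegral gfE// subrr.
  have ihk := integrable_bddM (measurable_fun_trace GT mh) hK ik.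
  have iB : mu.-integrable [set: T] (EFin \o (fun x => \1_(B n) x * `|g x| `^ p)).
    have iC := finite_measure_integrable_cst mu (n%:R `^ p).
    apply: (le_integrable measurableT _ _ (iC _ measurableT)) => //.
      apply/measurable_EFinP; apply: measurable_funM.
        by apply: measurable_indic; exact: GT.
      exact: measurable_powR_abs.
    move=> x _; rewrite /= lee_fin indicE; case: (boolP (x \in B n)) => /= [/set_mem Bx|_].
      rewrite mul1r !(ger0_norm (powR_ge0 _ _)).
      by rewrite (le_norm_powR p1)// (le_trans _ (ler_norm _)).
    by rewrite mul0r normr0.
  have iF := integrable_Lp p1 fL.
  rewrite -(@fineK _ (\int[mu]_x (`|f x| `^ p)%:E)%E); last first.
    by apply: integrable_fin_num => //.
  rewrite -(@fineK _ (\int[mu]_x (\1_(B n) x * `|g x| `^ p)%:E)%E); last first.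
    by apply: integrable_fin_num => //.
  rewrite lee_fin -[leLHS]addr0 -int0 -RintegralD//.
  apply: le_Rintegral => //.
    by have := integrableD measurableT iB ihk.
  move=> x _; rewrite /h indicE; case: (x \in B n) => /=.
    by rewrite !mul1r; exact: powR_tangent.
  by rewrite !mul0r addr0 powR_ge0.
have le_int : (\int[mu]_x (`|g x| `^ p)%:E <= \int[mu]_x (`|f x| `^ p)%:E)%E.
  pose g' n x := (\1_(B n) x * `|g x| `^ p)%:E.
  have := @cvg_monotone_convergence _ _ _ mu _ measurableT g'.
  have lim_g' x : limn (g'^~ x) = (`|g x| `^ p)%:E.
    apply: cvg_lim => //; apply: cvg_near_cst; near=> n.
    rewrite /g' indicE mem_set ?mul1r//.
    by rewrite /B /=; near: n; exact: nbhs_infty_ger.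
  under eq_integral do rewrite lim_g'.
  have mg' n : measurable_fun [set: T] (g' n).
    apply/measurable_EFinP; apply: measurable_funM.
      by apply: measurable_indic; exact: GT.
    exact: measurable_powR_abs.
  have g'0 n x : [set: T] x -> (0 <= g' n x)%E.
    by move=> _; rewrite lee_fin mulr_ge0// powR_ge0.
  have ndg' x : [set: T] x -> nondecreasing_seq (g'^~ x).
    move=> _ m n mn; rewrite lee_fin ler_wpM2r ?powR_ge0// !indicE ler_nat.
    case: (boolP (x \in B m)) => // /set_mem Bm; rewrite mem_set//.
    by rewrite /B /= (le_trans Bm)// ler_nat.
  move=> /(_ mg' g'0 ndg') H; rewrite -(cvg_lim (@ereal_hausdorff R) H).
  apply: lime_le; first by apply/cvg_ex; eexists; exact: H.
  by apply: nearW => n; exact: key.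
have gL : g \in Lp.
  apply/(Lp_int mu p1 mgT)/integrableP; split.
    by apply/measurable_EFinP; exact: measurable_powR_abs.
  have /integrableP[_] := integrable_Lp p1 fL; apply: le_lt_trans.
  under eq_integral do rewrite /= ger0_norm ?powR_ge0//.
  by under [leRHS]eq_integral do rewrite /= ger0_norm ?powR_ge0//.
split=> //; rewrite -(le_norm_powR p1)// !norm_cls// /Rintegral fine_le//.
- by apply: integrable_fin_num => //; exact: (integrable_Lp p1 gL).
- by apply: integrable_fin_num => //; exact: (integrable_Lp p1 fL).
Unshelve. all: by end_near. Qed.

End condexp.

Section conditional_envelope.
Context d (T : measurableType d) (R : realType).
Variables (mu : {finite_measure set T -> \bar R}) (p : R).
Hypothesis p1 : (1 <= p%:E)%E.
Local Notation V := (LspaceType mu p1).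
Local Notation Lp := (Lfun mu p%:E).
Local Notation cls := (@cls d T R mu p p1).
Variable Y : set V.
Local Notation G := (Sigma_generators Y).
Local Notation T' := (g_sigma_algebraType G).

Lemma Sigma_sub : <<s G >> `<=` measurable.
Proof.
apply: smallest_sub; first exact: sigma_algebra_measurable.
by move=> A [[]//|[f _ [B mB <-]]]; exact: (measurable_funPT f).
Qed.
Local Notation GT := Sigma_sub.

Definition is_condexp (x y : V) := exists g : T -> R,
  [/\ measurable_fun [set: T'] g, g \in Lp, y = cls g &
   forall A, <<s G >> A ->
    (\int[mu]_(t in A) (g t)%:E = \int[mu]_(t in A) (Lspace_repr x t)%:E)%E].

Lemma is_condexp_ex x : exists y, is_condexp x y.
Proof.
have [g [mg ig gE]] := condexp_ex GT (Lp_L1 p1 (Lp_repr x)).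
exists (cls g), g; split=> //.
by have [] := condexp_contract GT p1 (Lp_repr x) mg ig gE.
Qed.

Lemma is_condexp_uniq x y z : is_condexp x y -> is_condexp x z -> y = z.
Proof.
move=> [g [mg gL -> gE]] [h [mh hL -> hE]]; apply/clsP => //.
apply: (condexp_unique GT mg mh); [exact: (Lp_L1 p1)..|].
by move=> A GA; rewrite gE// hE.
Qed.

Lemma is_condexp_le x y : is_condexp x y -> `|y| <= `|x|.
Proof.
move=> [g [mg gL -> gE]]; rewrite -[in leRHS](cls_repr x).
by have [] := condexp_contract GT p1 (Lp_repr x) mg (Lp_L1 p1 gL) gE.
Qed.

Lemma is_condexpZD a x y x' y' : is_condexp x x' -> is_condexp y y' ->
  is_condexp (a *: x + y) (a *: x' + y').
Proof.
move=> [g [mg gL -> gE]] [h [mh hL -> hE]].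
exists (fun t => a * g t + h t); split.
- by apply: measurable_funD => //; exact: measurable_funM.
- by rewrite (LpD p1)// (LpZ p1).
- by rewrite clsD ?(LpZ p1)// clsZ.
move=> A GA; have mA := GT GA.
have iA f : f \in Lp -> mu.-integrable A (EFin \o f).
  by move=> fL; apply: integrableS (Lp_L1 p1 fL).
have iZA f : f \in Lp -> mu.-integrable A (fun t => a%:E * (f t)%:E)%E.
  by move=> fL; apply: integrableZl => //; exact: iA.
transitivity (a%:E * \int[mu]_(t in A) (g t)%:E + \int[mu]_(t in A) (h t)%:E)%E.
  rewrite -integralZl//; last exact: iA.
  rewrite -integralD//; [exact: iZA|exact: iA].
rewrite gE// hE// -integralZl//; last exact/iA/Lp_repr.
rewrite -integralD//; [|exact/iZA/Lp_repr|exact/iA/Lp_repr].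
apply: ae_eq_integral => //.
- apply: emeasurable_funD.
    exact: measurable_int (iZA _ (Lp_repr x)).
  exact: measurable_int (iA _ (Lp_repr y)).
- exact/measurable_funTS/measurable_EFinP/(measurable_funPT (Lspace_repr _)).
apply: filterS2 (reprD (a *: x) y) (reprZ a x) => t /(_ I) -> /(_ I) -> _.
by [].
Qed.

Lemma Env_cP x : Env_c Y x <-> exists2 g : T -> R,
  measurable_fun [set: T'] g & g \in Lp /\ x = cls g.
Proof.
split=> [[f mf ->]|[g mg [gL ->]]].
  by exists f => //; split; [exact: LfunP|rewrite clsE].
by exists (Lfun_Sub p1 gL) => //; rewrite -clsE.
Qed.

Definition condexp (x : V) : V := sval (cid (is_condexp_ex x)).

Lemma condexpP x : is_condexp x (condexp x).
Proof. by rewrite /condexp; case: cid. Qed.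

Lemma condexp_id x : Env_c Y x -> condexp x = x.
Proof.
move=> /Env_cP[g mg [gL xE]]; apply: is_condexp_uniq (condexpP x) _.
exists g; split=> // A GA; have mA := GT GA.
apply: ae_eq_integral => //.
- by apply/measurable_funTS/measurable_EFinP/(Lp_measurable gL).
- exact/measurable_funTS/measurable_EFinP/(measurable_funPT (Lspace_repr _)).
by rewrite xE; apply: filterS (repr_cls p1 gL) => t /(_ I) ->.
Qed.

Lemma condexp_Env_c x : Env_c Y (condexp x).
Proof. by have [g [mg gL -> _]] := condexpP x; apply/Env_cP; exists g. Qed.

Lemma condexp_linear : linear condexp.
Proof.
move=> a x y; apply: is_condexp_uniq (condexpP _) _.
by apply: is_condexpZD; exact: condexpP.
Qed.

Lemma one_complemented_Env_c : one_complemented (Env_c Y).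
Proof.
pose P : {linear V -> V} := HB.pack condexp (GRing.isLinear.Build _ _ _ _ _ condexp_linear).
exists P; split.
- by move=> x; apply: condexp_id; exact: condexp_Env_c.
- by move=> x; exact: is_condexp_le (condexpP x).
apply/seteqP; split=> [x Yx|_ [x _ <-]]; last exact: condexp_Env_c.
by exists x => //; exact: condexp_id.
Qed.

End conditional_envelope.

(** The range of a projection is the set of its fixed points. *)
Lemma one_complemented_closed (R : realType) (X : normedModType R) (W : set X) :
  one_complemented W -> submod_closed (mem W) /\ closed W.
Proof.
move=> [P [PP Ple ->]]; split.
  apply: submod_closedP; first by exists 0; rewrite ?linear0.
  by move=> a _ _ [x _ <-] [y _ <-]; exists (a *: x + y); rewrite ?linearP.
have PW x : range P x -> P x = x by move=> [y _ <-]; exact: PP.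
have -> : range P = [set x | P x - x = 0].
  apply/seteqP; split=> x /=; first by move/PW => ->; rewrite subrr.
  by move/eqP; rewrite subr_eq0 => /eqP <-; exists x.
have cP : continuous P.
  apply: bounded_linear_continuous; apply/linear_boundedP.
  by near=> r => x; rewrite (le_trans (Ple x))// ler_peMl.
apply: (@preimage_closed _ _ (fun x => P x - x) [set 0]); last first.
  exact/accessible_closed_set1/hausdorff_accessible/norm_hausdorff.
by move=> x _; apply: continuousB; [exact: cP|exact: cvg_id].
Unshelve. all: by end_near. Qed.

Section conditional_envelope_lattice.
Context d (T : measurableType d) (R : realType).
Variables (mu : {finite_measure set T -> \bar R}) (p : R).
Hypothesis p1 : (1 <= p%:E)%E.
Local Notation V := (LspaceType mu p1).
Variable Y : set V.

Lemma sub_Env_c : Y `<=` Env_c Y.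
Proof.
move=> y Yy; apply/Env_cP; exists (Lspace_repr y); last by rewrite Lp_repr cls_repr.
move=> _ B mB; apply: sub_sigma_algebra; right.
exists (Lspace_repr y) => /=; first by rewrite Lspace_reprK.
by exists B.
Qed.

Lemma closed_sublattice_Env_c : closed_sublattice (Env_c Y).
Proof.
have [sE cE] := one_complemented_closed (one_complemented_Env_c Y).
apply: closed_sublattice_vabs => // x /Env_cP[g mg [gL ->]].
rewrite vabs_cls//; apply/Env_cP; exists (fun t => `|g t|).
  exact: measurableT_comp.
by rewrite (Lp_abs p1).
Qed.

Lemma Lat_Env_c : Y (Lspace_one mu p1) -> Lat Y = Env_c Y.
Proof.
move=> Y1; apply/seteqP; split=> [x|x Ex].
  by apply: smallest_sub; [exact: closed_sublattice_Env_c|exact: sub_Env_c].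
move=> L [sL YL]; apply: Env_c_sub Ex => //; exact: YL.
Qed.

End conditional_envelope_lattice.

(** * Isometries and the lattice structure *)

Section clarkson.
Context (R : realType).
Implicit Types a b s t u v p q : R.

Lemma powRD_gt q s t : 1 < q -> 0 < s -> 0 < t ->
  s `^ q + t `^ q < (s + t) `^ q.
Proof.
move=> q1 s0 t0; have q0 : 0 < q by exact: lt_trans q1.
have q10 : 0 < q - 1 by rewrite subr_gt0.
have st0 : 0 < s + t by exact: addr_gt0.
rewrite -!(@mulr_powRB1 _ _ q) ?ltW// mulrDl.
apply: ltrD; rewrite ltr_pM2l//; apply: gt0_ltr_powR => //; rewrite ?nnegrE ?ltW//.
- by rewrite ltrDl.
- by rewrite ltrDr.
Qed.

Lemma powRD_lt q s t : 0 < q -> q < 1 -> 0 < s -> 0 < t ->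
  (s + t) `^ q < s `^ q + t `^ q.
Proof.
move=> q0 q1 s0 t0; have q10 : 0 < 1 - q by rewrite subr_gt0.
have st0 : 0 < s + t by exact: addr_gt0.
have dec x y : 0 < x -> x < y -> y `^ (q - 1) < x `^ (q - 1).
  move=> x0 xy; have y0 := lt_trans x0 xy.
  rewrite -opprB !powRN ltf_pV2 ?posrE ?powR_gt0//.
  by apply: gt0_ltr_powR => //; rewrite ?nnegrE ltW.
rewrite -!(@mulr_powRB1 _ _ q) ?ltW// mulrDl.
by apply: ltrD; rewrite ltr_pM2l//; apply: dec => //; rewrite ?ltrDl ?ltrDr.
Qed.

(** Midpoint convexity, from the tangents at the midpoint. *)
Lemma powR_convex_mid q u v : 1 <= q -> 0 <= u -> 0 <= v ->
  2 * ((u + v) / 2) `^ q <= u `^ q + v `^ q.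
Proof.
move=> q1 u0 v0; set m := (u + v) / 2.
have m0 : 0 <= m by rewrite divr_ge0// addr_ge0.
have hu := powR_tangent m u q1; have hv := powR_tangent m v q1.
rewrite !ger0_norm// in hu hv; have := lerD hu hv.
set c := q * dmap q m.
have -> : m `^ q + c * (u - m) + (m `^ q + c * (v - m)) =
  2 * m `^ q + c * (u + v - 2 * m) by ring.
by have -> : u + v - 2 * m = 0; [rewrite /m; field|rewrite mulr0 addr0].
Qed.

(** Midpoint concavity below 1, from midpoint convexity for the inverse function. *)
Lemma powR_concave_mid q u v : 0 < q -> q < 1 -> 0 <= u -> 0 <= v ->
  u `^ q + v `^ q <= 2 * ((u + v) / 2) `^ q.
Proof.
move=> q0 q1 u0 v0; have q'1 : 1 <= q^-1 by rewrite invf_ge1// ltW.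
have := powR_convex_mid q'1 (powR_ge0 u q) (powR_ge0 v q).
rewrite -!powRrM divff ?gt_eqF// !powRr1// mulrC -ler_pdivlMr// => h.
rewrite mulrC -ler_pdivrMr//.
have UV0 : 0 <= (u `^ q + v `^ q) / 2 by rewrite divr_ge0 ?addr_ge0 ?powR_ge0.
have -> : (u `^ q + v `^ q) / 2 = (((u `^ q + v `^ q) / 2) `^ q^-1) `^ q.
  by rewrite -powRrM mulVf ?gt_eqF// powRr1.
by apply: (ge0_ler_powR (ltW q0)); rewrite ?nnegrE ?powR_ge0 ?divr_ge0 ?addr_ge0 ?powR_ge0.
Qed.

(** The defect in the parallelogram law for p-th powers, which is 0 for [p = 2]. *)
Definition clarkson p a b :=
  `|a + b| `^ p + `|a - b| `^ p - 2 * (`|a| `^ p + `|b| `^ p).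

Let sqrE p a : `|a| `^ p = (a ^+ 2) `^ (p / 2).
Proof.
rewrite -real_normK ?num_real// -powR_mulrn// -powRrM.
by congr (_ `^ _); field.
Qed.

Lemma clarkson0 p a b : 0 < p -> a * b = 0 -> clarkson p a b = 0.
Proof.
move=> p0 /eqP; rewrite mulf_eq0 /clarkson => /orP[]/eqP->.
  by rewrite add0r sub0r normrN normr0 powR0 ?gt_eqF// add0r; ring.
by rewrite addr0 subr0 normr0 powR0 ?gt_eqF// addr0; ring.
Qed.

(** With [q = p / 2], the squares of [a + b] and [a - b] have mean [a^2 + b^2]: convexity
bounds the sum of their q-th powers below by [2 (a^2 + b^2)^q], and superadditivity of
[t^q] is strict. *)
Lemma clarkson_gt0 p a b : 2 < p -> a * b != 0 -> 0 < clarkson p a b.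
Proof.
move=> p2; rewrite mulf_eq0 negb_or => /andP[a0 b0].
have q1 : 1 < p / 2 by rewrite ltr_pdivlMr// mul1r.
have := powR_convex_mid (ltW q1) (sqr_ge0 (a + b)) (sqr_ge0 (a - b)).
have -> : ((a + b) ^+ 2 + (a - b) ^+ 2) / 2 = a ^+ 2 + b ^+ 2 by field.
have := powRD_gt q1; move=> /(_ (a ^+ 2) (b ^+ 2)).
rewrite !exprn_even_gt0// => /(_ a0 b0).
by rewrite /clarkson !sqrE; lra.
Qed.

Lemma clarkson_lt0 p a b : 0 < p -> p < 2 -> a * b != 0 -> clarkson p a b < 0.
Proof.
move=> p0 p2; rewrite mulf_eq0 negb_or => /andP[a0 b0].
have q0 : 0 < p / 2 by rewrite divr_gt0.
have q1 : p / 2 < 1 by rewrite ltr_pdivrMr// mul1r.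
have := powR_concave_mid q0 q1 (sqr_ge0 (a + b)) (sqr_ge0 (a - b)).
have -> : ((a + b) ^+ 2 + (a - b) ^+ 2) / 2 = a ^+ 2 + b ^+ 2 by field.
have := powRD_lt q0 q1; move=> /(_ (a ^+ 2) (b ^+ 2)).
rewrite !exprn_even_gt0// => /(_ a0 b0).
by rewrite /clarkson !sqrE; lra.
Qed.

(** The two cases are merged: up to the sign [e], the defect is nonnegative and vanishes
only if one of the arguments does. *)
Lemma clarkson_sign p : 0 < p -> p != 2 -> exists e : R, forall a b,
  (0 <= e * clarkson p a b) /\ (e * clarkson p a b = 0 -> a * b = 0).
Proof.
move=> p0; case: ltgtP => // p2 _.
  exists (-1) => a b; have [ab0|ab0] := eqVneq (a * b) 0.
    by rewrite clarkson0// mulr0.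
  have := clarkson_lt0 p0 p2 ab0; split; first by lra.
  by move=> h; exfalso; lra.
exists 1 => a b; have [ab0|ab0] := eqVneq (a * b) 0.
  by rewrite clarkson0// mulr0.
have := clarkson_gt0 p2 ab0; split; first by lra.
by move=> h; exfalso; lra.
Qed.

End clarkson.

Section isometries.
Context d (T : measurableType d) (R : realType).
Variables (mu : {finite_measure set T -> \bar R}) (p : R).
Hypothesis p1 : (1 <= p%:E)%E.
Local Notation V := (LspaceType mu p1).
Local Notation Lp := (Lfun mu p%:E).
Local Notation cls := (@cls d T R mu p p1).
Hypothesis p2 : p != 2.
Implicit Types x y z : V.

Definition disj x y := \forall t \ae mu, Lspace_repr x t * Lspace_repr y t = 0.

Lemma integral_clarkson x y :
  let c t := clarkson p (Lspace_repr x t) (Lspace_repr y t) in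
  mu.-integrable [set: T] (EFin \o c) /\
  \int[mu]_t c t =
  `|x + y| `^ p + `|x - y| `^ p - 2 * (`|x| `^ p + `|y| `^ p).
Proof.
set X := Lspace_repr x; set Y := Lspace_repr y => c.
have XL : (X : T -> R) \in Lp by exact: Lp_repr.
have YL : (Y : T -> R) \in Lp by exact: Lp_repr.
have iX := integrable_Lp p1 XL; have iY := integrable_Lp p1 YL.
have DL : (fun t => X t + Y t) \in Lp by exact: (LpD p1).
have BL : (fun t => X t - Y t) \in Lp by exact: (LpB p1).
have iD := integrable_Lp p1 DL; have iB := integrable_Lp p1 BL.
have i1 := integrableD measurableT iD iB.
have i2 := integrableD measurableT iX iY.
have i3 := integrableZl measurableT 2 i2.
split; first by have := integrableB measurableT i1 i3.
rewrite /c /clarkson RintegralB// RintegralD// RintegralZl// RintegralD//.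
rewrite -(norm_cls p1 DL) -(norm_cls p1 BL) -(norm_cls p1 XL) -(norm_cls p1 YL).
by rewrite clsD// clsB// !cls_repr.
Qed.

(** Disjointness is a metric property, since the Clarkson defect has a constant sign. *)
Lemma disjP x y : disj x y <->
  `|x + y| `^ p + `|x - y| `^ p - 2 * (`|x| `^ p + `|y| `^ p) = 0.
Proof.
have [ic <-] := integral_clarkson x y; set c := fun t => _ in ic *.
have [e eP] := clarkson_sign (p_gt0 p1) p2.
split=> [xy|c0].
  rewrite /Rintegral (ae_eq_integral (cst 0%E)) ?integral0//.
    exact: measurable_int ic.
  by apply: filterS xy => t xy _ /=; rewrite /c clarkson0// p_gt0.
have iec : mu.-integrable [set: T] (EFin \o (fun t => e * c t)).
  by have := integrableZl measurableT e ic.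
have ec_ge0 t : 0 <= e * c t.
  by case: (eP (Lspace_repr x t) (Lspace_repr y t)).
have ec0 : \int[mu]_t (e * c t) <= 0 by rewrite RintegralZl// c0 mulr0.
apply: filterS (Rintegral_ge0_eq0 iec ec_ge0 ec0) => t /(_ I).
by case: (eP (Lspace_repr x t) (Lspace_repr y t)) => _; apply.
Qed.

Variable U : {linear V -> V}.
Hypothesis Uiso : forall x, `|U x| = `|x|.

Lemma disj_isometry x y : disj x y -> disj (U x) (U y).
Proof. by rewrite !disjP -linearD -linearB !Uiso. Qed.

Let h := Lspace_repr (U (Lspace_one mu p1)).
Let s t := Num.sg (h t).

(** With [s] the sign of [U 1], this says that [U f] has the sign [s] wherever it does not
vanish; it also implies that [U f] vanishes where [U 1] does. *)
Definition signed_image (f : T -> R) := f \in Lp /\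
  \forall t \ae mu, Lspace_repr (U (cls f)) t = s t * `|Lspace_repr (U (cls f)) t|.

Lemma sg_mul_norm (a : R) : Num.sg a * `|Num.sg a| = Num.sg a.
Proof. by case: sgrP; rewrite ?normrN1 ?normr1 ?normr0 ?mulr0 ?mulr1. Qed.

(** [U 1] is the sum of the disjoint functions [U 1_A] and [U 1_(~` A)], so it
coincides with [U 1_A] wherever the latter does not vanish. *)
Lemma signed_image_indic (A : set T) : measurable A -> signed_image \1_A.
Proof.
move=> mA; have AL := indic_Lp mu p1 mA; split=> //.
have mAc := measurableC mA; have AcL := indic_Lp mu p1 mAc.
have E1 : Lspace_one mu p1 = cls \1_A + cls \1_(~` A).
  rewrite -cls1 -clsD//; congr cls; apply/funext => t.
  by rewrite !indicE in_setC; case: (t \in A); rewrite /= ?addr0 ?add0r.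
have : disj (U (cls \1_A)) (U (cls \1_(~` A))).
  apply: disj_isometry; apply: filterS2 (repr_cls p1 AL) (repr_cls p1 AcL).
  move=> t /(_ I) -> /(_ I) ->.
  by rewrite !indicE in_setC; case: (t \in A); rewrite /= ?mulr0 ?mul0r.
have : h = (fun t => Lspace_repr (U (cls \1_A)) t +
    Lspace_repr (U (cls \1_(~` A))) t) %[ae mu].
  by rewrite /h E1 linearD; exact: reprD.
apply: filterS2 => t /(_ I); rewrite /s => -> /eqP; rewrite mulf_eq0.
by case/orP => /eqP ->; rewrite ?normr0 ?mulr0// addr0 -numEsg.
Qed.

Lemma signed_image_cone (a : R) f g : 0 <= a ->
  signed_image f -> signed_image g -> signed_image (fun t => a * f t + g t).
Proof.
move=> a0 [fL Sf] [gL Sg]; split; first by rewrite (LpD p1)// (LpZ p1).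
rewrite clsD ?(LpZ p1)// clsZ// linearP.
apply: filterS2 (reprD (a *: U (cls f)) (U (cls g)))
  (filterI (reprZ a (U (cls f))) (filterI Sf Sg)).
move=> t /(_ I) -> [/(_ I) -> [-> ->]].
set u := `|_|; set v := `|_|.
have -> : a * (s t * u) + s t * v = s t * (a * u + v) by ring.
have uv0 : 0 <= a * u + v by rewrite addr_ge0 ?mulr_ge0 ?normr_ge0.
by rewrite /s normrM (ger0_norm uv0) mulrA sg_mul_norm.
Qed.

Lemma continuous_isometry : continuous U.
Proof.
apply: bounded_linear_continuous; apply/linear_boundedP.
by near=> r => x; rewrite Uiso ler_peMl.
Unshelve. all: by end_near. Qed.

(** The map [a |-> a - s |a|] is 2-Lipschitz, so that the property passes to limits in
norm. *)
Lemma signed_image_lim (f_ : nat -> T -> R) f :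
  f \in Lp -> (forall n, signed_image (f_ n)) ->
  cls (f_ n) @[n --> \oo] --> cls f -> signed_image f.
Proof.
move=> fL Sf cf; split=> //.
set z := U (cls f); pose Z n := U (cls (f_ n)).
have cZ : Z n @[n --> \oo] --> z by apply: continuous_cvg cf; exact: continuous_isometry.
pose k t := Lspace_repr z t - s t * `|Lspace_repr z t|.
have s1 t : `|s t| <= 1 by rewrite normr_sg lern1 leq_b1.
have mk : measurable_fun [set: T] k.
  apply: measurable_funB; first exact: measurable_funPT (Lspace_repr z).
  apply: measurable_funM.
    by apply: (measurableT_comp (@measurable_sg R)); exact: measurable_funPT h.
  by apply: measurableT_comp => //; exact: measurable_funPT (Lspace_repr z).
(* the Lipschitz estimate for [a |-> a - c |a|] *)
have kle (a b c : R) : `|c| <= 1 -> `|(a - c * `|a|) - (b - c * `|b|)| <= `|2 * (a - b)|.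
  move=> c1; have -> : (a - c * `|a|) - (b - c * `|b|) = (a - b) - c * (`|a| - `|b|) by ring.
  rewrite normrM (@ger0_norm _ 2)// (le_trans (ler_normB _ _))// mulrDl !mul1r lerD2l.
  rewrite normrM (le_trans _ (ler_dist_dist _ _))//.
  by rewrite -[leRHS]mul1r ler_wpM2r.
have kL : k \in Lp.
  apply: (le_Lp p1 mk (LpZ p1 2 (Lp_repr z))) => t.
  have := kle (Lspace_repr z t) 0 (s t) (s1 t).
  by rewrite normr0 mulr0 !subr0.
suff : cls k = 0.
  rewrite -cls0 => /(clsP p1 kL (Lp_cst mu p 0)); apply: filterS => t /(_ I) /=.
  by move/eqP; rewrite /k subr_eq0 => /eqP.
apply/eqP; rewrite -normr_le0; apply/ler_addgt0Pl => e e0; rewrite addr0.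
have /cvgrPdist_le /(_ (e / 2)) := cZ; rewrite divr_gt0// => /(_ isT).
move=> [N _ /(_ N (leqnn N))] /= zN.
apply: (@le_trans _ _ `|2 *: (z - Z N)|); last first.
  by rewrite normrZ ger0_norm// -ler_pdivlMl// mulrC.
rewrite -[_ *: _]cls_repr; apply: le_norm_cls => //; first exact: Lp_repr.
have [_ SN] := Sf N; move: SN; rewrite -/(Z N).
apply: filterS2 (filterI (reprZ 2 (z - Z N)) (reprB z (Z N))) => t [/(_ I) -> /(_ I) ->] SN.
have := kle (Lspace_repr z t) (Lspace_repr (Z N) t) (s t) (s1 t).
by rewrite -SN subrr subr0.
Qed.

Lemma signed_image_ge0 f : f \in Lp -> (forall t, 0 <= f t) -> signed_image f.
Proof.
move=> fL f0; apply: measurable_fun_ind_ge0 => //.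
- exact: Lp_measurable fL.
- exact: signed_image_indic.
- exact: signed_image_cone.
move=> f_ Sf mf_ ff cf.
have [_ _ cc] := cvg_cls p1 mf_ fL ff cf.
exact: signed_image_lim cc.
Qed.

(** The images of the positive and negative parts of [x] are disjoint and both have the
sign of [U 1]. *)
Lemma isometry_vabs x : \forall t \ae mu,
  Lspace_repr (U (vabs x)) t = s t * `|Lspace_repr (U x) t|.
Proof.
set X : T -> R := Lspace_repr x; have XL : X \in Lp by exact: Lp_repr.
have mX := Lp_measurable XL.
have absX t : `|X t| = X^\+ t + X^\- t.
  by rewrite -[LHS]/((Num.norm \o X) t) -funrposDneg.
have XE t : X t = X^\+ t - X^\- t by rewrite -[in LHS](funrposBneg X).
have posL : X^\+ \in Lp.
  apply: (le_Lp p1 (measurable_funrpos mX) XL) => t.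
  by rewrite absX (ger0_norm (funrpos_ge0 _ _)) lerDl.
have negL : X^\- \in Lp.
  apply: (le_Lp p1 (measurable_funrneg mX) XL) => t.
  by rewrite absX (ger0_norm (funrneg_ge0 _ _)) lerDr.
have [_ Sp] := signed_image_ge0 posL (funrpos_ge0 X).
have [_ Sn] := signed_image_ge0 negL (funrneg_ge0 X).
have vE : vabs x = cls X^\+ + cls X^\-.
  by rewrite -clsD// /vabs; congr cls; apply/funext => t; rewrite -absX.
have xE : x = cls X^\+ - cls X^\-.
  by rewrite -clsB// -[LHS]cls_repr; congr cls; apply/funext => t; rewrite -XE.
have : disj (U (cls X^\+)) (U (cls X^\-)).
  apply: disj_isometry; apply: filterS2 (repr_cls p1 posL) (repr_cls p1 negL).
  move=> t /(_ I) -> /(_ I) ->; rewrite /funrpos /funrneg.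
  have [X0|X0] := leP 0 (X t); last by rewrite mul0r.
  by rewrite max_r ?oppr_le0// mulr0.
have uv : U (vabs x) = U (cls X^\+) + U (cls X^\-) by rewrite vE linearD.
have ux : U x = U (cls X^\+) - U (cls X^\-) by rewrite {1}xE linearB.
rewrite uv ux => dj.
apply: filterS3 (reprD (U (cls X^\+)) (U (cls X^\-))) (reprB (U (cls X^\+)) (U (cls X^\-)))
  (filterI Sp (filterI Sn dj)) => t /(_ I) -> /(_ I) -> [+ [+ +]].
set a := Lspace_repr _ t; set b := Lspace_repr _ t => ha hb /eqP.
rewrite mulf_eq0 => /orP[]/eqP h0.
  by rewrite h0 add0r sub0r normrN -hb.
by rewrite h0 addr0 subr0 -ha.
Qed.

(** Where the sign [s] of [U 1] is not 1, [U 1] is at distance at least 1 from 1. So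
[(s - 1) |x|] is controlled by [U 1 - 1] as long as [|x|] stays below [n], and the rest
of [|x|] is estimated separately. *)
Lemma isometry_vabs_dist x n :
  `|U (vabs x) - vabs x| <= `|U x - x| +
    n%:R * 2 * `|U (Lspace_one mu p1) - Lspace_one mu p1| +
    2 * `|cls (fun t => `|Lspace_repr x t| - Num.min `|Lspace_repr x t| n%:R)|.
Proof.
set o := Lspace_one mu p1.
set r := fun t => _ - _.
have mx : measurable_fun [set: T] (Lspace_repr x) by exact: measurable_funPT.
have r0 t : 0 <= r t by rewrite subr_ge0 ge_min lexx.
have rL : r \in Lp.
  apply: (le_Lp p1 _ (Lp_repr x)).
    apply: measurable_funB; first exact: measurableT_comp.
    by apply: measurable_minr => //; exact: measurableT_comp.
  by move=> t; rewrite ger0_norm// /r lerBlDr lerDl le_min normr_ge0 ler0n.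
have -> : n%:R * 2 * `|U o - o| = `|(n%:R * 2) *: vabs (U o - o)|.
  by rewrite normrZ norm_vabs ger0_norm.
have -> : 2 * `|cls r| = `|2 *: cls r| by rewrite normrZ ger0_norm.
rewrite -(norm_vabs (U x - x)).
set A := vabs (U x - x); set B := _ *: vabs (U o - o); set C := 2 *: cls r.
have AL := Lp_repr A; have BL := Lp_repr B; have CL := Lp_repr C.
pose m t := Lspace_repr A t + Lspace_repr B t + Lspace_repr C t.
have mL : m \in Lp by rewrite (LpD p1)// (LpD p1).
apply: (@le_trans _ _ `|cls m|); last first.
  rewrite clsD ?(LpD p1)// clsD// !cls_repr.
  by rewrite (le_trans (ler_normD _ _))// lerD2r ler_normD.
rewrite -[U (vabs x) - vabs x]cls_repr; apply: le_norm_cls => //; first exact: Lp_repr.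
have HA := aeI (repr_vabs (U x - x)) (reprB (U x) x).
have HB := aeI (reprZ (n%:R * 2) (vabs (U o - o)))
  (aeI (repr_vabs (U o - o)) (reprB (U o) o)).
have HC := aeI (reprZ 2 (cls r)) (repr_cls p1 rL).
have HD := aeI (reprB (U (vabs x)) (vabs x)) (aeI (isometry_vabs x) (repr_vabs x)).
have H1 : Lspace_repr o = (fun=> 1) %[ae mu].
  by rewrite /o -cls1; apply: repr_cls; exact: Lp_cst.
have := aeI (aeI HA HB) (aeI (aeI HC HD) H1); apply: filterS => t.
rewrite /m /A /B /C /s /h -/o.
move=> [[[/(_ I) -> /(_ I) ->] [/(_ I) -> [/(_ I) -> /(_ I) ->]]]].
move=> [[[/(_ I) -> /(_ I) ->] [/(_ I) -> [-> /(_ I) ->]]] /(_ I) ->]; cbv beta.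
rewrite [leRHS]ger0_norm ?addr_ge0 ?mulr_ge0//.
rewrite /r; move: (Lspace_repr (U o) t) (Lspace_repr (U x) t) (Lspace_repr x t).
move=> hh u w.
have sg1 : `|Num.sg hh| <= 1 by rewrite normr_sg lern1 leq_b1.
have sgB : `|Num.sg hh - 1| <= 2.
  by rewrite (le_trans (ler_normB _ _))// normr1 -[2]/(1 + 1) lerD2r.
(* if [hh <= 0] then [hh] is at distance at least 1 from 1 *)
have sgh : `|Num.sg hh - 1| <= 2 * `|hh - 1|.
  have [hh0|hh0] := ltP 0 hh; first by rewrite gtr0_sg// subrr normr0 mulr_ge0.
  have := ler_norm (1 - hh); rewrite distrC => h1; lra.
have -> : Num.sg hh * `|u| - `|w| =
  Num.sg hh * (`|u| - `|w|) + (Num.sg hh - 1) * `|w| by ring.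
have m0 : 0 <= Num.min `|w| n%:R by rewrite le_min normr_ge0 ler0n.
have mn : Num.min `|w| n%:R <= n%:R by rewrite ge_min lexx orbT.
have mw : 0 <= `|w| - Num.min `|w| n%:R by rewrite subr_ge0 ge_min lexx.
rewrite -addrA (le_trans (ler_normD _ _))// lerD//.
  rewrite normrM (le_trans _ (ler_dist_dist _ _))//.
  by rewrite -[leRHS]mul1r ler_wpM2r.
rewrite normrM normr_id -[X in _ * X](subrK (Num.min `|w| n%:R)) mulrDr addrC.
apply: lerD; first exact: ler_wpM2r.
rewrite -mulrA [leRHS]mulrC; exact: ler_pM.
Qed.

End isometries.

Section env.
Context d (T : measurableType d) (R : realType).
Variables (mu : {finite_measure set T -> \bar R}) (p : R).
Hypothesis p1 : (1 <= p%:E)%E.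
Local Notation V := (LspaceType mu p1).
Local Notation cls := (@cls d T R mu p p1).
Hypothesis p2 : p != 2.

Lemma cvg_truncation (x : V) :
  cls (fun t => `|Lspace_repr x t| - Num.min `|Lspace_repr x t| n%:R) @[n --> \oo] --> 0.
Proof.
have mx : measurable_fun [set: T] (Lspace_repr x) by exact: measurable_funPT.
have [||||_ _] := @cvg_cls _ _ _ mu _ p1
  (fun n t => `|Lspace_repr x t| - Num.min `|Lspace_repr x t| n%:R) (cst 0)
  (fun t => `|Lspace_repr x t|).
- move=> n; apply: measurable_funB; first exact: measurableT_comp.
  by apply: measurable_minr => //; exact: measurableT_comp.
- by rewrite (Lp_abs p1)// Lp_repr.
- move=> n t; rewrite ger0_norm ?subr_ge0 ?ge_min ?lexx//.
  by rewrite lerBlDr lerDl le_min normr_ge0 ler0n.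
- move=> t; apply: cvg_near_cst; near=> n.
  rewrite min_l ?subrr//; near: n; exact: nbhs_infty_ger.
by rewrite [X in _ --> X]cls0.
Unshelve. all: by end_near. Qed.

(** The truncation level is chosen first, then the index of the net. *)
Lemma cvg_isometry_vabs (I : Type) (F : set_system I) (FF : ProperFilter F)
    (U : I -> {linear V -> V}) x : (forall i z, `|U i z| = `|z|) ->
  U i (Lspace_one mu p1) @[i --> F] --> Lspace_one mu p1 ->
  U i x @[i --> F] --> x -> U i (vabs x) @[i --> F] --> vabs x.
Proof.
move=> Uiso /cvgrPdistC_lt c1 /cvgrPdistC_lt cx; apply/cvgrPdistC_lt => e e0.
have /cvgrPdistC_lt /(_ (e / 8)) := cvg_truncation x.
rewrite divr_gt0// => /(_ isT)[N _ /(_ N (leqnn N))]; rewrite subr0 => /= rN.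
have k0 : 0 < e / (8 * N.+1%:R) by rewrite divr_gt0// mulr_gt0.
near=> i.
have := isometry_vabs_dist p2 (Uiso i) x N.
have : `|U i x - x| < e / 8 by near: i; apply: cx; rewrite divr_gt0.
have : `|U i (Lspace_one mu p1) - Lspace_one mu p1| < e / (8 * N.+1%:R).
  by near: i; exact: c1.
set u := `|_|; set v := `|_|; set w := `|_|; set r := `|_| in rN * => hu hv hw.
have Nu : N%:R * u <= e / 8.
  have -> : e / 8 = N.+1%:R * (e / (8 * N.+1%:R)).
    have M0 : 0 < (N.+1%:R : R) by [].
    by move: (N.+1%:R : R) M0 => M M0; field; rewrite gt_eqF.
  by rewrite ler_pM ?ler_nat ?normr_ge0// ltW.
have : N%:R * 2 * u = 2 * (N%:R * u) by ring.
lra.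
Unshelve. all: by end_near. Qed.

Lemma tails_proper I (le : I -> I -> Prop) : directed le -> ProperFilter (tails le).
Proof.
move=> [[i0] lexx' letr ledir]; apply: filter_from_proper.
  apply: filter_from_filter; first by exists i0.
  move=> i j _ _; have [k [ik jk]] := ledir i j; exists k => // l /= kl.
  by split; [exact: letr ik kl|exact: letr jk kl].
by move=> i _; exists i; exact: lexx'.
Qed.

Lemma Env_c_sub_Env (Y : set V) : Y (Lspace_one mu p1) -> Env_c Y `<=` Env Y.
Proof.
move=> Y1 x Ex I le U dir Uiso UY.
have FF := tails_proper dir.
have Uiso' i z : `|U i z| = `|z| by case: (Uiso i).
pose S := [set x : V | U i x @[i --> tails le] --> x].
suff : S x by [].
apply: Env_c_sub Ex => //; last exact: UY.
apply: closed_sublattice_vabs.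
- apply: submod_closedP.
    by rewrite /S /=; under eq_fun do rewrite linear0; exact: cvg_cst.
  move=> a y z Sy Sz; rewrite /S /=; under eq_fun do rewrite linearP.
  by apply: cvgD => //; apply: cvgZr.
- by move=> y Sy; apply: cvg_isometry_vabs => //; exact: UY.
move=> y cly; apply/cvgrPdistC_lt => e e0.
have e3 : 0 < e / 3 by rewrite divr_gt0.
have [z [Sz]] := cly _ (nbhsx_ballx y (e / 3) e3).
rewrite -ball_normE /= => yz.
have {Sz} /cvgrPdistC_lt/(_ _ e3) Sz := Sz.
near=> i; have Uz : `|U i z - z| < e / 3 by near: i.
have -> : U i y - y = U i (y - z) + ((U i z - z) + (z - y)).
  by rewrite linearB !addrA !subrK.
have h1 := ler_normD (U i (y - z)) ((U i z - z) + (z - y)).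
have h2 := ler_normD (U i z - z) (z - y).
rewrite Uiso' in h1; rewrite distrC in yz; rewrite (distrC y z) in h1; lra.
Unshelve. all: by end_near. Qed.

End env.

(** * Ranges of contractive projections *)

Section bootstrap.
Context d (T : measurableType d) (R : realType).
Variables (mu : {finite_measure set T -> \bar R}) (r s : R).
Hypotheses (r2 : 2 < r) (s1 : 1 < s) (rs : (r - 1) * (s - 1) = 1).
Variables A B : (T -> R) -> Prop.
Hypothesis A_Lr : forall f, A f -> f \in Lfun mu r%:E.
Hypothesis AB : forall f, A f -> B (dmap r \o f).
Hypothesis BA : forall f, B f -> A (dmap s \o f).
Hypothesis A1 : A (fun=> 1).
Hypothesis AZD : forall c f g, A f -> A g -> A (fun t => f t + c * g t).
Hypothesis BZB : forall c f g, B f -> B g -> B (fun t => c * (f t - g t)).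
Hypothesis Alim : forall (f_ : nat -> T -> R) f g, (forall n, A (f_ n)) ->
  g \in Lfun mu r%:E -> (forall n t, `|f_ n t| <= g t) ->
  (forall t, f_ n t @[n --> \oo] --> f t) -> A f.
Hypothesis Blim : forall (f_ : nat -> T -> R) f g, (forall n, B (f_ n)) ->
  g \in Lfun mu s%:E -> (forall n t, `|f_ n t| <= g t) ->
  (forall t, f_ n t @[n --> \oo] --> f t) -> B f.
Implicit Types f : T -> R.

Let r1 : 1 < r. Proof. by move: r2; lra. Qed.
Let r10 : 0 < r - 1. Proof. by rewrite subr_gt0. Qed.
Let rE : (1 <= r%:E)%E. Proof. by rewrite lee_fin ltW. Qed.
Let sE : (1 <= s%:E)%E. Proof. by rewrite lee_fin ltW. Qed.

Lemma conj_powR (a : R) : (a `^ (r - 1)) `^ s = a `^ r.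
Proof.
rewrite -powRrM; congr (_ `^ _).
have -> : (r - 1) * s = (r - 1) * (s - 1) + (r - 1) by ring.
by rewrite rs; ring.
Qed.

Lemma Lr_powR f : f \in Lfun mu r%:E -> (fun t => `|f t| `^ (r - 1)) \in Lfun mu s%:E.
Proof.
move=> fL; have mf := Lp_measurable fL.
apply/(Lp_int mu sE).
  apply: (measurableT_comp (measurable_powR (r - 1))).
  exact: measurableT_comp.
apply: eq_integrable (integrable_Lp rE fL) => // t _ /=.
by rewrite (ger0_norm (powR_ge0 _ _)) conj_powR.
Qed.

Lemma AZ c f : A f -> A (fun t => c * f t).
Proof.
move=> Af; have := AZD (c - 1) Af Af; congr A; apply/funext => t; ring.
Qed.

(** The difference quotients of [dmap r] at [f] along [|f|^gam] are in [B], hence so is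
their limit [(r - 1) |f|^(r - 2 + gam)]; its image by [dmap s] is in [A]. *)
Lemma bootstrap_step f (gam : R) : 0 <= gam -> A f ->
  A (fun t => `|f t| `^ gam) ->
  A (fun t => `|f t| `^ (1 - (1 - gam) / (r - 1))).
Proof.
move=> gam0 Af Ag; set g := fun t => `|f t| `^ gam in Ag.
have g0 t : 0 <= g t by exact: powR_ge0.
have fL := A_Lr Af; have gL := A_Lr Ag.
(* [M] bounds [f] and its increments, and [(r - 1) M^(r - 1)] the difference quotients *)
pose M t := `|f t| + g t.
have M0 t : 0 <= M t by rewrite addr_ge0.
have ML : M \in Lfun mu r%:E by rewrite (LpD rE)// (Lp_abs rE).
have BD : B (fun t => (r - 1) * `|f t| `^ (r - 2) * g t).
  apply: (Blim (f_ := fun n t => n.+1%:R * (dmap r (f t + g t / n.+1%:R) - dmap r (f t)))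
    (g := fun t => (r - 1) * `|M t| `^ (r - 1))).
  - move=> n; apply: BZB; last exact: AB.
    have := AB (AZD (n.+1%:R^-1) Af Ag); congr B; apply/funext => t /=.
    by rewrite [_^-1 * _]mulrC.
  - by apply: (LpZ sE); exact: Lr_powR.
  - move=> n t; rewrite normrM (@ger0_norm _ n.+1%:R)//.
    have gn : g t / n.+1%:R <= g t by rewrite ler_pdivrMr// ler_peMr// ler1n.
    have gn0 : 0 <= g t / n.+1%:R by rewrite divr_ge0.
    have h1 : `|f t + g t / n.+1%:R| <= M t.
      by rewrite (le_trans (ler_normD _ _))// lerD2l ger0_norm.
    have h2 : `|f t| <= M t by rewrite lerDl.
    have := ler_wpM2l (ler0n R n.+1) (dmap_lipschitz r2 h2 h1).
    move=> h; apply: le_trans h _.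
    rewrite [f t + _]addrC addrK (ger0_norm gn0) (ger0_norm (M0 t)).
    rewrite mulrCA -!mulrA [n.+1%:R * _]mulrC mulfVK// ler_wpM2l ?(ltW r10)//.
    have -> : r - 1 = (r - 2) + 1 by ring.
    rewrite (@powRD _ _ (r - 2) 1); last by apply/implyP => /eqP h; exfalso; move: r2 h; lra.
    by rewrite powRr1// ler_wpM2l ?powR_ge0// lerDr.
  - by move=> t; exact: dmap_derive.
have := AZ ((r - 1) `^ (s - 1))^-1 (BA BD); congr A; apply/funext => t /=.
have s10 : 0 < s - 1 by rewrite subr_gt0.
have e1 : `|f t| `^ (r - 2) * g t = `|f t| `^ (r - 2 + gam).
  rewrite /g (@powRD _ _ (r - 2) gam)//.
  by apply/implyP => /eqP h; exfalso; move: r2 gam0 h; lra.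
rewrite -mulrA e1 dmapE_ge0 ?mulr_ge0 ?powR_ge0 ?(ltW r10)//.
rewrite powRM ?powR_ge0 ?(ltW r10)// mulKf ?gt_eqF ?powR_gt0//.
rewrite -powRrM; congr (_ `^ _).
have -> : s - 1 = (r - 1)^-1 by rewrite -[LHS](mulKf (lt0r_neq0 r10)) rs mulr1.
by field; rewrite gt_eqF.
Qed.

(** Iterating from the constant 1, that is from exponent 0, the distance of the exponent
to 1 is divided by [r - 1] at each step. The hypothesis [2 < r] enters twice: it makes
the derivative of [dmap r] locally bounded, and the iteration converge. *)
Lemma bootstrap_abs f : A f -> A (fun t => `|f t|).
Proof.
move=> Af; pose al := (r - 1)^-1.
have al0 : 0 < al by rewrite invr_gt0.
have al1 : al < 1 by rewrite invf_lt1//; move: r2; lra.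
have aln n : 0 <= 1 - al ^+ n <= 1.
  by rewrite subr_ge0 exprn_ile1 ?(ltW al0) ?(ltW al1)//= lerBlDr lerDl exprn_ge0// ltW.
have An n : A (fun t => `|f t| `^ (1 - al ^+ n)).
  elim: n => [|n ih].
    rewrite expr0 subrr (_ : (fun t => _) = fun=> 1)//.
    by apply/funext => t; rewrite powRr0.
  have /andP[h0 _] := aln n.
  have := bootstrap_step h0 Af ih; congr A; apply/funext => t; congr (_ `^ _).
  by rewrite (subKr 1) exprSr.
apply: (Alim (f_ := fun n t => `|f t| `^ (1 - al ^+ n.+1)) (g := fun t => 1 + `|f t|)).
- by move=> n; exact: An.
- by rewrite (LpD rE) ?(Lp_abs rE) ?A_Lr// ; exact: Lp_cst.
- move=> n t; rewrite (ger0_norm (powR_ge0 _ _)); have /andP[h0 h1] := aln n.+1.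
  have [f1|f1] := leP `|f t| 1.
    apply: (@le_trans _ _ 1); last by rewrite lerDl.
    rewrite -[leRHS](_ : 1 `^ (1 - al ^+ n.+1) = 1); last by rewrite powR1.
    by apply: ge0_ler_powR; rewrite ?nnegrE.
  rewrite (le_trans (ler1_powR (ltW f1) h1))// lerDr//.
- move=> t; have [f0|f0] := eqVneq (f t) 0.
    rewrite f0 normr0; apply: cvg_near_cst; apply: nearW => n.
    by rewrite powR0// gt_eqF// subr_gt0 exprn_ilt1// ltW.
  have f0' : 0 < `|f t| by rewrite normr_gt0.
  rewrite -[X in _ --> X](@powRr1 _ `|f t|)//.
  rewrite /powR normr_eq0 (negbTE f0).
  apply: continuous_cvg; first exact: continuous_expR.
  apply: cvgMl; rewrite -[X in _ --> X]subr0; apply: cvgB; first exact: cvg_cst.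
  rewrite (cvg_shiftS (fun n => al ^+ n)).
  by apply: cvg_expr; rewrite ger0_norm ?ltW.
Qed.

End bootstrap.

Section projections.
Context d (T : measurableType d) (R : realType).
Variables (mu : {finite_measure set T -> \bar R}) (p : R).
Hypothesis p1 : (1 <= p%:E)%E.
Local Notation V := (LspaceType mu p1).
Local Notation Lp := (Lfun mu p%:E).
Local Notation cls := (@cls d T R mu p p1).
Implicit Types (x y u w : V) (f g : T -> R).

Section smooth.
Hypothesis p_gt1 : 1 < p.
Variable q : R.
Hypotheses (q_gt1 : 1 < q) (pq : (p - 1) * (q - 1) = 1).
Local Notation Lq := (Lfun mu q%:E).

Let q1 : (1 <= q%:E)%E. Proof. by rewrite lee_fin ltW. Qed.

Lemma Lq_dmap f : f \in Lp -> (dmap p \o f) \in Lq.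
Proof.
move=> fL; have mf := Lp_measurable fL.
apply/(Lp_int mu q1); first exact: (measurableT_comp (measurable_dmap p)).
apply: eq_integrable (integrable_Lp p1 fL) => // t _ /=.
rewrite norm_dmap// -powRrM; congr (_ `^ _)%:E.
have -> : (p - 1) * q = (p - 1) * (q - 1) + (p - 1) by ring.
by rewrite pq; ring.
Qed.

Lemma Lp_dmap f : f \in Lq -> (dmap q \o f) \in Lp.
Proof.
move=> fL; have mf := Lp_measurable fL.
apply/(Lp_int mu p1); first exact: (measurableT_comp (measurable_dmap q)).
apply: eq_integrable (integrable_Lp q1 fL) => // t _ /=.
rewrite norm_dmap// -powRrM; congr (_ `^ _)%:E.
have -> : (q - 1) * p = (p - 1) * (q - 1) + (q - 1) by ring.
by rewrite pq; ring.
Qed.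

Lemma integrable_LqLp f g : f \in Lq -> g \in Lp ->
  mu.-integrable [set: T] (EFin \o (fun t => f t * g t)).
Proof.
move=> fL gL; have mf := Lp_measurable fL; have mg := Lp_measurable gL.
have iD := integrableD measurableT (integrable_Lp q1 fL) (integrable_Lp p1 gL).
apply: le_integrable iD => //.
  by apply/measurable_EFinP; exact: measurable_funM.
move=> t _; rewrite /= lee_fin normrM [leRHS]ger0_norm ?addr_ge0 ?powR_ge0//.
have q0 : 0 < q by exact: lt_trans q_gt1.
have p0 : 0 < p by exact: lt_trans p_gt1.
have pq' : q^-1 + p^-1 = 1.
  have : p * q = p + q by move: pq; lra.
  have -> : q^-1 + p^-1 = (p + q) / (p * q) by field; rewrite !gt_eqF.
  by move=> <-; rewrite divff// mulf_neq0// gt_eqF.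
have := conjugate_powR (normr_ge0 (f t)) (normr_ge0 (g t)) q0 p0 pq'.
move=> /le_trans; apply; apply: lerD.
  by rewrite ler_pdivrMr// ler_peMr ?powR_ge0// ltW.
by rewrite ler_pdivrMr// ler_peMr ?powR_ge0// ltW.
Qed.

Definition pairing f g := \int[mu]_t (f t * g t).

Lemma pairingDr f g h : f \in Lq -> g \in Lp -> h \in Lp ->
  pairing f (fun t => g t + h t) = pairing f g + pairing f h.
Proof.
move=> fL gL hL; rewrite /pairing -RintegralD ?integrable_LqLp//.
by apply: eq_Rintegral => t _; rewrite mulrDr.
Qed.

Lemma pairingZr a f g : f \in Lq -> g \in Lp ->
  pairing f (fun t => a * g t) = a * pairing f g.
Proof.
move=> fL gL; rewrite /pairing -RintegralZl ?integrable_LqLp//.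
by apply: eq_Rintegral => t _; rewrite mulrCA.
Qed.

Lemma pairing_ae f g h : f \in Lq -> g \in Lp -> h \in Lp -> g = h %[ae mu] ->
  pairing f g = pairing f h.
Proof.
move=> fL gL hL gh; congr fine; apply: ae_eq_integral => //.
- exact: measurable_int (integrable_LqLp fL gL).
- exact: measurable_int (integrable_LqLp fL hL).
by apply: filterS gh => t /(_ I) -> _.
Qed.

(** Integrated tangent inequality: up to the factor [p], [dmap p \o f] is a subgradient
of the p-th power of the norm at [f]. *)
Lemma norm_ge_pairing f g : f \in Lp -> g \in Lp ->
  `|cls f| `^ p + p * pairing (dmap p \o f) (fun t => g t - f t) <= `|cls g| `^ p.
Proof.
move=> fL gL; have gfL : (fun t => g t - f t) \in Lp by exact: (LpB p1).
have i1 := integrable_LqLp (Lq_dmap fL) gfL.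
have i2 := integrable_Lp p1 fL.
rewrite !norm_cls// /pairing -RintegralZl// -RintegralD//; last first.
  by have := integrableZl measurableT p i1.
apply: le_Rintegral => //.
- by have := integrableD measurableT i2 (integrableZl measurableT p i1).
- exact: integrable_Lp.
move=> t _ /=; rewrite mulrA; apply: powR_tangent; exact: ltW.
Qed.

Lemma cvg_pairing_dmap f g : f \in Lp -> g \in Lp ->
  pairing (dmap p \o (fun t => f t + g t / n.+1%:R)) g @[n --> \oo] -->
  pairing (dmap p \o f) g.
Proof.
move=> fL gL; have mf := Lp_measurable fL; have mg := Lp_measurable gL.
pose M t := `|f t| + `|g t|.
have M0 t : 0 <= M t by rewrite addr_ge0.
have ML : M \in Lp by rewrite (LpD p1) ?(Lp_abs p1).
have gn n t : `|g t / n.+1%:R| <= `|g t|.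
  by rewrite normrM normfV (@ger0_norm _ n.+1%:R)// ler_pdivrMr// ler_peMr// ler1n.
have [||||_] := @Rdominated_convergence _ _ _ mu
  (fun n t => dmap p (f t + g t / n.+1%:R) * g t)
  (fun t => dmap p (f t) * g t) (fun t => `|M t| `^ p); last exact.
- move=> n; apply: measurable_funM => //.
  apply: (measurableT_comp (measurable_dmap p)); apply: measurable_funD => //.
  exact: measurable_funM.
- exact: integrable_Lp.
- move=> n t; rewrite normrM norm_dmap// (ger0_norm (M0 t)).
  have p0 : 0 < p by exact: lt_trans p_gt1.
  rewrite -(mulr_powRB1 (M0 t) p0) mulrC; apply: ler_pM; rewrite ?powR_ge0//.
    by rewrite lerDr.
  apply: ge0_ler_powR; rewrite ?nnegrE ?subr_ge0 ?(ltW p_gt1)//.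
  by rewrite (le_trans (ler_normD _ _))// lerD2l.
- move=> t; apply: cvgMl; apply: dmap_cts => //.
  rewrite -[X in _ --> X]addr0 -(mulr0 (g t)); apply: cvgD; first exact: cvg_cst.
  by apply: cvgMr; exact: cvg_harmonic.
Qed.

Variable P : {linear V -> V}.
Hypotheses (PP : forall x, P (P x) = P x) (Ple : forall x, `|P x| <= `|x|).

(** Up to the factor [p], [dmap p \o f] is the derivative at [f] of the p-th power of the
norm. As [P] fixes [f] and is contractive, [f + t P x] is not longer than [f + t x];
the inequality between the derivatives at [t = 0] follows. *)
Lemma dmap_annihilates_le f x : f \in Lp -> P (cls f) = cls f ->
  pairing (dmap p \o f) (Lspace_repr (P x)) <= pairing (dmap p \o f) (Lspace_repr x).
Proof.
move=> fL Pf; set g := Lspace_repr x; set h := Lspace_repr (P x).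
have gL : (g : T -> R) \in Lp by exact: Lp_repr.
have hL : (h : T -> R) \in Lp by exact: Lp_repr.
have p0 : 0 < p by exact: lt_trans p_gt1.
rewrite -(cvg_lim _ (cvg_pairing_dmap fL gL))//; apply: limr_ge.
  by apply/cvg_ex; eexists; exact: cvg_pairing_dmap.
apply: nearW => n; pose t : R := n.+1%:R^-1.
have t0 : 0 < t by rewrite invr_gt0.
pose k s := f s + g s / n.+1%:R; pose l s := f s + h s / n.+1%:R.
have kE : k = (fun s => f s + t * g s) by apply/funext => s; rewrite /k mulrC.
have lE : l = (fun s => f s + t * h s) by apply/funext => s; rewrite /l mulrC.
have tgL := LpZ p1 t gL; have thL := LpZ p1 t hL.
have kL : k \in Lp by rewrite kE (LpD p1).
have lL : l \in Lp by rewrite lE (LpD p1).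
have clk : cls k = cls f + t *: x by rewrite kE clsD// clsZ// cls_repr.
have cll : cls l = cls f + t *: P x by rewrite lE clsD// clsZ// cls_repr.
have h1 := norm_ge_pairing fL lL.
have h2 := norm_ge_pairing kL fL.
have h3 : `|cls l| `^ p <= `|cls k| `^ p.
  by rewrite (le_norm_powR p1)// clk cll -Pf -linearZ -linearD -Pf PP.
have e1 : pairing (dmap p \o f) (fun s => l s - f s) = t * pairing (dmap p \o f) h.
  rewrite -pairingZr ?Lq_dmap//; congr pairing; apply/funext => s.
  by rewrite lE addrC addKr.
have e2 : pairing (dmap p \o k) (fun s => f s - k s) = - t * pairing (dmap p \o k) g.
  rewrite -pairingZr ?Lq_dmap//; congr pairing; apply/funext => s.
  by rewrite kE opprD addrA subrr sub0r mulNr.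
rewrite e1 in h1; rewrite e2 in h2.
have : p * (t * pairing (dmap p \o f) h) <= p * (t * pairing (dmap p \o k) g).
  move: h1 h2 h3; rewrite mulNr mulrN.
  move: (pairing _ h) (pairing _ g) (`|cls f| `^ p) (`|cls l| `^ p) (`|cls k| `^ p).
  by move=> a b u v w; lra.
by rewrite !ler_pM2l.
Qed.

Definition fixedf f := f \in Lp /\ P (cls f) = cls f.
(** The functionals on L_p that vanish on the kernel of [P], that is, the range of the
adjoint projection, represented in L_q. *)
Definition annihf f := f \in Lq /\
  forall x, pairing f (Lspace_repr (P x)) = pairing f (Lspace_repr x).

Lemma fixedf_dmap f : fixedf f -> annihf (dmap p \o f).
Proof.
move=> [fL Pf]; have jL := Lq_dmap fL; split=> // x.
apply/eqP; rewrite eq_le dmap_annihilates_le//=.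
have := dmap_annihilates_le (- x) fL Pf.
have E y : pairing (dmap p \o f) (Lspace_repr (- y)) =
    - pairing (dmap p \o f) (Lspace_repr y).
  rewrite -mulN1r -pairingZr ?Lp_repr//; apply: pairing_ae; rewrite ?Lp_repr//.
    by rewrite (LpZ p1)// Lp_repr.
  by rewrite -scaleN1r; exact: reprZ.
by rewrite linearN !E lerN2.
Qed.

(** Let [w] be [dmap q \o f], so that [f] is [dmap p \o w]. As [f] vanishes on the kernel
of [P], there is no first order term between [w] and [P w] in the expansion of the
p-th power of the norm, and [P w] is not longer than [w]: by strict convexity,
[P w = w]. *)
Lemma annihf_dmap f : annihf f -> fixedf (dmap q \o f).
Proof.
move=> [fL fP]; set w := dmap q \o f.
have wL : w \in Lp := Lp_dmap fL; split=> //.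
set v := Lspace_repr (P (cls w)).
have vL : (v : T -> R) \in Lp by exact: Lp_repr.
have fE : f = dmap p \o w by apply/funext => t; rewrite /w /= dmapK.
have e0 : pairing f (fun t => v t - w t) = 0.
  have -> : (fun t => v t - w t) = (fun t => v t + (-1) * w t).
    by apply/funext => t; rewrite mulN1r.
  rewrite pairingDr ?(LpZ p1)// pairingZr// fP mulN1r.
  rewrite (@pairing_ae _ _ w) ?Lp_repr// ?subrr//.
  exact: (repr_cls p1).
have vwL : (fun t => v t - w t) \in Lp by exact: (LpB p1).
have i1 := integrable_LqLp fL vwL.
have i2 := integrable_Lp p1 wL; have i3 := integrable_Lp p1 vL.
have ip1 := integrableZl measurableT p i1.
pose D t := `|v t| `^ p - (`|w t| `^ p + p * (f t * (v t - w t))).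
have iD : mu.-integrable [set: T] (EFin \o D).
  by have := integrableB measurableT i3 (integrableD measurableT i2 ip1).
(* [D] is the gap between the graph and the tangent at [w] *)
have D0 t : 0 <= D t.
  by rewrite /D subr_ge0 fE /= mulrA; apply: powR_tangent; exact: ltW.
have intD : \int[mu]_t D t <= 0.
  rewrite /D RintegralB//; last by have := integrableD measurableT i2 ip1.
  rewrite RintegralD// RintegralZl// -[X in p * X]/(pairing f _) e0 mulr0 addr0.
  by rewrite -!norm_cls// subr_le0 (le_norm_powR p1)// cls_repr.
rewrite -[LHS]cls_repr; apply/clsP => //.
apply: filterS (Rintegral_ge0_eq0 iD D0 intD) => t /(_ I) Dt _.
apply: (powR_tangent_eq p_gt1); move/eqP: Dt; rewrite /D subr_eq0 => /eqP ->.
by rewrite fE /= mulrA.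
Qed.

Lemma fixedfZD c f g : fixedf f -> fixedf g -> fixedf (fun t => f t + c * g t).
Proof.
move=> [fL Pf] [gL Pg]; split; first by rewrite (LpD p1)// (LpZ p1).
by rewrite clsD ?(LpZ p1)// clsZ// linearD linearZ Pf Pg.
Qed.

Lemma pairingDl f g h : f \in Lq -> g \in Lq -> h \in Lp ->
  pairing (fun t => f t + g t) h = pairing f h + pairing g h.
Proof.
move=> fL gL hL; rewrite /pairing -RintegralD ?integrable_LqLp//.
by apply: eq_Rintegral => t _; rewrite mulrDl.
Qed.

Lemma pairingZl c f h : f \in Lq -> h \in Lp ->
  pairing (fun t => c * f t) h = c * pairing f h.
Proof.
move=> fL hL; rewrite /pairing -RintegralZl ?integrable_LqLp//.
by apply: eq_Rintegral => t _; rewrite mulrA.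
Qed.

Lemma annihfZD c f g : annihf f -> annihf g -> annihf (fun t => f t + c * g t).
Proof.
move=> [fL Pf] [gL Pg]; split; first by rewrite (LpD q1)// (LpZ q1).
move=> x; rewrite !pairingDl ?(LpZ q1) ?Lp_repr// !pairingZl ?Lp_repr//.
by rewrite Pf Pg.
Qed.

Lemma fixedf_lim (f_ : nat -> T -> R) f g : (forall n, fixedf (f_ n)) ->
  g \in Lp -> (forall n t, `|f_ n t| <= g t) ->
  (forall t, f_ n t @[n --> \oo] --> f t) -> fixedf f.
Proof.
move=> Ff gL fg cf.
have [||||_ fL cc] := @cvg_cls _ _ _ mu _ p1 f_ f g => //.
  by move=> n; have [fn _] := Ff n; exact: Lp_measurable fn.
split=> //.
have [_ cW] : submod_closed (mem (range P)) /\ closed (range P).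
  by apply: one_complemented_closed; exists P.
have [x _ <-] : range P (cls f); last exact: PP.
apply: (@closed_cvg _ _ _ _ (fun n => cls (f_ n)) (range P) cW _ _ cc).
by apply: nearW => n; exists (cls (f_ n)) => //; case: (Ff n).
Qed.

Lemma annihf_lim (f_ : nat -> T -> R) f g : (forall n, annihf (f_ n)) ->
  g \in Lq -> (forall n t, `|f_ n t| <= g t) ->
  (forall t, f_ n t @[n --> \oo] --> f t) -> annihf f.
Proof.
move=> Ff gL fg cf.
have mf_ n : measurable_fun [set: T] (f_ n).
  by have [fn _] := Ff n; exact: Lp_measurable fn.
have [||||_ fL _] := @cvg_cls _ _ _ mu _ q1 f_ f g => //.
split=> //.
have cp h : h \in Lp -> pairing (f_ n) h @[n --> \oo] --> pairing f h.
  move=> hL; have mh := Lp_measurable hL.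
  have [||||_] := @Rdominated_convergence _ _ _ mu (fun n t => f_ n t * h t)
    (fun t => f t * h t) (fun t => g t * `|h t|); last exact.
  - by move=> n; exact: measurable_funM.
  - by apply: integrable_LqLp => //; exact: (Lp_abs p1).
  - by move=> n t; rewrite normrM ler_wpM2r.
  - by move=> t; apply: cvgMl; exact: cf.
move=> x; have c1 := cp _ (Lp_repr (P x)); have c2 := cp _ (Lp_repr x).
apply: (cvg_unique _ c1) => //.
have -> : (fun n => pairing (f_ n) (Lspace_repr (P x))) =
  (fun n => pairing (f_ n) (Lspace_repr x)); last exact: c2.
by apply/funext => n; case: (Ff n).
Qed.

Hypothesis P1 : P (Lspace_one mu p1) = Lspace_one mu p1.

Lemma fixedf1 : fixedf (fun=> 1).
Proof. by split; [exact: Lp_cst|rewrite cls1]. Qed.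

Lemma annihf1 : annihf (fun=> 1).
Proof.
have := fixedf_dmap fixedf1; congr annihf; apply/funext => t /=; exact: dmap1.
Qed.

End smooth.

(** The spaces of fixed functions and of functionals vanishing on the kernel are exchanged
by the duality maps. Whichever of [p] and [q] is above 2 provides the space in which
the absolute value is built; for [p < 2], one goes back by
[|f| = dmap q |dmap p f|]. *)
Lemma fixedf_abs (p_gt1 : 1 < p) (p2 : p != 2) (P : {linear V -> V}) f :
  (forall x, P (P x) = P x) -> (forall x, `|P x| <= `|x|) ->
  P (Lspace_one mu p1) = Lspace_one mu p1 ->
  f \in Lp -> P (cls f) = cls f -> P (cls (fun t => `|f t|)) = cls (fun t => `|f t|).
Proof.
move=> PP Ple P1 fL Pf.
(* the conjugate exponent of [p] *)
pose q : R := (p - 1)^-1 + 1.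
have p10 : 0 < p - 1 by rewrite subr_gt0.
have q_gt1 : 1 < q by rewrite /q ltrDr invr_gt0.
have pq : (p - 1) * (q - 1) = 1 by rewrite /q addrK mulfV// gt_eqF.
have qp : (q - 1) * (p - 1) = 1 by rewrite mulrC.
have Ff : fixedf P f by [].
suff : fixedf P (fun t => `|f t|) by case.
have BZB (Q : (T -> R) -> Prop) : (forall c f g, Q f -> Q g -> Q (fun t => f t + c * g t)) ->
    forall c f g, Q f -> Q g -> Q (fun t => c * (f t - g t)).
  move=> QZD c g h Qg Qh; have Q1 := QZD (-1) _ _ Qg Qh.
  by have := QZD (c - 1) _ _ Q1 Q1; congr Q; apply/funext => t; ring.
have [p_lt2|p_gt2|pE] := ltgtP p 2; last by rewrite pE eqxx in p2.
- have q_gt2 : 2 < q.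
    by rewrite /q -[2]/(1 + 1) ltrD2r invf_gt1//; move: p_lt2; lra.
  have Af := fixedf_dmap p_gt1 q_gt1 pq PP Ple Ff.
  have : annihf q P (fun t => `|dmap p (f t)|).
    apply: (@bootstrap_abs _ _ _ mu q p q_gt2 p_gt1 qp (annihf q P) (fixedf P)
      _ _ _ _ _ _ _ _ (dmap p \o f) Af).
    + by move=> g [].
    + by move=> g; exact: annihf_dmap.
    + by move=> g; exact: fixedf_dmap.
    + exact: annihf1.
    + by move=> c g h; exact: annihfZD.
    + by apply: BZB => c g h; exact: fixedfZD.
    + by move=> f_ g h; exact: annihf_lim.
    + by move=> f_ g h; exact: fixedf_lim.
  move=> /(annihf_dmap p_gt1 q_gt1 pq Ple); congr fixedf; apply/funext => t /=.
  rewrite norm_dmap// -[RHS](dmapK `|f t| q_gt1 p_gt1 qp).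
  by rewrite (@dmapE_ge0 _ p).
- apply: (@bootstrap_abs _ _ _ mu p q p_gt2 q_gt1 pq (fixedf P) (annihf q P)
    _ _ _ _ _ _ _ _ f Ff).
  + by move=> g [].
  + by move=> g; exact: fixedf_dmap.
  + by move=> g; exact: annihf_dmap.
  + exact: fixedf1.
  + by move=> c g h; exact: fixedfZD.
  + by apply: BZB => c g h; exact: annihfZD.
  + by move=> f_ g h; exact: fixedf_lim.
  + by move=> f_ g h; exact: annihf_lim.
Qed.

Section p_eq1.
Hypothesis pE : p = 1.

Lemma norm_cls_L1 f : f \in Lp -> `|cls f| = \int[mu]_t `|f t|.
Proof.
have powp (a : R) : 0 <= a -> a `^ p = a by move=> a0; rewrite pE powRr1.
move=> fL; rewrite -[LHS]powp// norm_cls//.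
by apply: eq_Rintegral => t _; rewrite powp.
Qed.

Variable P : {linear V -> V}.
Hypothesis Ple : forall x, `|P x| <= `|x|.
Hypothesis P1 : P (Lspace_one mu p1) = Lspace_one mu p1.

(** Let [0 <= f] and [Z = P f]. Outside [0, n], the sum [|Z| + |n - Z|] exceeds [n]
by twice the distance to that interval; its integral is at most that of
[|f| + |n - f| = n + 2 (f - n)^+], which gives [\int Z^- <= \int (f - n)^+]. Then [n]
tends to infinity. *)
Lemma contraction_ge0 f : f \in Lp -> (forall t, 0 <= f t) ->
  {ae mu, forall t, 0 <= Lspace_repr (P (cls f)) t}.
Proof.
move=> fL f0; set Z := Lspace_repr _.
have ZL : (Z : T -> R) \in Lp by exact: Lp_repr.
have mf := Lp_measurable fL; have mZ := Lp_measurable ZL.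
pose N t := Num.max (- Z t) 0.
have NL : N \in Lp.
  apply: (le_Lp p1 _ ZL); first exact: (measurable_funrneg mZ).
  move=> t; rewrite /N ger0_norm ?le_max ?lexx ?orbT//.
  by rewrite ge_max normr_ge0 -normrN ler_norm.
pose r n t := f t - Num.min (f t) n%:R.
have r0 n t : 0 <= r n t by rewrite subr_ge0 ge_min lexx.
have rf n t : r n t <= f t by rewrite lerBlDr lerDl le_min f0 ler0n.
have mr n : measurable_fun [set: T] (r n).
  by apply: measurable_funB => //; exact: measurable_minr.
have rL n : r n \in Lp.
  by apply: (le_Lp p1 (mr n) fL) => t; rewrite !ger0_norm.
have iN := Lp_L1 p1 NL; have ir n := Lp_L1 p1 (rL n).
have key n : \int[mu]_t N t <= \int[mu]_t r n t.
  have cL : (fun=> n%:R) \in Lp by exact: Lp_cst.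
  have cE : cls (fun=> n%:R) = n%:R *: Lspace_one mu p1.
    rewrite -cls1 -clsZ ?Lp_cst//; congr cls; apply/funext => t; exact: esym (mulr1 _).
  have Pc : P (cls (fun=> n%:R)) = cls (fun=> n%:R) by rewrite cE linearZ P1.
  have kL : (fun t => n%:R - f t) \in Lp by exact: (LpB p1).
  have lL : (fun t => n%:R - Z t) \in Lp by exact: (LpB p1).
  have := lerD (Ple (cls f)) (Ple (cls (fun t => n%:R - f t))).
  rewrite [cls (fun t => n%:R - f t)]clsB// linearB Pc -(clsB p1 cL fL).
  rewrite -[P (cls f)]cls_repr -/Z -(clsB p1 cL ZL) !norm_cls_L1//.
  have iabs g : g \in Lp -> mu.-integrable [set: T] (EFin \o (fun t => `|g t|)).
    by move=> gL; apply: (Lp_L1 p1); exact: (Lp_abs p1).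
  rewrite -!RintegralD ?iabs// => h.
  have i2N : mu.-integrable [set: T] (EFin \o (fun t => 2 * N t)).
    by have := integrableZl measurableT 2 iN.
  have i2r : mu.-integrable [set: T] (EFin \o (fun t => 2 * r n t)).
    by have := integrableZl measurableT 2 (ir n).
  have ic := Lp_L1 p1 cL.
  (* [`|Z| + `|n - Z|] is at least [n], with excess at least [2 Z^-] *)
  have h1 : \int[mu]_t (n%:R + 2 * N t) <= \int[mu]_t (`|Z t| + `|n%:R - Z t|).
    apply: le_Rintegral => //.
    - by have := integrableD measurableT ic i2N.
    - by have := integrableD measurableT (iabs _ ZL) (iabs _ lL).
    move=> t _; rewrite /N; have [Z0|Z0] := leP (- Z t) 0.
      rewrite mulr0 addr0.
      have := ler_norm (n%:R - Z t); have := ler_norm (Z t); lra.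
    rewrite oppr_gt0 in Z0; rewrite (ltr0_norm Z0).
    have := ler_norm (n%:R - Z t); lra.
  have h2 : \int[mu]_t (`|f t| + `|n%:R - f t|) <= \int[mu]_t (n%:R + 2 * r n t).
    apply: le_Rintegral => //.
    - by have := integrableD measurableT (iabs _ fL) (iabs _ kL).
    - by have := integrableD measurableT ic i2r.
    move=> t _; rewrite /r (ger0_norm (f0 t)); have [fn|fn] := leP (f t) n%:R.
      by rewrite ger0_norm ?subr_ge0//; lra.
    by rewrite ltr0_norm ?subr_lt0//; lra.
  have := le_trans h1 (le_trans h h2).
  rewrite (RintegralD measurableT ic i2N) (RintegralD measurableT ic i2r).
  by rewrite (RintegralZl 2 measurableT iN) (RintegralZl 2 measurableT (ir n)); lra.
have cr : \int[mu]_t r n t @[n --> \oo] --> (0 : R).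
  have [||_] := @Rdominated_convergence _ _ _ mu r (cst 0) f mr (Lp_L1 p1 fL).
  - by move=> n t; rewrite ger0_norm.
  - move=> t; apply: cvg_near_cst; near=> n.
    by rewrite /r min_l ?subrr//; near: n; exact: nbhs_infty_ger.
  by rewrite [X in _ --> X](_ : _ = 0)// Rintegral_cst// mul0r.
have N0 : \int[mu]_t N t <= 0.
  rewrite -(cvg_lim _ cr)//; apply: limr_ge; last by apply: nearW => n; exact: key.
  by apply/cvg_ex; eexists; exact: cr.
have N_ge0 t : 0 <= N t by rewrite le_max lexx orbT.
apply: filterS (Rintegral_ge0_eq0 iN N_ge0 N0) => t /(_ I) Nt.
have : - Z t <= N t by rewrite le_max lexx.
by rewrite Nt oppr_le0.
Unshelve. all: by end_near. Qed.

(** Positivity gives [P |x| >= |x|], and contractivity forces the equality of the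
integrals. *)
Lemma fixed_vabs_L1 x : P x = x -> P (vabs x) = vabs x.
Proof.
move=> Px; set X := Lspace_repr x.
have XL : (X : T -> R) \in Lp by exact: Lp_repr.
have aL : (fun t => `|X t|) \in Lp by exact: (Lp_abs p1).
have h1 : {ae mu, forall t, 0 <= Lspace_repr (P (vabs x + x)) t}.
  have -> : vabs x + x = cls (fun t => `|X t| + X t) by rewrite clsD// cls_repr.
  apply: contraction_ge0; first exact: (LpD p1).
  by move=> t; rewrite -lerBlDr sub0r -normrN ler_norm.
have h2 : {ae mu, forall t, 0 <= Lspace_repr (P (vabs x - x)) t}.
  have -> : vabs x - x = cls (fun t => `|X t| - X t) by rewrite clsB// cls_repr.
  apply: contraction_ge0; first exact: (LpB p1).
  by move=> t; rewrite subr_ge0 ler_norm.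
rewrite linearD Px in h1; rewrite linearB Px in h2.
set z := P (vabs x) in h1 h2 *.
have zL := Lp_repr z.
have zX : {ae mu, forall t, `|X t| <= Lspace_repr z t}.
  have h3 := aeI h1 (reprD z x); have h4 := aeI h2 (reprB z x).
  apply: filterS2 h3 h4 => t [a1 /(_ I) a2] [b1 /(_ I) b2].
  rewrite a2 -/X in a1; rewrite b2 -/X in b1.
  by rewrite ler_norml; apply/andP; split; lra.
pose D t := Num.max (Lspace_repr z t - `|X t|) 0.
have DL0 : (fun t => Lspace_repr z t - `|X t|) \in Lp by exact: (LpB p1).
have DL : D \in Lp.
  apply: (le_Lp p1 _ DL0); first exact: (measurable_funrpos (Lp_measurable DL0)).
  move=> t; rewrite /D ger0_norm ?le_max ?lexx ?orbT//.
  by rewrite ge_max normr_ge0 ler_norm.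
have iD := Lp_L1 p1 DL.
have D0 : \int[mu]_t D t <= 0.
  have -> : \int[mu]_t D t = \int[mu]_t (`|Lspace_repr z t| - `|X t|).
    congr fine; apply: ae_eq_integral => //.
    - exact: measurable_int iD.
    - by apply/measurable_EFinP/(@Lp_measurable _ _ _ mu p)/(LpB p1)=> //; exact: (Lp_abs p1).
    apply: filterS zX => t zX _; rewrite /D max_l ?subr_ge0//.
    by rewrite (@ger0_norm _ (Lspace_repr z t))// (le_trans _ zX).
  rewrite RintegralB//; [|exact: Lp_L1 (Lp_abs p1 zL)|exact: Lp_L1 aL].
  rewrite subr_le0 -!norm_cls_L1// !cls_repr /z (le_trans (Ple _))//.
  by rewrite norm_vabs.
have D_ge0 t : 0 <= D t by rewrite le_max lexx orbT.
rewrite -[LHS]cls_repr; apply/clsP => //.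
apply: filterS2 zX (Rintegral_ge0_eq0 iD D_ge0 D0) => t zX /(_ I) Dt _.
apply/eqP; rewrite eq_le zX andbT -subr_le0 -Dt /D le_max lexx//.
Qed.

End p_eq1.

(** Fails for [p = 2], where all closed subspaces are one-complemented. *)
Lemma one_complemented_sublattice (W : set V) : p != 2 -> one_complemented W ->
  W (Lspace_one mu p1) -> closed_sublattice W.
Proof.
move=> p2 W1c W1; have [sW cW] := one_complemented_closed W1c.
move: W1c => [P [PP Ple WE]]; rewrite WE in sW cW W1 *.
have Pfix x : range P x -> P x = x by move=> [y _ <-].
have P1 := Pfix _ W1.
apply: closed_sublattice_vabs => // x Wx; exists (vabs x) => //.
have := p_ge1 p1; rewrite le_eqVlt => /predU1P[pE|p_gt1].
  by apply: fixed_vabs_L1 => //; exact: Pfix.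
by apply: fixedf_abs => //; [exact: Lp_repr|rewrite cls_repr; exact: Pfix].
Qed.

End projections.

(** * Rearrangements of the unit interval *)

Section koopman.
Context d (T : measurableType d) (R : realType).
Variables (mu : {finite_measure set T -> \bar R}) (p : R).
Hypothesis p1 : (1 <= p%:E)%E.
Local Notation V := (LspaceType mu p1).
Local Notation Lp := (Lfun mu p%:E).
Local Notation cls := (@cls d T R mu p p1).
Implicit Types (x y : V) (f g : T -> R).

Definition measure_preserving (phi : T -> T) :=
  measurable_fun [set: T] phi /\
  forall A, measurable A -> mu (phi @^-1` A) = mu A.

Section one_map.
Variable phi : T -> T.
Hypothesis phiP : measure_preserving phi.

Lemma ae_comp (Q : T -> Prop) : {ae mu, forall t, Q t} -> {ae mu, forall t, Q (phi t)}.
Proof.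
have [mphi muphi] := phiP.
move=> [N [mN N0 sN]]; exists (phi @^-1` N); split.
- by rewrite -[_ @^-1` _]setTI; exact: mphi.
- by rewrite muphi.
- by move=> t; exact: sN.
Qed.

Lemma integral_comp (f : T -> \bar R) : measurable_fun [set: T] f ->
  (forall t, (0 <= f t)%E) -> (\int[mu]_t f (phi t) = \int[mu]_t f t)%E.
Proof.
have [mphi muphi] := phiP.
move=> mf f0; have := ge0_integral_pushforward mphi mu measurableT mf (fun t _ => f0 t).
rewrite preimage_setT => <-; apply: eq_measure_integral => //.
by move=> A mA _; exact: muphi.
Qed.

Lemma Lp_comp f : f \in Lp -> (fun t => f (phi t)) \in Lp.
Proof.
have [mphi _] := phiP.
move=> fL; have mf := Lp_measurable fL.
have mfp : measurable_fun [set: T] (fun t => f (phi t)) by exact: (measurableT_comp mf).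
apply/(Lp_int mu p1 mfp)/integrableP; split.
  by apply/measurable_EFinP; exact: measurable_powR_abs.
have /integrableP[mfi] := integrable_Lp p1 fL; apply: le_lt_trans.
pose G : T -> \bar R := EFin \o (fun u => `|f u| `^ p).
rewrite -(integral_comp (f := fun t => `|G t|%E))//.
exact: measurableT_comp.
Qed.

Lemma norm_comp f : f \in Lp -> `|cls (fun t => f (phi t))| = `|cls f|.
Proof.
move=> fL; have fpL := Lp_comp fL; have mf := Lp_measurable fL.
suff E : `|cls (fun t => f (phi t))| `^ p = `|cls f| `^ p.
  by apply/le_anti; rewrite -(le_norm_powR p1)// E lexx /= -(le_norm_powR p1)// E lexx.
rewrite (norm_cls p1 fpL) (norm_cls p1 fL).
congr fine; rewrite -(integral_comp (f := fun t => (`|f t| `^ p)%:E))//.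
  by apply/measurable_EFinP; exact: measurable_powR_abs.
Qed.

Definition koopman x : V := cls (fun t => Lspace_repr x (phi t)).

Lemma koopman_cls f : f \in Lp -> koopman (cls f) = cls (fun t => f (phi t)).
Proof.
move=> fL; apply/clsP; [exact: Lp_comp (Lp_repr _)|exact: Lp_comp|].
by apply: filterS (ae_comp (repr_cls p1 fL)) => t /(_ I) -> _.
Qed.

Lemma koopman_linear : linear koopman.
Proof.
move=> a x y; rewrite -[in LHS](cls_repr x) -[in LHS](cls_repr y).
have xL := Lp_repr x; have yL := Lp_repr y.
rewrite -clsZ// -clsD ?(LpZ p1)// koopman_cls ?(LpD p1) ?(LpZ p1)//.
by rewrite clsD ?(LpZ p1) ?Lp_comp// clsZ ?Lp_comp.
Qed.

Definition Koopman : {linear V -> V} :=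
  HB.pack koopman (GRing.isLinear.Build _ _ _ _ _ koopman_linear).

Lemma norm_Koopman x : `|Koopman x| = `|x|.
Proof. by rewrite -[in RHS](cls_repr x) -norm_comp ?Lp_repr. Qed.

End one_map.

Lemma surjective_isometry_Koopman phi psi (phiP : measure_preserving phi)
  (psiP : measure_preserving psi) : cancel phi psi ->
  surjective_isometry (Koopman phiP).
Proof.
move=> phiK; split=> [x|y]; first exact: norm_Koopman.
exists (koopman psi y); rewrite -[RHS]cls_repr.
rewrite -[LHS]/(koopman phi (koopman psi y)) koopman_cls//; last first.
  exact: Lp_comp (Lp_repr _).
by congr cls; apply/funext => t; rewrite phiK.
Qed.

End koopman.

Section cells.
Context (R : realType).
Local Notation T := (measurableTypeR R).
Local Notation mu := (lebesgue01 R).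
Local Notation lambda := (@lebesgue_measure R).
Implicit Types (m : nat) (t a : R).

(** The measure [A |-> lambda (A - a)] agrees with [lambda] on half-open intervals. *)
Lemma lebesgue_translation a (A : set T) : measurable A ->
  lambda ((fun t => t + a) @^-1` A) = lambda A.
Proof.
move=> mA; have mshift : measurable_fun [set: T] (fun t : T => t + a : T).
  by apply: measurable_funD.
pose nu0 := pushforward lambda (fun t : T => t + a : T).
pose nu : {measure set T -> \bar R} :=
  measure_function_pushforward__canonical__measure_function_Measure lambda mshift.
rewrite [RHS](@lebesgue_measure_unique _ nu)// => X [[b c] _ <-].
rewrite /nu /= /pushforward.
have -> : (fun t => t + a) @^-1` `]b, c]%classic = `]b - a, c - a]%classic.
  by apply/seteqP; split=> t /=; rewrite !in_itv/= ltrBlDr lerBrDr.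
rewrite !lebesgue_measure_itv/= !lte_fin ltrD2r; case: ifP => // _.
by rewrite -!EFinD; congr EFin; ring.
Qed.

(** Half-open intervals make the cells with [i <= m] a partition of [0, 1[. Their number
is a successor so that indices range over an inhabited type. *)
Definition cell m (i : nat) : set T := `[i%:R / m.+1%:R, i.+1%:R / m.+1%:R[%classic.

Lemma cellP m (i : nat) t : cell m i t <-> i%:R <= m.+1%:R * t < i.+1%:R.
Proof. by rewrite /cell /= in_itv/= ler_pdivrMr// ltr_pdivlMr// mulrC. Qed.

Lemma measurable_cell m (i : nat) : measurable (cell m i).
Proof. exact: measurable_itv. Qed.

Lemma cell_inj m (i j : nat) t : cell m i t -> cell m j t -> i = j.
Proof.
move=> /cellP/andP[i1 i2] /cellP/andP[j1 j2].
have := le_lt_trans i1 j2; have := le_lt_trans j1 i2.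
by rewrite !ltr_nat !ltnS => ji ij; apply/eqP; rewrite eqn_leq ij ji.
Qed.

Lemma cell_ex m t : 0 <= t < 1 -> exists i : 'I_m.+1, cell m i t.
Proof.
move=> /andP[t0 t1]; have mt0 : 0 <= m.+1%:R * t by rewrite mulr_ge0.
have /andP[h1 h2] := truncn_itv mt0.
have im : (Num.truncn (m.+1%:R * t) < m.+1)%N.
  rewrite -(ltr_nat R) (le_lt_trans h1)// -[ltRHS]mulr1 ltr_pM2l//.
by exists (Ordinal im); apply/cellP; rewrite h1 h2.
Qed.

Lemma cell_sub01 m (i : 'I_m.+1) t : cell m i t -> 0 <= t < 1.
Proof.
move=> /cellP/andP[i1 i2]; have m0 : 0 < m.+1%:R :> R by [].
have := le_trans (ler0n _ _) i1; rewrite pmulr_rge0// => -> /=.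
have : m.+1%:R * t < m.+1%:R * 1.
  by rewrite mulr1 (lt_le_trans i2)// ler_nat.
by rewrite ltr_pM2l.
Qed.

Lemma ae_01 : {ae mu, forall t, 0 <= t < 1}.
Proof.
exists (~` `[0, 1[%classic); split.
- by apply: measurableC; exact: measurable_itv.
- rewrite /lebesgue01/= /mfrestr /mrestr.
  have -> : ~` `[0, 1[%classic `&` `[0, 1]%classic = [set (1 : R)].
    apply/seteqP; split=> t /=; rewrite !in_itv/=.
      by move=> [/negP]; rewrite negb_and -ltNge -leNgt; move=> h /andP[h1 h2]; lra.
    by move=> ->; rewrite ltxx lexx ler01 andbF.
  exact: lebesgue_measure_set1.
- by move=> t /=; rewrite in_itv.
Qed.

Lemma ae_cell m : {ae mu, forall t, exists i : 'I_m.+1, cell m i t}.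
Proof. by apply: ae_imply ae_01 => t; exact: cell_ex. Qed.

Lemma lebesgue01_cells m (A : set T) : measurable A ->
  (mu A = \sum_(i < m.+1) lambda (A `&` cell m i))%E.
Proof.
move=> mA.
have mAc (i : 'I_m.+1) : measurable (A `&` cell m i).
  by apply: measurableI => //; exact: measurable_cell.
rewrite -[LHS]/(lambda (A `&` `[0, 1]%classic)).
have -> : A `&` `[0, 1]%classic =
    \big[setU/set0]_(i < m.+1) (A `&` cell m i) `|` (A `&` [set 1]).
  apply/seteqP; split=> t /=.
    rewrite in_itv/= => -[At /andP[t0]]; rewrite le_eqVlt => /predU1P[t1|t1].
      by right.
    have [i it] : exists i : 'I_m.+1, cell m i t by apply: cell_ex; rewrite t0 t1.
    by left; rewrite (bigD1 i)//=; left.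
  case=> [|[At t1]]; last by split=> //; rewrite t1 in_itv/= ler01 lexx.
  elim/big_rec: _ => // i X _ IH [[At ct]|/IH//]; split=> //.
  by have /andP[t0 t1] := cell_sub01 ct; rewrite in_itv/= t0 ltW.
have m11 : measurable [set (1 : R)] by [].
have m1 : measurable (A `&` [set (1 : R)]) by exact: measurableI.
rewrite measureU0//; last 2 first.
- exact: bigsetU_measurable.
- apply/eqP; rewrite eq_le measure_ge0 andbT -(lebesgue_measure_set1 (1 : R)).
  by apply: le_measure; [exact/mem_set|exact/mem_set|move=> t []].
rewrite (measure_bigsetU_ord lambda xpredT)//.
apply/trivIsetP => i j _ _ ij; apply/seteqP; split=> // t [[_ ti] [_ tj]].
by move/eqP: ij; apply; apply/val_inj; exact: cell_inj ti tj.
Qed.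

Definition fstep m (c : 'I_m.+1 -> R) (t : T) : R :=
  \sum_(i < m.+1) c i * \1_(cell m i) t.

Lemma fstepE m (c : 'I_m.+1 -> R) (i : 'I_m.+1) t : cell m i t -> fstep c t = c i.
Proof.
move=> it; rewrite /fstep (bigD1 i)//= indicE mem_set// mulr1 big1 ?addr0// => j ji.
rewrite indicE memNset ?mulr0// => jt; move/eqP: ji; apply.
by apply/val_inj; exact: cell_inj jt it.
Qed.

Lemma fstep_out m (c : 'I_m.+1 -> R) t :
  (forall i : 'I_m.+1, ~ cell m i t) -> fstep c t = 0.
Proof.
by move=> it; rewrite /fstep big1// => i _; rewrite indicE memNset ?mulr0//; exact: it.
Qed.

Lemma measurable_fstep m (c : 'I_m.+1 -> R) : measurable_fun [set: T] (fstep c).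
Proof.
apply: measurable_sum => i; apply: measurable_funM => //.
by apply: measurable_indic; exact: measurable_cell.
Qed.

Lemma fstep_comp m (c d e : 'I_m.+1 -> R) (op : R -> R -> R) t : op 0 0 = 0 ->
  (forall i : 'I_m.+1, e i = op (c i) (d i)) -> fstep e t = op (fstep c t) (fstep d t).
Proof.
move=> op0 eE; have [[i it]|nt] := pselect (exists i : 'I_m.+1, cell m i t).
  by rewrite !(fstepE _ it).
by rewrite !fstep_out// => i it; apply: nt; exists i.
Qed.

Section permutations.
Variable m : nat.
Implicit Types s : {perm 'I_m.+1}.

(** The rearrangement that translates the i-th cell onto the cell of index [s i]; being
the identity outside [0, 1[ makes it a bijection of the line. *)
Definition tau s (t : T) : T :=
  t + fstep (fun i => ((s i)%:R - i%:R) / m.+1%:R) t.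

Lemma tauE s (i : 'I_m.+1) t : cell m i t ->
  tau s t = t + ((s i)%:R - i%:R) / m.+1%:R.
Proof. by move=> it; rewrite /tau (fstepE _ it). Qed.

Lemma cell_shift (i j : nat) t :
  cell m j (t + (j%:R - i%:R) / m.+1%:R) <-> cell m i t.
Proof.
have m0 : m.+1%:R != 0 :> R by [].
rewrite !cellP mulrDr mulrCA mulfV// mulr1 addrA [_ + j%:R]addrC -addrA.
rewrite -[X in X <= _]addr0 lerD2l subr_ge0.
by rewrite -[X in _ < X]natr1 ltrD2l ltrBlDl natr1.
Qed.

Lemma tau_cell s (i : 'I_m.+1) t : cell m i t -> cell m (s i) (tau s t).
Proof. by move=> it; rewrite (tauE _ it); apply/cell_shift. Qed.

Lemma tau_out s t : (forall i : 'I_m.+1, ~ cell m i t) -> tau s t = t.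
Proof. by move=> it; rewrite /tau fstep_out ?addr0. Qed.

Lemma tauK s : cancel (tau s) (tau s^-1%g).
Proof.
move=> t; have [[i it]|nt] := pselect (exists i : 'I_m.+1, cell m i t).
  rewrite (tauE _ (tau_cell s it)) (tauE _ it) permK -addrA -mulrDl.
  by rewrite [_ + (i%:R - _)]addrC subrKA subrr mul0r addr0.
have nt' (i : 'I_m.+1) : ~ cell m i t by move=> it; apply: nt; exists i.
by rewrite (tau_out s)// tau_out.
Qed.

Lemma measurable_tau s : measurable_fun [set: T] (tau s).
Proof. by apply: measurable_funD => //; exact: measurable_fstep. Qed.

(** On each cell, [tau s] is a translation onto another cell. *)
Lemma tau_preserving s : measure_preserving mu (tau s).
Proof.
split; first exact: measurable_tau.
move=> A mA; have mtA : measurable (tau s @^-1` A).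
  by rewrite -[_ @^-1` _]setTI; exact: measurable_tau.
rewrite (lebesgue01_cells m mA) (lebesgue01_cells m mtA).
rewrite [RHS](reindex_inj (@perm_inj _ s)); apply: eq_bigr => i _ /=.
rewrite -[RHS](lebesgue_translation (((s i)%:R - i%:R) / m.+1%:R)); last first.
  by apply: measurableI => //; exact: measurable_cell.
congr (lambda _); apply/seteqP; split=> t /=.
  by move=> [At it]; rewrite -(tauE _ it); split=> //; exact: tau_cell.
by move=> [At /cell_shift it]; rewrite (tauE _ it).
Qed.

Lemma fstep_tau s (c : 'I_m.+1 -> R) t : fstep c (tau s t) = fstep (c \o s) t.
Proof.
have [[i it]|nt] := pselect (exists i : 'I_m.+1, cell m i t).
  by rewrite (fstepE _ (tau_cell s it)) (fstepE _ it).
have nt' (i : 'I_m.+1) : ~ cell m i t by move=> it; apply: nt; exists i.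
by rewrite tau_out// !fstep_out.
Qed.

End permutations.

Lemma cell_div m n N (j : 'I_N.+1) : N.+1 = (m.+1 * n.+1)%N ->
  (j %/ n.+1 < m.+1)%N /\ forall t, cell N j t -> cell m (j %/ n.+1) t.
Proof.
move=> NE; split; first by rewrite ltn_divLR// -NE.
move=> t /cellP/andP[j1 j2]; apply/cellP.
have N_E : N.+1%:R = m.+1%:R * n.+1%:R :> R by rewrite -natrM NE.
have n0 : 0 < n.+1%:R :> R by [].
have c1 : ((j %/ n.+1)%:R * n.+1%:R : R) <= j%:R by rewrite -natrM ler_nat leq_divM.
have c2 : j.+1%:R <= ((j %/ n.+1).+1%:R * n.+1%:R : R).
  by rewrite -natrM ler_nat ltn_ceil.
rewrite -(ler_pM2r n0) -[X in _ && X](ltr_pM2r n0) mulrAC -N_E.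
by rewrite (le_trans c1 j1) (lt_le_trans j2 c2).
Qed.

(** Two partitions in equal cells are refined by the partition whose number of cells is
the product. *)
Lemma common_refinement m n : exists N (f : 'I_N.+1 -> 'I_m.+1) (g : 'I_N.+1 -> 'I_n.+1),
  forall (j : 'I_N.+1) t, cell N j t -> cell m (f j) t /\ cell n (g j) t.
Proof.
pose N := (m.+1 * n.+1).-1.
have N1 : N.+1 = (m.+1 * n.+1)%N by rewrite prednK// muln_gt0.
have N2 : N.+1 = (n.+1 * m.+1)%N by rewrite N1 mulnC.
exists N, (fun j => Ordinal (cell_div j N1).1), (fun j => Ordinal (cell_div j N2).1).
by move=> j t jt; split; [exact: (cell_div j N1).2|exact: (cell_div j N2).2].
Qed.

Lemma fstep_refine m N (f : 'I_N.+1 -> 'I_m.+1) (c : 'I_m.+1 -> R) :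
  (forall (j : 'I_N.+1) t, cell N j t -> cell m (f j) t) -> fstep (c \o f) = fstep c.
Proof.
move=> fP; apply/funext => t.
have [[j jt]|nt] := pselect (exists j : 'I_N.+1, cell N j t).
  by rewrite (fstepE _ jt) (fstepE _ (fP _ _ jt)).
rewrite !fstep_out// => i it; last by apply: nt; exists i.
by apply: nt; apply: cell_ex; exact: cell_sub01 it.
Qed.

End cells.

Section density.
Context (R : realType) (p : R).
Hypothesis p1 : (1 <= p%:E)%E.
Local Notation T := (measurableTypeR R).
Local Notation mu := (lebesgue01 R).
Local Notation V := (LspaceType mu p1).
Local Notation Lp := (Lfun mu p%:E).
Local Notation cls := (@cls _ T R mu p p1).
Implicit Types (x y z : V) (f g : T -> R).

Lemma Lp_fstep m (c : 'I_m.+1 -> R) : fstep c \in Lp.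
Proof.
apply: (le_Lp p1 (measurable_fstep c) (Lp_cst mu p (\sum_i `|c i|))) => t.
rewrite [leRHS]ger0_norm ?sumr_ge0//.
have [[i it]|nt] := pselect (exists i : 'I_m.+1, cell m i t).
  by rewrite (fstepE _ it) (bigD1 i)//= lerDl sumr_ge0.
by rewrite fstep_out ?normr0 ?sumr_ge0// => i it; apply: nt; exists i.
Qed.

Lemma cls_fstepD N (c d : 'I_N.+1 -> R) :
  cls (fstep (fun i => c i + d i)) = cls (fstep c) + cls (fstep d).
Proof.
rewrite -clsD ?Lp_fstep//; congr cls; apply/funext => t.
by apply: (@fstep_comp _ _ c d _ +%R) => //; rewrite addr0.
Qed.

Lemma cls_fstepZ N a (c : 'I_N.+1 -> R) :
  cls (fstep (fun i => a * c i)) = a *: cls (fstep c).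
Proof.
rewrite -clsZ ?Lp_fstep//; congr cls; apply/funext => t.
by apply: (@fstep_comp _ _ c c _ (fun u _ => a * u)) => //; rewrite mulr0.
Qed.

Lemma cls_fstep_sum N (I : Type) (r : seq I) (P : pred I) (c : I -> 'I_N.+1 -> R) :
  cls (fstep (fun i => \sum_(s <- r | P s) c s i)) = \sum_(s <- r | P s) cls (fstep (c s)).
Proof.
elim: r => [|s r ih].
  rewrite big_nil -(scale0r (cls (fstep (fun _ : 'I_N.+1 => 0 : R)))) -cls_fstepZ.
  by congr cls; congr fstep; apply/funext => i; rewrite big_nil mul0r.
rewrite big_cons; case: ifP => Ps; rewrite -ih.
  rewrite -cls_fstepD; congr cls; congr fstep; apply/funext => i.
  by rewrite big_cons Ps.
by congr cls; congr fstep; apply/funext => i; rewrite big_cons Ps.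
Qed.

Definition step_class : set V := [set x | exists m (c : 'I_m.+1 -> R), x = cls (fstep c)].

Lemma submod_step : submod_closed (mem (closure step_class)).
Proof.
apply: submod_closedP.
  apply: subset_closure; exists 0%N, (fun=> 0); rewrite -cls0; congr cls.
  by apply/funext => t; rewrite /fstep big1// => i _; rewrite mul0r.
move=> a x y cx cy B /nbhs_ballP[e /= e0 eB].
pose k := e / (2 * (`|a| + 1)).
have a1 : 0 < `|a| + 1 by rewrite ltr_wpDl.
have k0 : 0 < k by rewrite divr_gt0// mulr_gt0.
have [x' [[m [c x'E]]]] := cx _ (nbhsx_ballx x k k0).
have e2 : 0 < e / 2 by rewrite divr_gt0.
have [y' [[n [c' y'E]]]] := cy _ (nbhsx_ballx y (e / 2) e2).
rewrite -!ball_normE /= => yy' xx'.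
exists (a *: x' + y'); split; last first.
  apply: eB; rewrite -ball_normE /=.
  have -> : a *: x + y - (a *: x' + y') = a *: (x - x') + (y - y').
    by rewrite scalerBr opprD addrACA.
  rewrite (le_lt_trans (ler_normD _ _))// [ltRHS]splitr ler_ltD// normrZ.
  rewrite (@le_trans _ _ ((`|a| + 1) * k))//.
    by rewrite ler_pM// ?lerDl// ltW.
  have -> // : (`|a| + 1) * k = e / 2.
  by rewrite /k; field; rewrite gt_eqF.
have [N [f [g fgP]]] := common_refinement R m n.
exists N, (fun j => a * c (f j) + c' (g j)).
rewrite x'E y'E -clsZ ?Lp_fstep// -clsD ?(LpZ p1) ?Lp_fstep//.
rewrite -(fstep_refine c (fun j t h => (fgP j t h).1)).
rewrite -(fstep_refine c' (fun j t h => (fgP j t h).2)).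
congr cls; apply/funext => t.
apply/esym; apply: (@fstep_comp _ _ (c \o f) (c' \o g) _ (fun u v => a * u + v)) => //.
by rewrite mulr0 addr0.
Qed.

(** The closure of the step functions is a lattice, so that its density will follow from
the results on closed unital sublattices. *)
Lemma sublattice_step : closed_sublattice (closure step_class).
Proof.
apply: closed_sublattice_vabs; [exact: submod_step| |exact: closed_closure].
move=> x cx B /nbhs_ballP[e /= e0 eB].
have [x' [[m [c x'E]]]] := cx _ (nbhsx_ballx x e e0).
rewrite -!ball_normE /= => xx'.
exists (vabs x'); split; last first.
  by apply: eB; rewrite -ball_normE /= (le_lt_trans (dist_vabs _ _)).
exists m, (fun i => `|c i|); rewrite x'E vabs_cls ?Lp_fstep//.
congr cls; apply/funext => t.
apply/esym; apply: (@fstep_comp _ _ c c _ (fun u v => `|u|)) => //.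
exact: normr0.
Qed.

Lemma step_class1 : step_class (Lspace_one mu p1).
Proof.
exists 0%N, (fun=> 1); rewrite -cls1; apply/clsP; rewrite ?Lp_fstep ?Lp_cst//.
by apply: ae_imply (ae_cell R 0) => t [i it] _; rewrite (fstepE _ it).
Qed.

End density.

(** * Approximation by step functions *)

Section step_density.
Context (R : realType) (p : R).
Hypothesis p1 : (1 <= p%:E)%E.
Local Notation T := (measurableTypeR R).
Local Notation mu := (lebesgue01 R).
Local Notation V := (LspaceType mu p1).
Local Notation Lp := (Lfun mu p%:E).
Local Notation cls := (@cls _ T R mu p p1).
Implicit Types (x y z : V) (f g : T -> R).

Let id01 (t : T) : R := t * \1_(`[0, 1[%classic : set T) t.

Let measurable_id01 : measurable_fun [set: T] id01.
Proof.
apply: measurable_funM; first exact: measurable_id.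
by apply: measurable_indic; exact: measurable_itv.
Qed.

Let id01_Lp : id01 \in Lp.
Proof.
apply: (le_Lp p1 measurable_id01 (Lp_cst mu p 1)) => t.
rewrite /id01 indicE normr1; case: (boolP (t \in _)) => [/set_mem|_].
  by rewrite /= in_itv/= mulr1 => /andP[t0 t1]; rewrite ger0_norm// ltW.
by rewrite mulr0 normr0.
Qed.

Let closure_id01 : closure (@step_class R p p1) (cls id01).
Proof.
move=> B /nbhs_ballP[e /= e0 eB].
pose N := `|Lspace_one mu p1| + 1.
have N0 : 0 < N by rewrite ltr_wpDl.
have [m me] : exists m : nat, m.+1%:R^-1 < e / N.
  have eN : 0 < e / N by rewrite divr_gt0.
  have /cvgrPdist_lt /(_ _ eN)[m _ /(_ m (leqnn m))] := @cvg_harmonic R.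
  by rewrite /= sub0r normrN ger0_norm// => mE; exists m.
exists (cls (fstep (fun i : 'I_m.+1 => i%:R / m.+1%:R))); split.
  by exists m, (fun i : 'I_m.+1 => i%:R / m.+1%:R).
apply: eB; rewrite -ball_normE /= -clsB ?Lp_fstep//.
apply: (@le_lt_trans _ _ `|m.+1%:R^-1 *: Lspace_one mu p1|); last first.
  rewrite normrZ ger0_norm//.
  apply: (@le_lt_trans _ _ (m.+1%:R^-1 * N)); last by rewrite -ltr_pdivlMr.
  by rewrite ler_wpM2l// lerDl.
rewrite -cls1 -clsZ ?Lp_cst//; apply: le_norm_cls.
- by rewrite (LpB p1)// Lp_fstep.
- by rewrite (LpZ p1)// Lp_cst.
apply: ae_imply (ae_cell R m) => t [i it]; rewrite (fstepE _ it).
have t01 := cell_sub01 it; rewrite /id01 indicE mem_set ?mulr1; last by rewrite /= in_itv.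
move/cellP : it => /andP[i1 i2].
have m0 : 0 < m.+1%:R :> R by [].
have -> : t - i%:R / m.+1%:R = (m.+1%:R * t - i%:R) / m.+1%:R by field; rewrite gt_eqF.
rewrite normrM ler_piMl//; rewrite -natr1 in i2.
by rewrite ger0_norm ?subr_ge0//; lra.
Qed.

(** The identity function of [0, 1[ is a uniform limit of step functions, and it
generates the Borel sets. *)
Lemma step_dense x : closure (@step_class R p p1) x.
Proof.
set L := closure _; have sL : closed_sublattice L := sublattice_step p1.
have L1 : L (Lspace_one mu p1) by apply: subset_closure; exact: step_class1.
rewrite -[x]cls_repr; apply: (@sublattice_measurable _ _ _ _ _ p1 L sL (@measurable _ T)).
- move=> A mA; have {}mA : measurable A.
    by apply: mA; split=> //; exact: sigma_algebra_measurable.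
  have [mB LB] := L_sets_preimage sL L1 id01_Lp closure_id01 mA.
  split=> //; suff -> : cls \1_A = cls \1_(id01 @^-1` A) by [].
  apply/clsP; rewrite ?indic_Lp//; apply: ae_imply (ae_01 R) => t t01 _.
  rewrite !indicE; congr (nat_of_bool _)%:R; apply/idP/idP => /set_mem h; apply/mem_set.
    by rewrite /= /id01 indicE mem_set ?mulr1//= in_itv.
  by move: h; rewrite /= /id01 indicE mem_set ?mulr1//= in_itv.
- move=> _ B mB; apply: sub_sigma_algebra.
  by have := measurable_funPT (Lspace_repr x) measurableT _ mB.
- exact: Lp_repr.
Qed.

Lemma approx_step x (e : R) : 0 < e ->
  exists m (c : 'I_m.+1 -> R), `|x - cls (fstep c)| < e.
Proof.
move=> e0; have [_ [[m [c ->]]]] := step_dense (nbhsx_ballx x e e0).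
by rewrite -ball_normE /= => xc; exists m, c.
Qed.

(** A step function close to an indicator is rounded to the values 0 and 1, which at most
doubles the distance. *)
Lemma approx_set (A : set T) (e : R) : measurable A -> 0 < e ->
  exists m (b : 'I_m.+1 -> bool),
    `|cls (fun t => `|\1_A t - fstep (fun i => (b i)%:R) t|)| < e.
Proof.
move=> mA e0; have AL := indic_Lp mu p1 mA.
have e2 : 0 < e / 2 by rewrite divr_gt0.
have [m [c cE]] := approx_step (cls \1_A) e2.
have cL := Lp_fstep p1 c.
pose b (i : 'I_m.+1) : bool := 2^-1 < c i; exists m, b.
have bL := Lp_fstep p1 (fun i => (b i)%:R).
apply: (@le_lt_trans _ _ `|2 *: (cls \1_A - cls (fstep c))|); last first.
  by rewrite normrZ ger0_norm// -ltr_pdivlMl// mulrC.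
rewrite -clsB// -clsZ ?(LpB p1)//; apply: le_norm_cls.
- by rewrite (Lp_abs p1)// (LpB p1).
- by rewrite (LpZ p1)// (LpB p1).
apply: ae_imply (ae_cell R m) => t [i it]; rewrite !(fstepE _ it) /b normr_id.
rewrite normrM (@ger0_norm _ 2)// indicE.
have [ci|ci] := ltP; case: (t \in A) => /=.
- by rewrite subrr normr0 mulr_ge0.
- rewrite sub0r normrN normr1 sub0r normrN.
  have := ler_norm (c i); lra.
- rewrite subr0 normr1; have := ler_norm (1 - c i); lra.
- by rewrite subrr normr0 mulr_ge0.
Qed.

(** The functions that factor through [bits As] are the simple functions of the algebra
generated by [As]. *)
Definition bits (As : seq (set T)) (t : T) := [seq `[< A t >] | A <- As].

(** Each cell [j] receives a colour [col j], the value that [bits As] should take on it.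
The set where [bits As] differs from the colour is small, which is expressed by a
function [h] of small norm, at least 1 on that set. The partition refines a given
one. *)
Lemma approx_sets (As : seq (set T)) (e : R) m : 0 < e ->
  (forall A, A \in As -> measurable A) ->
  exists N (f : 'I_N.+1 -> 'I_m.+1) (col : 'I_N.+1 -> seq bool) (h : T -> R),
   [/\ forall (j : 'I_N.+1) (t : T), cell N j t -> cell m (f j) t,
       h \in Lp /\ `|cls h| < e,
       forall t, 0 <= h t &
       forall (j : 'I_N.+1) (t : T), cell N j t -> bits As t <> col j -> 1 <= h t].
Proof.
elim: As e => [|A As ih] e e0 mAs.
  exists m, id, (fun=> [::]), (fun=> 0); split=> //; split; first exact: Lp_cst.
  by rewrite cls0 normr0.
have e2 : 0 < e / 2 by rewrite divr_gt0.
have mA : measurable A by apply: mAs; rewrite in_cons eqxx.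
have [|N [f [col [h [fP [hL he] h0 hcol]]]]] := ih _ e2.
  by move=> B BAs; apply: mAs; rewrite in_cons BAs orbT.
have [n [b be]] := approx_set mA e2.
have [N' [g [k gkP]]] := common_refinement R N n.
have AL := indic_Lp mu p1 mA; have bL := Lp_fstep p1 (fun i => (b i)%:R).
have uL : (fun t => `|\1_A t - fstep (fun i => (b i)%:R) t|) \in Lp.
  by rewrite (Lp_abs p1)// (LpB p1).
exists N', (f \o g), (fun j => b (k j) :: col (g j)),
  (fun t => h t + `|\1_A t - fstep (fun i => (b i)%:R) t|); split.
- by move=> j t jt; apply: fP; have [] := gkP _ _ jt.
- split; first exact: (LpD p1).
  by rewrite clsD// (le_lt_trans (ler_normD _ _))// [ltRHS]splitr ltrD.
- by move=> t; rewrite addr_ge0.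
- move=> j t jt /= ne; have [gj kj] := gkP _ _ jt.
  have [E|/(hcol _ _ gj) h1] := pselect (bits As t = col (g j)); last first.
    by rewrite -[leLHS]addr0 lerD.
  rewrite -[leLHS]add0r lerD// (fstepE _ kj) indicE.
  have : `[< A t >] != b (k j) by apply/eqP => bk; apply: ne; rewrite bk E.
  have -> : (t \in A) = `[< A t >] by [].
  by case: `[< A t >]; case: (b (k j)) => //= _; rewrite ?subr0 ?sub0r ?normrN normr1.
Qed.

End step_density.

(** * The isometric envelope *)

Section envelope_approximation.
Context (R : realType) (p : R).
Hypothesis p1 : (1 <= p%:E)%E.
Local Notation T := (measurableTypeR R).
Local Notation mu := (lebesgue01 R).
Local Notation V := (LspaceType mu p1).
Local Notation Lp := (Lfun mu p%:E).
Local Notation cls := (@cls _ T R mu p p1).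
Implicit Types (x y z : V) (f g : T -> R).
Variable Y : set V.
Local Notation Sig := <<s Sigma_generators Y >>.
Local Notation T' := (g_sigma_algebraType (Sigma_generators Y)).

Lemma measurable_bits (As : seq (set T)) (phi : seq bool -> R) :
  (forall A, A \in As -> Sig A) -> measurable_fun [set: T'] (fun t => phi (bits As t)).
Proof.
elim: As phi => [|A As ih] phi SA; first exact: (@measurable_cst _ _ T' _ _ (phi [::])).
have SAs B : B \in As -> Sig B by move=> BAs; apply: SA; rewrite in_cons BAs orbT.
have GA : Sig A by apply: SA; rewrite in_cons eqxx.
have mA : measurable_fun [set: T'] (\1_A : T' -> R) by exact: measurable_indic.
have -> : (fun t => phi (bits (A :: As) t)) = (fun t => \1_A t * phi (true :: bits As t) +
    (1 - \1_A t) * phi (false :: bits As t)).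
  apply/funext => t; rewrite indicE /=; have -> : (t \in A) = `[< A t >] by [].
  by case: `[< A t >]; rewrite /= ?subrr ?subr0 !mul0r !mul1r ?addr0 ?add0r.
apply: measurable_funD; apply: measurable_funM => //.
- exact: (ih (fun b => phi (true :: b))).
- by apply: measurable_funB.
- exact: (ih (fun b => phi (false :: b))).
Qed.

Lemma bits_Lp (As : seq (set T)) (phi : seq bool -> R) (K : R) :
  (forall A, A \in As -> Sig A) -> (forall b, `|phi b| <= K) ->
  (fun t => phi (bits As t)) \in Lp.
Proof.
move=> SA phiK; apply: (le_Lp p1 _ (Lp_cst mu p K)).
  exact: measurable_fun_trace (@Sigma_sub _ _ _ _ _ p1 Y) _ (measurable_bits phi SA).
by move=> t; rewrite (le_trans (phiK _))// ler_norm.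
Qed.

(** The explicit bound [K] on the values of [phi] serves to control the error made when
[bits As] is replaced by the colour of the cell. *)
Definition bits_approx x (As : seq (set T)) (K e : R) := exists phi : seq bool -> R,
  (forall b, `|phi b| <= K) /\ `|x - cls (fun t => phi (bits As t))| < e.

Lemma bits_approx_cat x (As Bs : seq (set T)) (K K' e : R) : K <= K' ->
  (bits_approx x As K e -> bits_approx x (As ++ Bs) K' e) /\
  (bits_approx x Bs K e -> bits_approx x (As ++ Bs) K' e).
Proof.
have catE t : bits (As ++ Bs) t = bits As t ++ bits Bs t by rewrite /bits map_cat.
move=> KK'; split=> -[phi [phiK xphi]].
  exists (fun b => phi (take (size As) b)); split.
    by move=> b; exact: le_trans (phiK _) KK'.
  have -> // : (fun t => phi (take (size As) (bits (As ++ Bs) t))) =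
    (fun t => phi (bits As t)).
  by apply/funext => t; rewrite catE take_size_cat ?size_map.
exists (fun b => phi (drop (size As) b)); split.
  by move=> b; exact: le_trans (phiK _) KK'.
have -> // : (fun t => phi (drop (size As) (bits (As ++ Bs) t))) = (fun t => phi (bits Bs t)).
by apply/funext => t; rewrite catE drop_size_cat ?size_map.
Qed.

Lemma Env_c_bits_approx x (e : R) : Env_c Y x -> 0 < e -> exists As K,
  (forall A, A \in As -> Sig A) /\ bits_approx x As K e.
Proof.
move=> /Env_cP[f mf [fL ->]] e0.
pose Phi (g : T -> R) := g \in Lp /\ forall e, 0 < e -> exists As K,
  (forall A, A \in As -> Sig A) /\ bits_approx (cls g) As K e.
suff [_] : Phi f by apply.
apply: (@measurable_fun_ind _ T') => //.
- move=> A GA; have AL := indic_Lp mu p1 (Sigma_sub GA); split=> // e' e'0.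
  exists [:: A], 1; split; first by move=> B; rewrite mem_seq1 => /eqP ->.
  exists (fun b => (head false b)%:R); split.
    by move=> b; case: (head _ _); rewrite ?normr0 ?normr1.
  have -> : \1_A = (fun t => (head false (bits [:: A] t))%:R) :> (T -> R).
    by apply/funext => t; rewrite indicE.
  by rewrite subrr normr0.
- move=> a g h [gL Hg] [hL Hh]; split; first by rewrite (LpD p1)// (LpZ p1).
  move=> e' e'0.
  have a1 : 0 < `|a| + 1 by rewrite ltr_wpDl.
  have k0 : 0 < e' / (2 * (`|a| + 1)) by rewrite divr_gt0// mulr_gt0.
  have e2 : 0 < e' / 2 by rewrite divr_gt0.
  have [As [K [SA Ag]]] := Hg _ k0; have [Bs [K' [SB Ah]]] := Hh _ e2.
  have SAB A : A \in As ++ Bs -> Sig A.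
    by rewrite mem_cat => /orP[/SA|/SB].
  have [/(_ Ag)[phi [phiK gphi]] _] :=
    bits_approx_cat (cls g) As Bs (e' / (2 * (`|a| + 1))) (lexx K).
  have [_ /(_ Ah)[psi [psiK hpsi]]] := bits_approx_cat (cls h) As Bs (e' / 2) (lexx K').
  exists (As ++ Bs), (`|a| * K + K'); split=> //.
  have phiL := bits_Lp SAB phiK; have psiL := bits_Lp SAB psiK.
  exists (fun b => a * phi b + psi b); split.
    move=> b; rewrite (le_trans (ler_normD _ _))// lerD// normrM.
    by rewrite ler_wpM2l.
  rewrite clsD ?(LpZ p1)// clsZ// clsD ?(LpZ p1)// clsZ//.
  set u := cls g in gphi *; set v := cls h in hpsi *.
  set u' := cls _ in gphi *; set v' := cls _ in hpsi *.
  have -> : a *: u + v - (a *: u' + v') = a *: (u - u') + (v - v').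
    by rewrite scalerBr opprD addrACA.
  rewrite (le_lt_trans (ler_normD _ _))// [ltRHS]splitr ler_ltD// normrZ.
  apply: (@le_trans _ _ ((`|a| + 1) * (e' / (2 * (`|a| + 1))))).
    by rewrite ler_pM// ?lerDl// ltW.
  have -> // : (`|a| + 1) * (e' / (2 * (`|a| + 1))) = e' / 2.
  by field; rewrite gt_eqF.
- move=> f_ g Pf_ _ ff cg.
  have [||||_ gL cc] := @cvg_cls _ _ _ mu _ p1 f_ g (fun t => `|f t|) => //.
    by move=> n; apply: (@Lp_measurable _ _ _ mu p); case: (Pf_ n).
  by rewrite (Lp_abs p1).
  split=> // e' e'0; have e2 : 0 < e' / 2 by rewrite divr_gt0.
  have /cvgrPdist_lt/(_ _ e2)[n _ /(_ n (leqnn n)) gn] := cc.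
  have [_ /(_ _ e2)[As [K [SA [phi [phiK nphi]]]]]] := Pf_ n.
  exists As, K; split=> //; exists phi; split=> //.
  rewrite -(subrKA (cls (f_ n))) (le_lt_trans (ler_normD _ _))//.
  by rewrite [ltRHS]splitr ltrD.
Qed.

(** Finitely many elements share one list of sets and one bound, obtained by
concatenation. *)
Lemma Env_c_bits_approx_seq (s : seq V) (e : R) : (forall y, y \in s -> Env_c Y y) ->
  0 < e -> exists As K, (forall A, A \in As -> Sig A) /\
    forall y, y \in s -> bits_approx y As K e.
Proof.
move=> + e0; elim: s => [|y s ih] sE; first by exists [::], 0.
have [|As [K [SA AP]]] := ih.
  by move=> z zs; apply: sE; rewrite in_cons zs orbT.
have [|Bs [K' [SB BP]]] := @Env_c_bits_approx y e _ e0.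
  by apply: sE; rewrite in_cons eqxx.
exists (As ++ Bs), (Num.max K K'); split.
  by move=> A; rewrite mem_cat => /orP[/SA|/SB].
move=> z; rewrite in_cons => /orP[/eqP ->|zs].
  have KM : K' <= Num.max K K' by rewrite le_max lexx orbT.
  by have [_ /(_ BP)] := bits_approx_cat y As Bs e KM.
have KM : K <= Num.max K K' by rewrite le_max lexx.
by have [/(_ (AP _ zs))] := bits_approx_cat z As Bs e KM.
Qed.

(** Both functions are bounded by [K], and where they differ [h] is at least 1. *)
Lemma bits_close (As : seq (set T)) N (col : 'I_N.+1 -> seq bool) (h : T -> R)
    (psi : seq bool -> R) (K : R) :
  (forall A, A \in As -> Sig A) -> (forall b, `|psi b| <= K) ->
  h \in Lp -> (forall t, 0 <= h t) ->
  (forall (j : 'I_N.+1) (t : T), cell N j t -> bits As t <> col j -> 1 <= h t) ->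
  `|cls (fun t => psi (bits As t)) - cls (fstep (psi \o col))| <= 2 * K * `|cls h|.
Proof.
move=> SA psiK hL h0 hcol; have K0 : 0 <= K by exact: le_trans (psiK [::]).
have psiL := bits_Lp SA psiK; have fL := Lp_fstep p1 (psi \o col).
have -> : 2 * K * `|cls h| = `|(2 * K) *: cls h|.
  by rewrite normrZ ger0_norm// mulr_ge0.
rewrite -clsB// -clsZ//; apply: le_norm_cls.
- by rewrite (LpB p1).
- by rewrite (LpZ p1).
apply: ae_imply (ae_cell R N) => t [i it]; rewrite (fstepE _ it) /=.
rewrite [leRHS]ger0_norm ?mulr_ge0//.
have [->|/(hcol _ _ it) h1] := pselect (bits As t = col i).
  by rewrite subrr normr0 !mulr_ge0.
rewrite (@le_trans _ _ (2 * K))//; last by rewrite ler_peMr// mulr_ge0.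
by rewrite (le_trans (ler_normB _ _))// mulr_natl mulr2n lerD.
Qed.

Section averaging.
Variables (N : nat) (col : 'I_N.+1 -> seq bool) (c : 'I_N.+1 -> R).

Definition color_perms : {set {perm 'I_N.+1}} :=
  [set s : {perm 'I_N.+1} | [forall i, col (s i) == col i]].

Definition color_mean (i : 'I_N.+1) : R :=
  #|color_perms|%:R^-1 * \sum_(s in color_perms) c (s i).

Lemma color_permsP (s : {perm 'I_N.+1}) : s \in color_perms <-> forall i, col (s i) = col i.
Proof.
rewrite finset.inE; split; first by move=> /forallP sP i; exact/eqP.
by move=> sP; apply/forallP => i; rewrite sP.
Qed.

Lemma color_perms_gt0 : (0 < #|color_perms|)%N.
Proof.
apply/card_gt0P; exists 1%g; apply/color_permsP => i; by rewrite perm1.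
Qed.

(** Two cells of the same colour are exchanged by a transposition that preserves colours,
and the mean over a group is invariant under that group. *)
Lemma color_mean_invariant i j : col i = col j -> color_mean i = color_mean j.
Proof.
move=> ij; congr (_ * _).
rewrite (reindex_inj (@mulgI _ (tperm i j))) /=; apply: eq_big => [s|s _].
  have tcol k : col (tperm i j k) = col k by case: tpermP => [->|->|].
  apply/idP/idP => /color_permsP sP; apply/color_permsP => k.
    by have := sP (tperm i j k); rewrite permM tpermK => ->; rewrite tcol.
  by rewrite permM sP tcol.
by rewrite permM tpermL.
Qed.

Lemma le_color_mean (K : R) i : (forall j, `|c j| <= K) -> `|color_mean i| <= K.
Proof.
move=> cK; have n0 : 0 < #|color_perms|%:R :> R by rewrite ltr0n color_perms_gt0.
rewrite /color_mean normrM normfV (gtr0_norm n0) mulrC ler_pdivrMr//.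
rewrite (le_trans (ler_norm_sum _ _ _))//.
rewrite (@le_trans _ _ (\sum_(s in color_perms) K))//.
  by apply: ler_sum => s _; exact: cK.
by rewrite sumr_const mulr_natr.
Qed.

(** The mean commutes with [fstep], and the triangle inequality applies. *)
Lemma dist_color_mean (e : R) :
  (forall s, s \in color_perms -> `|cls (fstep (c \o s)) - cls (fstep c)| <= e) ->
  `|cls (fstep c) - cls (fstep color_mean)| <= e.
Proof.
move=> He; have n0 : 0 < #|color_perms|%:R :> R by rewrite ltr0n color_perms_gt0.
rewrite /color_mean cls_fstepZ cls_fstep_sum.
have -> : cls (fstep c) = #|color_perms|%:R^-1 *: \sum_(s in color_perms) cls (fstep c).
  by rewrite sumr_const -[cls _ *+ _]scaler_nat scalerA mulVf ?scale1r// gt_eqF.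
rewrite -scalerBr -sumrB normrZ normfV (gtr0_norm n0) mulrC ler_pdivrMr//.
rewrite (le_trans (ler_norm_sum _ _ _))//.
rewrite (@le_trans _ _ (\sum_(s in color_perms) e))//.
  by apply: ler_sum => s sG; rewrite distrC; exact: He.
by rewrite sumr_const mulr_natr.
Qed.

End averaging.

(** See the averaging argument at the top. The distance [5 e] splits as [e] from [x] to a
step function [c], [3 e] from [c] to its mean over the permutations preserving
colours, since each of them moves [c] by less than [3 e], and [e] from that mean to a
function of the sets [As]. *)
Lemma Env_c_approx x (s : seq V) (e eta : R) : 0 < e -> 0 < eta ->
  (forall y, y \in s -> Env_c Y y) ->
  (forall U : {linear V -> V}, surjective_isometry U ->
    (forall y, y \in s -> `|U y - y| < eta) -> `|U x - x| < e) ->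
  exists2 z, Env_c Y z & `|x - z| < 5 * e.
Proof.
move=> e0 eta0 sE H.
have eta8 : 0 < eta / 8 by rewrite divr_gt0.
have [As [K [SA AP]]] := Env_c_bits_approx_seq sE eta8.
have [m [c0 xc0]] := approx_step x e0.
pose K0 := \sum_i `|c0 i|; pose KK := `|K| + K0 + 1.
have K00 : 0 <= K0 by rewrite sumr_ge0.
have KK0 : 0 < KK by rewrite ltr_wpDl// addr_ge0.
(* [2 * KK] is the Lipschitz constant of [bits_close]; with [e1] the error made when
passing from the sets to the colours is below both [eta / 8] and [e] *)
pose e1 := Num.min (eta / 8) e / (2 * KK).
have e10 : 0 < e1 by rewrite divr_gt0 ?mulr_gt0// lt_min eta8 e0.
have mAs A : A \in As -> measurable A by move=> /SA; exact: Sigma_sub.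
have [N [f [col [h [fP [hL he] h0 hcol]]]]] := approx_sets p1 m e10 mAs.
have hmin : 2 * KK * `|cls h| < Num.min (eta / 8) e.
  by rewrite mulrC -ltr_pdivlMr// mulr_gt0.
pose c := c0 \o f; have cE : fstep c = fstep c0 by exact: fstep_refine.
rewrite -cE in xc0.
have cK i : `|c i| <= K0 by rewrite /K0 (bigD1 (f i))//= lerDl sumr_ge0.
have Uc (t : {perm 'I_N.+1}) : t \in color_perms col ->
    `|cls (fstep (c \o t)) - cls (fstep c)| <= 3 * e.
  move=> /color_permsP tP.
  pose U := Koopman p1 (tau_preserving R t).
  have Uiso : surjective_isometry U.
    exact: (surjective_isometry_Koopman p1 (tau_preserving R t)
      (tau_preserving R t^-1%g) (@tauK R N t)).
  have UE (d : 'I_N.+1 -> R) : U (cls (fstep d)) = cls (fstep (d \o t)).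
    rewrite -[LHS]/(koopman (tau t) (cls (fstep d))).
    rewrite (koopman_cls p1 (tau_preserving R t) (Lp_fstep p1 d)).
    by congr cls; apply/funext => u; rewrite fstep_tau.
  have Unorm z : `|U z| = `|z| by case: Uiso.
  clearbody U.
  have Us y : y \in s -> `|U y - y| < eta.
    move=> ys; have [phi [phiK yphi]] := AP _ ys.
    have phiKK b : `|phi b| <= KK.
      rewrite (le_trans (phiK b))// (le_trans (ler_norm K))// /KK -addrA lerDl.
      by rewrite addr_ge0.
    have := bits_close SA phiKK hL h0 hcol; set y1 := cls _ in yphi *.
    set y2 := cls _ => y12.
    have Uy2 : U y2 = y2.
      by rewrite /y2 UE; congr cls; congr fstep; apply/funext => i /=; rewrite tP.
    have yy2 : `|y - y2| < eta / 4.
      rewrite -(subrKA y1) (le_lt_trans (ler_normD _ _))//.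
      have : Num.min (eta / 8) e <= eta / 8 by rewrite ge_min lexx.
      lra.
    have -> : U y - y = U (y - y2) - (y - y2) by rewrite linearB Uy2 opprB subrKA.
    rewrite (le_lt_trans (ler_normB _ _))// Unorm; lra.
  have := H U Uiso Us; rewrite -UE; set x' := cls _ in xc0 *.
  have -> : U x' - x' = U (x' - x) + (U x - x) + (x - x').
    by rewrite linearB !addrA !subrK.
  move=> Uxx; rewrite (le_trans (ler_normD _ _))//.
  have := ler_normD (U (x' - x)) (U x - x); rewrite Unorm distrC; lra.
(* the mean factors through the colours; colours that are not attained get value 0 *)
pose psi b := if [pick i | col i == b] is Some i then color_mean col c i else 0.
have psiE : psi \o col = color_mean col c.
  apply/funext => i; rewrite /psi /=; case: pickP => [j /eqP ji|/(_ i)]; last by rewrite eqxx.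
  exact: color_mean_invariant.
have psiKK b : `|psi b| <= KK.
  rewrite /psi; case: pickP => [j _|_]; last by rewrite normr0 ltW.
  rewrite (le_trans (le_color_mean col j cK))// /KK; have := normr_ge0 K; lra.
exists (cls (fun t => psi (bits As t))).
  apply/Env_cP; exists (fun t => psi (bits As t)); first exact: measurable_bits.
  by split=> //; exact: bits_Lp psiKK.
have := bits_close SA psiKK hL h0 hcol; rewrite psiE.
have := dist_color_mean Uc; set x1 := cls (fstep c) in xc0 *.
set x2 := cls (fstep _); set z := cls _ => x12 zx2.
rewrite -(subrKA x1) (le_lt_trans (ler_normD _ _))//.
have := ler_normD (x1 - x2) (x2 - z); rewrite subrKA (distrC x2).
have : Num.min (eta / 8) e <= e by rewrite ge_min lexx orbT.
lra.
Qed.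

End envelope_approximation.

(** Otherwise, pick for every finite set [s] and every [k] an isometry violating the
conclusion for the part of [s] included in [Y]. Indexed by the pairs [(s, k)], these
isometries form a net converging to the identity on [Y] but not at [x]. *)
Lemma Env_finite (R : realType) (X : normedModType R) (Y : set X) x (e : R) :
  Env Y x -> 0 < e -> exists (s : seq X) (k : nat),
    (forall y, y \in s -> Y y) /\
    forall U : {linear X -> X}, surjective_isometry U ->
      (forall y, y \in s -> `|U y - y| < k.+1%:R^-1) -> `|U x - x| < e.
Proof.
move=> Ex e0; apply: contrapT => none.
pose close_on (s : seq X) k (U : {linear X -> X}) :=
  forall y, y \in s -> Y y -> `|U y - y| < k.+1%:R^-1.
have bad (i : seq X * nat) : exists U : {linear X -> X},
    [/\ surjective_isometry U, close_on i.1 i.2 U & e <= `|U x - x|].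
  apply: contrapT => noU; apply: none.
  exists [seq y <- i.1 | `[< Y y >]], i.2; split.
    by move=> y; rewrite mem_filter => /andP[/asboolP].
  move=> U Uiso Us; rewrite ltNge; apply/negP => eU; apply: noU; exists U; split=> //.
  by move=> y ys Yy; apply: Us; rewrite mem_filter ys andbT; apply/asboolP.
have [U UP] := choice bad.
pose le (i j : seq X * nat) := {subset i.1 <= j.1} /\ (i.2 <= j.2)%N.
have dir : directed le.
  split; first exact: (inhabits ([::], 0%N)).
  - by move=> i; split.
  - move=> i j k [ij1 ij2] [jk1 jk2]; split; last exact: leq_trans jk2.
    by move=> y /ij1/jk1.
  - move=> i j; exists (i.1 ++ j.1, maxn i.2 j.2); split; split=> /=.
    + by move=> y yi; rewrite mem_cat yi.
    + exact: leq_maxl.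
    + by move=> y yj; rewrite mem_cat yj orbT.
    + exact: leq_maxr.
have FF := tails_proper dir.
have /cvgrPdistC_lt/(_ _ e0)[i _ near_i] : U i x @[i --> tails le] --> x.
  apply: (Ex _ _ _ dir) => [i|y Yy]; first by case: (UP i).
  apply/cvgrPdistC_lt => r r0.
  have /cvgrPdist_lt /(_ _ r0)[k _ /(_ k (leqnn k))] := @cvg_harmonic R.
  rewrite /= sub0r normrN ger0_norm// => kr.
  exists ([:: y], k) => // j [jy jk]; have [_ Uj _] := UP j.
  have yj : y \in j.1 by apply: jy; rewrite mem_head.
  apply: (lt_trans (Uj _ yj Yy)); apply: le_lt_trans kr.
  by rewrite lef_pV2 ?posrE// ler_nat ltnS.
have : `|U i x - x| < e by apply: near_i; split.
by rewrite ltNge; have [_ _ ->] := UP i.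
Qed.

Lemma Env_sub_Env_c (R : realType) (p : R) (p1 : (1 <= p%:E)%E)
    (Y : set (LspaceType (lebesgue01 R) p1)) : Env Y `<=` Env_c Y.
Proof.
move=> x Ex; have [_ cE] := one_complemented_closed (one_complemented_Env_c Y).
apply: cE => B /nbhs_ballP[e /= e0 eB].
have e5 : 0 < e / 5 by rewrite divr_gt0.
have [s [k [sY Hs]]] := Env_finite Ex e5.
have k0 : 0 < k.+1%:R^-1 :> R by rewrite invr_gt0.
have [z Ez xz] := Env_c_approx e5 k0 (fun y ys => sub_Env_c (sY y ys)) Hs.
exists z; split=> //; apply: eB; rewrite -ball_normE /=.
by rewrite (lt_le_trans xz)// mulrC mulfVK.
Qed.

Theorem theorem3p12 (R : realType) (p : R) (p1 : (1 <= p%:E)%E)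
    (Y : set (LspaceType (lebesgue01 R) p1)) :
  p != 2 ->
  submod_closed (mem Y) ->
  Y (Lspace_one (lebesgue01 R) p1) ->
  exists Z : set (LspaceType (lebesgue01 R) p1),
    [/\ is_Env_min Y Z, Env Y = Lat Y, Lat Y = Env_c Y & Env_c Y = Z].
Proof.
move=> p2 _ Y1; exists (Env_c Y); split=> //.
- split; [exact: one_complemented_Env_c|exact: sub_Env_c|move=> W W1c YW].
  have W1 := YW _ Y1.
  by apply: Env_c_sub => //; exact: one_complemented_sublattice.
- rewrite Lat_Env_c//; apply/seteqP; split; first exact: Env_sub_Env_c.
  exact: Env_c_sub_Env.
- exact: Lat_Env_c.
Qed.
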